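(* Let $\mathcal B_0$ be a nonempty open subset of $\Omega=(0,L)$, let $\psi$ satisfy the standing weight assumption below, and let $\mathcal B$ be an open subset of $\Omega$ with $\mathcal B_0\subset\subset\mathcal B$. For $\lambda\ge1$ sufficiently large there exist constants $C>0$, $\tau_0\ge1$, $h_0>0$, $\epsilon_0>0$, depending on $\mathcal B,\mathcal B_0,T,\lambda$, such that $$ \begin{aligned} &\tau^{-1}\iint_Q \bar{\mathtt t}^-\!\big(e^{2\tau\theta\varphi}\theta^{-1}\big)\big(|D_{\bar t}q|^2+|\Delta_h\bar{\mathtt t}^-q|^2\big)+\tau\iint_Q\bar{\mathtt t}^-\!\big(e^{2\tau\theta\varphi}\theta\big)|\partial_h\bar{\mathtt t}^-q|^2\\ &\quad+\tau\iint_Q\bar{\mathtt t}^-\!\big(e^{2\tau\theta\varphi}\theta\big)|\overline{\partial_h\bar{\mathtt t}^-q}|^2+\tau^3\iint_Q\bar{\mathtt t}^-\!\big(e^{2\tau\theta\varphi}\theta^3\big)(\bar{\mathtt t}^-q)^2\\ &\le C\Big(\iint_Q\bar{\mathtt t}^-\!\big(e^{2\tau\theta\varphi}\big)|L q|^2+\tau^3\iint_{\mathcal B\times(0,T)}\bar{\mathtt t}^-\!\big(e^{2\tau\theta\varphi}\theta^3\big)(\bar{\mathtt t}^-q)^2\Big)\\ &\quad+Ch^{-2}\Big(\int_\Omega\big|e^{\tau\theta(t_{1/2})\varphi}q^{1/2}\big|^2+\int_\Omega\big|e^{\tau\theta(t_{M+1/2})\varphi}q^{M+1/2}\big|^2\Big)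 \end{aligned} $$ for all $\tau\ge\tau_0(T+T^2)$, all $0<h\le h_0$, all $\Delta t>0$ and all $0<\delta\le 1/2$ satisfying $$\frac{\tau^4\Delta t}{\delta^4T^6}\le\epsilon_0\quad\text{and}\quad\frac{\tau h}{\delta T^2}\le\epsilon_0,$$ and for every fully-discrete function $q=(q^{n+1/2})_{n=0}^{M}$ with $q^{n+1/2}_0=q^{n+1/2}_{N+1}=0$ for $n\in\{0,\dots,M-1\}$. Here $(Lq)^n:=-(D_{\bar t}q)^n-\Delta_h q^{n-1/2}$, $n=1,\dots,M$.
   Context: Grids: $L>0$, $\Omega=(0,L)$, $T>0$, integers $N,M\ge1$, $h=L/(N+1)$, $\Delta t=T/M$, $x_i=ih$ ($i=0,\dots,N+1$), $x_{i+1/2}=(i+\tfrac12)h$ ($i=0,\dots,N$), $t_n=n\Delta t$, $t_{n+1/2}=(n+\tfrac12)\Delta t$ ($n=0,\dots,M$; note $t_{M+1/2}>T$). Space-discrete functions: a primal function $u=(u_i)_{i=1}^N$ (extended by boundary values $u_0,u_{N+1}$, here always $0$); a dual function $v=(v_{i+1/2})_{i=0}^N$. Operators: $(\partial_h u)_{i+1/2}=(u_{i+1}-u_i)/h$ ($i=0,\dots,N$); for dual $v$, $(\bar\partial_h v)_i=(v_{i+1/2}-v_{i-1/2})/h$ and $\bar v_i=(v_{i+1/2}+v_{i-1/2})/2$ ($i=1,\dots,N$); $\Delta_h u=\bar\partial_h\partial_h u$, i.e. $(\Delta_hu)_i=(u_{i+1}-2u_i+u_{i-1})/h^2$; $\overline{\partial_h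 u}_i=(u_{i+1}-u_{i-1})/(2h)$. Discrete integrals: $\int_\Omega u=\sum_{i=1}^N h u_i$ for primal $u$, $\int_\Omega v=\sum_{i=0}^Nhv_{i+1/2}$ for dual $v$; for $\mathcal B\subset\Omega$ the sums are restricted to the indices whose grid point lies in $\mathcal B$. A continuous function of $x$ appearing in a product is sampled at the same grid points (primal or dual) as the discrete function it multiplies. Fully discrete functions: $q=(q^{n+1/2})_{n=0}^M$, each $q^{n+1/2}$ a primal space function. For $n=1,\dots,M$: $(D_{\bar t}q)^n=(q^{n+1/2}-q^{n-1/2})/\Delta t$, $(\bar{\mathtt t}^-q)^n=q^{n-1/2}$; for a continuous function $f(t,x)$, $\bar{\mathtt t}^-(f)$ denotes $f(t_{n-1/2},\cdot)$ at index $n$. Double integrals: $\iint_QF=\sum_{n=1}^M\Delta t\int_\Omega F^n$ and $\iint_{\mathcal B\times(0,T)}F=\sum_{n=1}^M\Delta t\int_{\mathcal B}F^n$. Weights: $\tilde\Omega$ is an open interval containing $[0,L]$. Standing weight assumption: $\psi\in C^k(\overline{\tilde\Omega})$ for $k$ sufficiently large, $\psi>0$ in $\tilde\Omega$, $|\psi'|\ge c>0$ in $\tilde\Omega\setminus\mathcal B_0$, and, in a small neighborhood of each boundary point, $\psi'\ge c$ near $0$ and $\psi'\le-c$ near $L$ (i.e. outward normal derivative $\le -c$); e.g. $\psi(x)=C-(x-x_0)^2$ with $x_0\in\mathcal B_0$, $C$ large. Let $K>\|\psi\|_{C(\overline\Omega)}$, $\lambda>0$, $\varphi(x)=e^{\lambda\psi(x)}-e^{\lambda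 K}<0$, and for $0<\delta<1/2$, $\theta(t)=\frac{1}{(t+\delta T)(T+\delta T-t)}$ on $(-\delta T,T+\delta T)$. *)

(* Defs.v *)
From Stdlib Require Import Reals Lra Lia ClassicalEpsilon.
From Coquelicot Require Import Coquelicot.
Open Scope R_scope.

Fixpoint sumR (f : nat -> R) (n : nat) : R :=
  match n with O => 0 | S n' => sumR f n' + f n' end.
Definition sum_range (m n : nat) (f : nat -> R) : R :=
  sumR (fun j => f (m + j)%nat) (S n - m).

Definition indic (P : Prop) : R :=
  if excluded_middle_informative P then 1 else 0.

Definition hstep (L : R) (N : nat) : R := L / INR (N + 1).
Definition dtstep (T : R) (M : nat) : R := T / INR M.
Definition xp (L : R) (N i : nat) : R := INR i * hstep L N.
Definition xd (L : R) (N i : nat) : R := (INR i + / 2) * hstep L N.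
Definition thalf (T : R) (M n : nat) : R := (INR n + / 2) * dtstep T M.

Definition varphi (psi : R -> R) (lam K : R) (x : R) : R :=
  exp (lam * psi x) - exp (lam * K).
Definition theta (T delta : R) (t : R) : R :=
  / ((t + delta * T) * (T + delta * T - t)).
Definition wgt (psi : R -> R) (lam K T delta tau : R) (p : Z) (t x : R) : R :=
  exp (2 * tau * theta T delta t * varphi psi lam K x)
  * powerRZ (theta T delta t) p.

(* ---------- fully discrete functions ----------
   A fully discrete function q = (q^{n+1/2})_{n=0..M} is encoded as
   q : nat -> nat -> R with  q n i = q^{n+1/2}_i  (i = 0..N+1). *)

Definition Dtb (T : R) (M : nat) (q : nat -> nat -> R) (n i : nat) : R :=
  (q n i - q (n - 1)%nat i) / dtstep T M.
Definition tbm (q : nat -> nat -> R) (n i : nat) : R := q (n - 1)%nat i.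
(* primal u (indices 0..N+1): (partial_h u)_{i+1/2}, dual, i = 0..N *)
Definition dh (L : R) (N : nat) (u : nat -> R) (i : nat) : R :=
  (u (S i) - u i) / hstep L N.
Definition lap (L : R) (N : nat) (u : nat -> R) (i : nat) : R :=
  (u (S i) - 2 * u i + u (i - 1)%nat) / (hstep L N ^ 2).
Definition dhbar (L : R) (N : nat) (u : nat -> R) (i : nat) : R :=
  (u (S i) - u (i - 1)%nat) / (2 * hstep L N).
Definition Lop (L T : R) (N M : nat) (q : nat -> nat -> R) (n i : nat) : R :=
  - Dtb T M q n i - lap L N (q (n - 1)%nat) i.

(* primal: sum_{i=1}^N h F_i ; dual: sum_{i=0}^N h F_{i+1/2} *)
Definition int_p (L : R) (N : nat) (F : nat -> R) : R :=
  sum_range 1 N (fun i => hstep L N * F i).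
Definition int_d (L : R) (N : nat) (F : nat -> R) : R :=
  sum_range 0 N (fun i => hstep L N * F i).
Definition int_pB (L : R) (N : nat) (B : R -> Prop) (F : nat -> R) : R :=
  sum_range 1 N (fun i => hstep L N * indic (B (xp L N i)) * F i).
Definition iint (T : R) (M : nat) (G : nat -> R) : R :=
  sum_range 1 M (fun n => dtstep T M * G n).

Definition in_closure (A : R -> Prop) (x : R) : Prop :=
  forall eps : R, 0 < eps -> exists y, A y /\ Rabs (x - y) < eps.
Definition compactly_contained (A B : R -> Prop) : Prop :=
  (exists Mb : R, forall x, A x -> Rabs x <= Mb) /\
  (forall x, in_closure A x -> B x).
Definition Ck_on (k : nat) (a b : R) (psi : R -> R) : Prop :=
  forall x, a < x < b -> forall j : nat, (j <= k)%nat ->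
    ex_derive_n psi j x /\ continuous (Derive_n psi j) x.

(* Main.v *)
(* Conjugating with [z = e^{s phi} q], [s = tau theta], turns [e^{s phi} Lap_h e^{- s phi}] into the
   sum of a symmetric and a skew-symmetric tridiagonal operator, with coefficients [cosh d] and
   [sinh d], where [d] is the increment of [s phi] along an edge.  By the addition formulas their
   cross term is, up to boundary terms of the right sign, the sum over the nodes of
   [sinh (d+ - d-) (cosh (d+ + d-) z^2 - z+ z-)], a discrete form of
   [s phi'' (z'^2 - z z'') + 2 s^3 phi'' phi'^2 z^2].  Testing the symmetric part against the
   additional multiplier [s mu z], [mu = kap e^{lam psi}] with [kap] proportional to [lam], makes the
   gradient term coercive everywhere, because [phi'' + mu > 0], while the zero-order term stays
   coercive off [B0], because there [phi'' > mu] once [lam] is large; no cut-off is needed.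
   In time, the polarisation identity and telescoping of the quadratic form of the symmetric part
   leave the end-point terms, of size [h^{-2}], and errors that are absorbed since [s^4 dt] and
   [s h] are small. *)

Require Import Defs.
From Stdlib Require Import Reals ZArith Lra Lia ClassicalEpsilon.
From Coquelicot Require Import Coquelicot.
Open Scope R_scope.

(** * Sums and hyperbolic functions *)

(** Let [X] be the symmetric part applied to [z] and [Y] the time difference of [z] plus the skew
    part. The equation reads [X + Y = - residual] up to errors, and in its square both [X ^ 2] and
    [Y ^ 2] are kept because each pays for something that the weighted left side cannot. The product
    z+ z- in the cross term hides an error s h^2 phi'' (Lap_h z)^2. No gradient term controls it, so
    Lap_h z is expressed through [X], and the error becomes small with s h. The variation of the
    exponential weight over one time step leaves errors in the time difference of [z]. That
    difference is [Y] minus a first-order operator, so [Y ^ 2] and the gradient term absorb them. No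
    condition ties [dt] to [h ^ 2]: the Laplacian sits at the earlier time, so the form of the
    increment z' - z enters the polarisation identity with the sign that makes its gradient part
    nonnegative. Only its zero-order part, of relative size s^2 dt, is left to absorb. A single [G]
    bounds all data from above and a single [c] bounds the coercive quantities from below; the
    thresholds are explicit powers of them, so each absorption is a numerical comparison. *)

Lemma sumR_ext f g n :
  (forall j, (j < n)%nat -> f j = g j) -> sumR f n = sumR g n.
Proof.
induction n as [|n IH]; simpl; intros H; [reflexivity|].
rewrite IH, (H n); auto with arith.
Qed.

Lemma sumR_le f g n :
  (forall j, (j < n)%nat -> f j <= g j) -> sumR f n <= sumR g n.
Proof.
induction n as [|n IH]; simpl; intros H; [lra|].
apply Rplus_le_compat; [apply IH; auto with arith | apply H; auto with arith].
Qed.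

Lemma sumR_plus f g n : sumR (fun j => f j + g j) n = sumR f n + sumR g n.
Proof. induction n as [|n IH]; simpl; [lra|rewrite IH; lra]. Qed.

Lemma sumR_minus f g n : sumR (fun j => f j - g j) n = sumR f n - sumR g n.
Proof. induction n as [|n IH]; simpl; [lra|rewrite IH; lra]. Qed.

Lemma sumR_scal k f n : sumR (fun j => k * f j) n = k * sumR f n.
Proof. induction n as [|n IH]; simpl; [lra|rewrite IH; lra]. Qed.

Lemma sumR_ge0 f n : (forall j, (j < n)%nat -> 0 <= f j) -> 0 <= sumR f n.
Proof.
induction n as [|n IH]; simpl; intros H; [lra|].
apply Rplus_le_le_0_compat; [apply IH; auto with arith | apply H; auto with arith].
Qed.

Lemma sumR_telescope F n : sumR (fun j => F j - F (S j)) n = F O - F n.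
Proof. induction n as [|n IH]; simpl; [lra|rewrite IH; lra]. Qed.

Lemma sumR_abs f n : Rabs (sumR f n) <= sumR (fun j => Rabs (f j)) n.
Proof.
induction n as [|n IH]; simpl; [rewrite Rabs_R0; lra|].
eapply Rle_trans; [apply Rabs_triang|lra].
Qed.

Lemma sumR_succ_l f n : sumR f (S n) = f O + sumR (fun j => f (S j)) n.
Proof.
induction n as [|n IH]; [simpl; lra|].
change (sumR f (S (S n))) with (sumR f (S n) + f (S n)).
rewrite IH; simpl; lra.
Qed.

Lemma cosh_ge_1 x : 1 <= cosh x.
Proof.
unfold cosh.
assert (H := exp_pos x). assert (E : exp x * exp (-x) = 1).
{ rewrite <- exp_plus, Rplus_opp_r; apply exp_0. }
assert (H' := exp_pos (-x)).
assert (H2 := pow2_ge_0 (exp x - exp (-x))).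
destruct (Rle_dec 2 (exp x + exp (-x))); [lra|].
assert (0 < (2 - (exp x + exp (-x))) * (2 + (exp x + exp (-x)))) by (apply Rmult_lt_0_compat; lra).
nra.
Qed.

Lemma exp_le_3_of_abs x : Rabs x <= 1 -> exp x <= 3.
Proof.
intros H. apply Rabs_le_between in H.
apply Rle_trans with (exp 1); [|apply exp_le_3].
destruct (Req_dec x 1) as [->|Hx]; [lra|].
left; apply exp_increasing; lra.
Qed.

Lemma cosh_le_3 x : Rabs x <= 1 -> cosh x <= 3.
Proof.
intros H. assert (H1 := exp_le_3_of_abs x H).
assert (H2 := exp_le_3_of_abs (-x)). rewrite Rabs_Ropp in H2. specialize (H2 H).
unfold cosh; lra.
Qed.

Lemma mvt_0 (f f' : R -> R) x :
  (forall t, derivable_pt_lim f t (f' t)) ->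
  exists c, Rabs c <= Rabs x /\ f x - f 0 = f' c * x.
Proof.
intros H. destruct (Rtotal_order 0 x) as [Hx|[<-|Hx]].
- destruct (MVT_cor2 f f' 0 x Hx (fun c _ => H c)) as (c & E & Hc).
  exists c; split; [rewrite !Rabs_right; lra|rewrite E; ring].
- exists 0; split; [lra|ring].
- destruct (MVT_cor2 f f' x 0 Hx (fun c _ => H c)) as (c & E & Hc).
  exists c; split; [rewrite !Rabs_left; lra|lra].
Qed.

Lemma sinh_mvt x : exists c, Rabs c <= Rabs x /\ sinh x = cosh c * x.
Proof.
destruct (mvt_0 sinh cosh x derivable_pt_lim_sinh) as (c & Hc & E).
exists c; split; [exact Hc|]. rewrite sinh_0 in E; lra.
Qed.

Lemma sinh_abs_le x : Rabs x <= 1 -> Rabs (sinh x) <= 3 * Rabs x.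
Proof.
intros H. destruct (sinh_mvt x) as (c & Hc & ->).
rewrite Rabs_mult. apply Rmult_le_compat_r; [apply Rabs_pos|].
assert (H1 := cosh_ge_1 c). rewrite Rabs_right by lra.
apply cosh_le_3; lra.
Qed.

Lemma sinh_ge x : 0 <= x -> x <= sinh x.
Proof.
intros H. destruct (sinh_mvt x) as (c & Hc & ->).
assert (H1 := cosh_ge_1 c). nra.
Qed.

Lemma sinh_sq_ge x : x ^ 2 <= sinh x ^ 2.
Proof.
destruct (sinh_mvt x) as (c & Hc & ->).
assert (H1 := cosh_ge_1 c). assert (0 <= x^2) by nra.
assert (H2 : 1 <= cosh c ^ 2) by nra.
replace ((cosh c * x)^2) with (cosh c ^2 * x^2) by ring.
assert (0 <= (cosh c ^ 2 - 1) * x^2) by (apply Rmult_le_pos; lra). lra.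
Qed.

Lemma sinh_sq_le x : Rabs x <= 1 -> sinh x ^ 2 <= 9 * x ^ 2.
Proof.
intros H. apply sinh_abs_le in H.
rewrite <- (pow2_abs (sinh x)), <- (pow2_abs x).
assert (H1 := Rabs_pos (sinh x)). assert (H2 := Rabs_pos x). nra.
Qed.

(** In the half exponentials of x and y and their inverses both sides are polynomials, equal modulo
    a a' = b b' = 1. All later bounds on differences of [cosh] go through this product of two
    [sinh]. *)
Lemma cosh_minus x y :
  cosh x - cosh y = 2 * sinh ((x + y) / 2) * sinh ((x - y) / 2).
Proof.
unfold cosh, sinh.
set (a := exp (x/2)). set (b := exp (y/2)).
set (a' := exp (-(x/2))). set (b' := exp (-(y/2))).
assert (Ea : a * a' = 1) by (unfold a, a'; rewrite <- exp_plus, Rplus_opp_r; apply exp_0).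
assert (Eb : b * b' = 1) by (unfold b, b'; rewrite <- exp_plus, Rplus_opp_r; apply exp_0).
replace (exp x) with (a*a) by (unfold a; rewrite <- exp_plus; f_equal; field).
replace (exp y) with (b*b) by (unfold b; rewrite <- exp_plus; f_equal; field).
replace (exp (-x)) with (a'*a') by (unfold a'; rewrite <- exp_plus; f_equal; field).
replace (exp (-y)) with (b'*b') by (unfold b'; rewrite <- exp_plus; f_equal; field).
replace (exp ((x+y)/2)) with (a*b) by (unfold a, b; rewrite <- exp_plus; f_equal; field).
replace (exp (-((x+y)/2))) with (a'*b') by (unfold a', b'; rewrite <- exp_plus; f_equal; field).
replace (exp ((x-y)/2)) with (a*b') by (unfold a, b'; rewrite <- exp_plus; f_equal; field).
replace (exp (-((x-y)/2))) with (a'*b) by (unfold a', b; rewrite <- exp_plus; f_equal; field).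
replace (2 * ((a * b - a' * b') / 2) * ((a * b' - a' * b) / 2))
  with ((a*a*(b*b') - (a*a')*(b*b) - (a*a')*(b'*b') + a'*a'*(b*b'))/2) by field.
rewrite Ea, Eb; field.
Qed.

Lemma cosh_m1 x : cosh x - 1 = 2 * sinh (x / 2) ^ 2.
Proof.
rewrite <- cosh_0, cosh_minus, Rplus_0_r, Rminus_0_r; ring.
Qed.

Lemma cosh_m1_ge x : x ^ 2 / 2 <= cosh x - 1.
Proof. rewrite cosh_m1. assert (H := sinh_sq_ge (x/2)). nra. Qed.

Lemma cosh_m1_le x : Rabs x <= 1 -> cosh x - 1 <= 5 * x ^ 2.
Proof.
intros H. rewrite cosh_m1.
assert (H1 := sinh_sq_le (x/2)).
assert (Rabs (x/2) <= 1).
{ unfold Rdiv; rewrite Rabs_mult, (Rabs_right (/2)) by lra. lra. }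
specialize (H1 H0). nra.
Qed.

(** Evenness of [cosh] gives the factor [m]. For exponents of size s h that differ by a multiple of
    h, division by h^2 then leaves a bounded quantity. *)
Lemma cosh_lip x y m : Rabs x <= m -> Rabs y <= m -> m <= 1 ->
  Rabs (cosh x - cosh y) <= 9 * m * Rabs (x - y).
Proof.
intros Hx Hy Hm. rewrite cosh_minus, !Rabs_mult, (Rabs_right 2) by lra.
apply Rabs_le_between in Hx. apply Rabs_le_between in Hy.
assert (H1 : Rabs ((x+y)/2) <= m) by (apply Rabs_le; lra).
assert (H2 : Rabs ((x-y)/2) <= 1) by (apply Rabs_le; lra).
assert (H1' : Rabs ((x+y)/2) <= 1) by lra.
apply sinh_abs_le in H1'. apply sinh_abs_le in H2.
assert (E : Rabs ((x-y)/2) = Rabs (x-y) / 2).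
{ unfold Rdiv; rewrite Rabs_mult, (Rabs_right (/2)) by lra. reflexivity. }
rewrite E in H2.
assert (H3 := Rabs_pos (sinh ((x+y)/2))). assert (H4 := Rabs_pos (sinh ((x-y)/2))).
assert (H5 := Rabs_pos (x-y)).
apply Rle_trans with (2 * (3 * m) * (3 * (Rabs (x-y)/2))); [|lra].
apply Rmult_le_compat; lra.
Qed.

Lemma sinh_lip x y : Rabs x <= 1 -> Rabs y <= 1 ->
  Rabs (sinh x - sinh y) <= 3 * Rabs (x - y).
Proof.
assert (W : forall x y, x < y -> Rabs x <= 1 -> Rabs y <= 1 ->
  Rabs (sinh x - sinh y) <= 3 * Rabs (x - y)).
{ clear x y. intros x y H Hx Hy.
  destruct (MVT_cor2 sinh cosh x y H (fun c _ => derivable_pt_lim_sinh c)) as (c & E & Hc).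
  rewrite Rabs_minus_sym, E, Rabs_mult, (Rabs_minus_sym x).
  apply Rmult_le_compat_r; [apply Rabs_pos|].
  assert (H1 := cosh_ge_1 c). rewrite Rabs_right by lra.
  apply cosh_le_3, Rabs_le. apply Rabs_le_between in Hx. apply Rabs_le_between in Hy. lra. }
intros Hx Hy. destruct (Rtotal_order x y) as [H|[->|H]].
- auto.
- rewrite !Rminus_diag, Rabs_R0; lra.
- rewrite Rabs_minus_sym, (Rabs_minus_sym x). auto.
Qed.

(** A lower bound for either sign of x. It is applied to x = s phi'' h^2 without knowledge of the
    sign of phi'', and there the loss is quadratic in s h^2. *)
Lemma sinh_ge_quad x : Rabs x <= 1 -> x - 5 * x ^ 2 <= sinh x.
Proof.
intros H. destruct (sinh_mvt x) as (c & Hc & ->).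
assert (H1 := cosh_ge_1 c).
assert (H2 : cosh c - 1 <= 5 * c^2) by (apply cosh_m1_le; lra).
rewrite <- (pow2_abs c) in H2.
assert (Hc0 := Rabs_pos c).
destruct (Rle_dec 0 x) as [Hx|Hx]; [nra|].
rewrite (Rabs_left x) in * by lra.
assert (cosh c - 1 <= 5 * (-x)) by nra. nra.
Qed.

Lemma exp_m1_abs_le x : Rabs x <= 1 -> Rabs (exp x - 1) <= 3 * Rabs x.
Proof.
intros H. destruct (mvt_0 exp exp x derivable_pt_lim_exp) as (c & Hc & E).
rewrite exp_0 in E. rewrite E, Rabs_mult.
apply Rmult_le_compat_r; [apply Rabs_pos|].
rewrite Rabs_right by (assert (H1 := exp_pos c); lra).
apply exp_le_3_of_abs; lra.
Qed.

Lemma exp_taylor1 x : Rabs x <= 1 -> Rabs (exp x - 1 - x) <= 3 * x ^ 2.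
Proof.
intros H. destruct (mvt_0 exp exp x derivable_pt_lim_exp) as (c & Hc & E).
rewrite exp_0 in E.
assert (H1 : Rabs (exp c - 1) <= 3 * Rabs c) by (apply exp_m1_abs_le; lra).
replace (exp x - 1 - x) with ((exp c - 1) * x) by lra.
rewrite Rabs_mult, <- (pow2_abs x).
assert (H2 := Rabs_pos x). assert (H3 := Rabs_pos c). nra.
Qed.

(** * The pointwise estimate *)

Lemma Rmult_abs_le x y a b : Rabs x <= a -> Rabs y <= b -> Rabs (x * y) <= a * b.
Proof.
intros Hx Hy. rewrite Rabs_mult.
apply Rmult_le_compat; auto using Rabs_pos.
Qed.

Lemma Rmult_ge_of_abs W w y Y : Rabs W <= w -> Rabs y <= Y -> - (w * Y) <= W * y.
Proof.
intros HW Hy. assert (H := Rmult_abs_le _ _ _ _ HW Hy).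
apply Rabs_le_between in H. lra.
Qed.

Lemma abs_mul_young k x y : 0 < k -> Rabs (x * y) <= k / 2 * x ^ 2 + / (2 * k) * y ^ 2.
Proof.
intros Hk.
assert (E : / (2 * k) = /k / 2) by (field; lra). rewrite E.
assert (Hi : 0 < / k) by (apply Rinv_0_lt_compat; lra).
assert (K1 : k * / k = 1) by (apply Rinv_r; lra).
assert (H1 := pow2_ge_0 (k * x - y)). assert (H2 := pow2_ge_0 (k * x + y)).
apply Rabs_le.
assert (0 <= /k * (k * x - y)^2) by (apply Rmult_le_pos; lra).
assert (0 <= /k * (k * x + y)^2) by (apply Rmult_le_pos; lra).
replace (/k * (k * x - y)^2) with ((k * /k) * (k * x^2 - 2 * x * y) + /k * y^2) in H by ring.
replace (/k * (k * x + y)^2) with ((k * /k) * (k * x^2 + 2 * x * y) + /k * y^2) in H0 by ring.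
rewrite K1 in *. lra.
Qed.

Lemma abs_mul_le_sq x y : Rabs (x * y) <= / 2 * x ^ 2 + / 2 * y ^ 2.
Proof. assert (H := abs_mul_young 1 x y Rlt_0_1). rewrite Rmult_1_r in H. lra. Qed.

Lemma sq_le_of_abs x a : Rabs x <= a -> x ^ 2 <= a ^ 2.
Proof. intros H. rewrite <- pow2_abs. assert (H' := Rabs_pos x). nra. Qed.

Lemma sq_sum3 x y z : (x + y + z) ^ 2 <= 3 * (x ^ 2 + y ^ 2 + z ^ 2).
Proof.
assert (H1 := pow2_ge_0 (x - y)). assert (H2 := pow2_ge_0 (y - z)).
assert (H3 := pow2_ge_0 (x - z)). nra.
Qed.

Lemma sq_sum2 x y : (x + y) ^ 2 <= 2 * (x ^ 2 + y ^ 2).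
Proof. assert (H1 := pow2_ge_0 (x - y)). nra. Qed.

(* Every quantity is normalised by its natural power of [s] and [h];
   [u + h * vp] and [u - h * vm] are the values at the two neighbours of the node carrying [u]. *)
Lemma local_coercivity (G c s h tau E P mu cp cm a u vp vm X o : R) :
  1 <= G -> 0 < c <= 1 -> 0 < h <= 1 -> 1 <= tau -> 0 < s ->
  s * h <= c / (200 * G ^ 3) -> 200 * G ^ 2 / c <= s -> 200 * G ^ 2 / c <= tau ->
  Rabs E <= G -> 0 <= P <= G -> 0 <= cp <= G -> 0 <= cm <= G -> 0 <= mu <= G ->
  Rabs a <= G * s ^ 2 / tau -> c <= E + mu ->
  0 <= o -> (o = 1 \/ (mu <= E /\ c <= E * P)) ->
  let k := cp * (u + h * vp) + cm * (u - h * vm) in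
  c / 4 * (s ^ 3 * u ^ 2 + s * (vp ^ 2 + vm ^ 2)) - 6 * G ^ 2 * o * (s ^ 3 * u ^ 2) - X ^ 2 / 8
  <= s ^ 3 * E * P * u ^ 2 + s / 2 * (E + mu) * (vp ^ 2 + vm ^ 2)
     - s / 2 * h ^ 2 * E * (X - a * u - s ^ 2 * k) ^ 2
     - s * (E - mu) * u * (X - a * u) + s ^ 3 * (E - mu) * u * k.
Proof.
intros HG Hc Hh Htau Hs Hsh Hs0 Ht0 HE HP Hcp Hcm Hmu Ha HEm Ho Hobs k.
set (Q := s ^ 3 * u ^ 2). set (V := s * (vp ^ 2 + vm ^ 2)).
assert (Hs3 : 0 < s ^ 3) by (apply pow_lt; lra).
assert (HQ : 0 <= Q) by (apply Rmult_le_pos; [lra|apply pow2_ge_0]).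
assert (HV : 0 <= V).
{ apply Rmult_le_pos; [lra|]. assert (H1 := pow2_ge_0 vp). assert (H2 := pow2_ge_0 vm). lra. }
assert (HX : 0 <= X ^ 2) by apply pow2_ge_0.
assert (G2 : 1 <= G ^ 2) by nra. assert (G3 : G ^ 2 <= G ^ 3) by nra.
set (eta := s * h) in *.
assert (Heta : 0 < eta) by (apply Rmult_lt_0_compat; lra).
assert (HE1 : G ^ 3 * eta <= c / 200).
{ apply Rmult_le_compat_l with (r := G ^ 3) in Hsh; [|lra].
  replace (G ^ 3 * (c / (200 * G ^ 3))) with (c / 200) in Hsh by (field; lra). exact Hsh. }
assert (HEm2 : Rabs (E - mu) <= 2 * G).
{ apply Rabs_le_between in HE. apply Rabs_le. lra. }
assert (HGs : G ^ 2 / s <= c / 200).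
{ apply Rmult_le_reg_r with s; [lra|]. unfold Rdiv at 1. rewrite Rmult_assoc, Rinv_l, Rmult_1_r by lra.
  apply Rmult_le_compat_l with (r := c / 200) in Hs0; [|lra].
  replace (c / 200 * (200 * G ^ 2 / c)) with (G ^ 2) in Hs0 by (field; lra). lra. }
assert (HGt : G ^ 2 / tau <= c / 200).
{ apply Rmult_le_reg_r with tau; [lra|]. unfold Rdiv at 1. rewrite Rmult_assoc, Rinv_l, Rmult_1_r by lra.
  apply Rmult_le_compat_l with (r := c / 200) in Ht0; [|lra].
  replace (c / 200 * (200 * G ^ 2 / c)) with (G ^ 2) in Ht0 by (field; lra). lra. }
assert (Ha' : Rabs a <= G * s ^ 2).
{ apply Rle_trans with (1 := Ha). unfold Rdiv. rewrite <- (Rmult_1_r (G * s ^ 2)) at 2.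
  apply Rmult_le_compat_l; [apply Rmult_le_pos; [lra|apply pow2_ge_0]|].
  rewrite <- Rinv_1. apply Rinv_le_contravar; lra. }
(* The offsets [h * vp] and [h * vm] inside [k] cost a factor [eta = s h] relative to [Q] and
   [V]. *)
assert (T5 : forall W v, Rabs W <= 2 * G * G ->
   - (G ^ 2 * eta * (Q + s * v ^ 2)) <= s ^ 3 * W * u * (h * v)).
{ intros W v HW.
  replace (s ^ 3 * W * u * (h * v)) with (W * (eta * (s ^ 2 * u * v))) by (unfold eta; ring).
  replace (G ^ 2 * eta * (Q + s * v ^ 2)) with ((2 * G * G) * (eta * (/ 2 * (Q + s * v ^ 2)))) by field.
  apply Rmult_ge_of_abs; [exact HW|].
  rewrite Rabs_mult, (Rabs_right eta) by lra. apply Rmult_le_compat_l; [lra|].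
  assert (H := abs_mul_le_sq (s * u) v).
  replace (s ^ 2 * u * v) with (s * (s * u * v)) by ring.
  rewrite Rabs_mult, (Rabs_right s) by lra.
  apply Rmult_le_compat_l with (r := s) in H; [|lra].
  apply Rle_trans with (1 := H). right. unfold Q. field. }
assert (T5p : - (G ^ 2 * eta * (Q + s * vp ^ 2)) <= s ^ 3 * ((E - mu) * cp) * u * (h * vp)).
{ apply T5. apply Rmult_abs_le; [exact HEm2|]. rewrite Rabs_right; lra. }
assert (T5m : - (G ^ 2 * eta * (Q + s * vm ^ 2)) <= s ^ 3 * (- ((E - mu) * cm)) * u * (h * vm)).
{ apply T5. rewrite Rabs_Ropp. apply Rmult_abs_le; [exact HEm2|]. rewrite Rabs_right; lra. }
(* Young's inequality with weight 16 G spends half of the allowance [X ^ 2 / 8]; the other half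
   covers the second-difference error [T3]. *)
assert (T4a : - (X ^ 2 / 16 + 16 * (G ^ 2 / s) * Q) <= - s * (E - mu) * u * X).
{ replace (- s * (E - mu) * u * X) with ((E - mu) * (- (s * u * X))) by ring.
  replace (X ^ 2 / 16 + 16 * (G ^ 2 / s) * Q) with
    ((2 * G) * (16 * G / 2 * (s * u) ^ 2 + / (2 * (16 * G)) * X ^ 2)).
  2:{ unfold Q. field. lra. }
  apply Rmult_ge_of_abs; [exact HEm2|]. rewrite Rabs_Ropp. apply abs_mul_young. lra. }
assert (T4b : - (2 * (G ^ 2 / tau) * Q) <= s * (E - mu) * u * (a * u)).
{ replace (s * (E - mu) * u * (a * u)) with ((E - mu) * (a * (s * u ^ 2))) by ring.
  replace (2 * (G ^ 2 / tau) * Q) with ((2 * G) * ((G * s ^ 2 / tau) * (s * u ^ 2))).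
  2:{ unfold Q. field. lra. }
  apply Rmult_ge_of_abs; [exact HEm2|]. apply Rmult_abs_le; [exact Ha|].
  rewrite Rabs_right; [lra|]. apply Rle_ge, Rmult_le_pos; [lra|apply pow2_ge_0]. }
assert (Hk : k ^ 2 <= 12 * G ^ 2 * (u ^ 2 + h ^ 2 * (vp ^ 2 + vm ^ 2))).
{ unfold k. replace (cp * (u + h * vp) + cm * (u - h * vm))
    with ((cp + cm) * u + cp * (h * vp) + (- cm) * (h * vm)) by ring.
  apply Rle_trans with (1 := sq_sum3 _ _ _). rewrite !Rpow_mult_distr.
  assert (A1 : (cp + cm) ^ 2 <= 4 * G ^ 2) by nra.
  assert (A2 : cp ^ 2 <= 4 * G ^ 2) by nra.
  assert (A3 : (- cm) ^ 2 <= 4 * G ^ 2) by nra.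
  assert (B1 := pow2_ge_0 u). assert (B2 := pow2_ge_0 (h * vp)). assert (B3 := pow2_ge_0 (h * vm)).
  rewrite Rpow_mult_distr in B2, B3.
  apply Rmult_le_compat_r with (r := u ^ 2) in A1; [|lra].
  apply Rmult_le_compat_r with (r := h ^ 2 * vp ^ 2) in A2; [|lra].
  apply Rmult_le_compat_r with (r := h ^ 2 * vm ^ 2) in A3; [|lra]. lra. }
(* In the application [X - a * u - s ^ 2 * k] is the second difference Lap_h z. Bounding it by [X]
   and lower-order terms is affordable because it only occurs with the factor s h^2. *)
assert (HD : (X - a * u - s ^ 2 * k) ^ 2 <=
   3 * X ^ 2 + 39 * G ^ 2 * s ^ 4 * u ^ 2 + 36 * G ^ 2 * s ^ 4 * h ^ 2 * (vp ^ 2 + vm ^ 2)).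
{ replace (X - a * u - s ^ 2 * k) with (X + (- a) * u + (- s ^ 2) * k) by ring.
  apply Rle_trans with (1 := sq_sum3 _ _ _). rewrite !Rpow_mult_distr.
  rewrite <- Rabs_Ropp in Ha'. apply sq_le_of_abs in Ha'.
  apply Rmult_le_compat_r with (r := u ^ 2) in Ha'; [|apply pow2_ge_0].
  apply Rmult_le_compat_l with (r := (- s ^ 2) ^ 2) in Hk; [|apply pow2_ge_0].
  replace ((- s ^ 2) ^ 2) with (s ^ 4) in * by ring. nra. }
assert (T3 : - (G * eta * (2 * X ^ 2 + 20 * G ^ 2 * (Q + V))) <=
   - (s / 2 * h ^ 2) * E * (X - a * u - s ^ 2 * k) ^ 2).
{ assert (Hsh2 : 0 < s / 2 * h ^ 2) by (apply Rmult_lt_0_compat; [lra|apply pow_lt; lra]).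
  apply Rle_trans with (- ((s / 2 * h ^ 2) * G * (X - a * u - s ^ 2 * k) ^ 2)).
  2:{ apply Rabs_le_between in HE. assert (Y := pow2_ge_0 (X - a * u - s ^ 2 * k)).
      assert (0 <= s / 2 * h ^ 2 * (G - E) * (X - a * u - s ^ 2 * k) ^ 2).
      { apply Rmult_le_pos; [apply Rmult_le_pos; lra|exact Y]. } nra. }
  apply Ropp_le_contravar.
  apply Rmult_le_compat_l with (r := s / 2 * h ^ 2 * G) in HD; [|apply Rmult_le_pos; lra].
  apply Rle_trans with (1 := HD).
  replace (s / 2 * h ^ 2 * G * (3 * X ^ 2 + 39 * G ^ 2 * s ^ 4 * u ^ 2 + 36 * G ^ 2 * s ^ 4 * h ^ 2 * (vp ^ 2 + vm ^ 2)))
   with (G * eta * (3 / 2 * h * X ^ 2 + 39 / 2 * G ^ 2 * eta * Q + 18 * G ^ 2 * eta ^ 3 * V)).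
  2:{ unfold eta, Q, V. field. }
  assert (E1 : eta <= 1).
  { assert (eta <= G ^ 3 * eta) by (rewrite <- (Rmult_1_l eta) at 1; apply Rmult_le_compat_r; lra). lra. }
  apply Rmult_le_compat_l; [apply Rmult_le_pos; lra|].
  assert (eta ^ 3 <= 1). { replace 1 with (1 ^ 3) by ring. apply pow_incr; lra. }
  assert (0 < eta ^ 3) by (apply pow_lt; lra).
  assert (P1 : h * X ^ 2 <= 1 * X ^ 2) by (apply Rmult_le_compat_r; lra).
  assert (P2 : G ^ 2 * (eta * Q) <= G ^ 2 * (1 * Q)) by (apply Rmult_le_compat_l; [lra|apply Rmult_le_compat_r; lra]).
  assert (P3 : G ^ 2 * (eta ^ 3 * V) <= G ^ 2 * (1 * V)) by (apply Rmult_le_compat_l; [lra|apply Rmult_le_compat_r; lra]).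
  assert (0 <= G ^ 2 * Q) by (apply Rmult_le_pos; lra).
  assert (0 <= G ^ 2 * V) by (apply Rmult_le_pos; lra). lra. }
assert (T2 : c / 2 * V <= s / 2 * (E + mu) * (vp ^ 2 + vm ^ 2)).
{ replace (s / 2 * (E + mu) * (vp ^ 2 + vm ^ 2)) with ((E + mu) / 2 * V) by (unfold V; field).
  apply Rmult_le_compat_r; lra. }
(* The complete zero-order coefficient. At unobserved nodes its second summand is nonnegative and
   the first is at least c. At observed nodes the sum is at least -5 G^2, and c <= G^2 turns this
   into c - 6 G^2. *)
assert (T15 : c * Q - 6 * G ^ 2 * o * Q <= E * P * Q + (E - mu) * (cp + cm) * Q).
{ rewrite <- !Rmult_minus_distr_r, <- Rmult_plus_distr_r. apply Rmult_le_compat_r; [exact HQ|].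
  destruct Hobs as [->|[O1 O2]].
  - assert (H1 : - (G * G) <= E * P) by (apply Rmult_ge_of_abs; [exact HE|rewrite Rabs_right; lra]).
    assert (H2 : - ((2 * G) * (2 * G)) <= (E - mu) * (cp + cm)).
    { apply Rmult_ge_of_abs; [exact HEm2|rewrite Rabs_right; lra]. }
    nra.
  - assert (0 <= (E - mu) * (cp + cm)) by (apply Rmult_le_pos; lra).
    assert (0 <= 6 * G ^ 2 * o) by (apply Rmult_le_pos; lra). lra. }
replace (s ^ 3 * E * P * u ^ 2 + s / 2 * (E + mu) * (vp ^ 2 + vm ^ 2)
     - s / 2 * h ^ 2 * E * (X - a * u - s ^ 2 * k) ^ 2
     - s * (E - mu) * u * (X - a * u) + s ^ 3 * (E - mu) * u * k)
 with ((E * P * Q + (E - mu) * (cp + cm) * Q) + s / 2 * (E + mu) * (vp ^ 2 + vm ^ 2)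
   + (- (s / 2 * h ^ 2) * E * (X - a * u - s ^ 2 * k) ^ 2)
   + (- s * (E - mu) * u * X) + s * (E - mu) * u * (a * u)
   + s ^ 3 * ((E - mu) * cp) * u * (h * vp) + s ^ 3 * (- ((E - mu) * cm)) * u * (h * vm)).
2:{ unfold Q, k. ring. }
fold Q V.
assert (F1 : G ^ 2 * eta * Q <= c / 200 * Q).
{ apply Rmult_le_compat_r; [lra|]. apply Rle_trans with (2 := HE1). apply Rmult_le_compat_r; lra. }
assert (F1' : G ^ 2 * eta * V <= c / 200 * V).
{ apply Rmult_le_compat_r; [lra|]. apply Rle_trans with (2 := HE1). apply Rmult_le_compat_r; lra. }
assert (F2 : G ^ 2 / s * Q <= c / 200 * Q) by (apply Rmult_le_compat_r; lra).
assert (F3 : G ^ 2 / tau * Q <= c / 200 * Q) by (apply Rmult_le_compat_r; lra).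
assert (F4 : G * eta * X ^ 2 <= / 200 * X ^ 2).
{ apply Rmult_le_compat_r; [lra|].
  apply Rle_trans with (G ^ 3 * eta); [|lra]. apply Rmult_le_compat_r; [lra|]. nra. }
assert (F5 : G ^ 3 * eta * (Q + V) <= c / 200 * (Q + V)) by (apply Rmult_le_compat_r; lra).
replace (G * eta * (2 * X ^ 2 + 20 * G ^ 2 * (Q + V))) with
  (2 * (G * eta * X ^ 2) + 20 * (G ^ 3 * eta * (Q + V))) in T3 by ring.
replace (G ^ 2 * eta * (Q + s * vp ^ 2)) with (G ^ 2 * eta * Q + G ^ 2 * eta * (s * vp ^ 2)) in T5p by ring.
replace (G ^ 2 * eta * (Q + s * vm ^ 2)) with (G ^ 2 * eta * Q + G ^ 2 * eta * (s * vm ^ 2)) in T5m by ring.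
assert (EV : G ^ 2 * eta * V = G ^ 2 * eta * (s * vp ^ 2) + G ^ 2 * eta * (s * vm ^ 2)) by (unfold V; ring).
assert (cQ : 0 <= c * Q) by (apply Rmult_le_pos; lra).
assert (cV : 0 <= c * V) by (apply Rmult_le_pos; lra).
lra.
Qed.

(** * The conjugated Laplacian *)

Lemma exp_mul_neg x : exp x * exp (- x) = 1.
Proof. rewrite <- exp_plus, Rplus_opp_r; apply exp_0. Qed.

Lemma cosh_sq_minus_sinh_sq x : cosh x ^ 2 - sinh x ^ 2 = 1.
Proof. unfold cosh, sinh. assert (H := exp_mul_neg x). nra. Qed.

Lemma sinh_minus x y : sinh (x - y) = sinh x * cosh y - cosh x * sinh y.
Proof.
unfold cosh, sinh. replace (- (x - y)) with (- x + y) by ring.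
unfold Rminus at 2. rewrite !exp_plus. field.
Qed.

Lemma cosh_plus x y : cosh (x + y) = cosh x * cosh y + sinh x * sinh y.
Proof.
unfold cosh, sinh. replace (- (x + y)) with (- x + - y) by ring.
rewrite !exp_plus. field.
Qed.

(** Both sides are half of sinh 2x - sinh 2y. The right side is a difference between two edges, so
    the diagonal part of the cross term fits into a telescoping flux. *)
Lemma sinh_minus_cosh_plus x y :
  sinh (x - y) * cosh (x + y) = cosh x * sinh x - cosh y * sinh y.
Proof.
rewrite sinh_minus, cosh_plus.
assert (Hx := cosh_sq_minus_sinh_sq x). assert (Hy := cosh_sq_minus_sinh_sq y).
replace ((sinh x * cosh y - cosh x * sinh y) * (cosh x * cosh y + sinh x * sinh y))
 with (cosh x * sinh x * (cosh y ^ 2 - sinh y ^ 2) - cosh y * sinh y * (cosh x ^ 2 - sinh x ^ 2)) by ring.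
rewrite Hx, Hy; ring.
Qed.

Definition dph (s : R) (ph : nat -> R) (j : nat) : R := s * (ph (S j) - ph j).

(* [symp] and [skew] are [h^2] times the symmetric and skew-symmetric parts of
   [z |-> e^{s ph} Lap_h (e^{- s ph} z)]; the value at index [j] belongs to the node [j+1]. *)
Definition symp (s : R) (ph z : nat -> R) (j : nat) : R :=
  cosh (dph s ph (S j)) * z (S (S j)) - 2 * z (S j) + cosh (dph s ph j) * z j.
Definition skew (s : R) (ph z : nat -> R) (j : nat) : R :=
  - sinh (dph s ph (S j)) * z (S (S j)) + sinh (dph s ph j) * z j.

Definition sdiff (f : nat -> R) (j : nat) : R := f (S (S j)) - 2 * f (S j) + f j.

(* [ph] samples the weight, [mu] the multiplier, and [o] is the indicator of the observed nodes. *)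
Record grid_weight (G c h : R) (N : nat) (ph mu o : nat -> R) : Prop := {
  gw_diff : forall j, (j <= N)%nat -> Rabs (ph (S j) - ph j) <= G * h;
  gw_sdiff : forall j, (j < N)%nat -> Rabs (sdiff ph j) <= G * h ^ 2;
  gw_conv : forall j, (j < N)%nat -> 2 * c * h ^ 2 <= sdiff ph j + mu (S j) * h ^ 2;
  gw_obs : forall j, (j < N)%nat -> o (S j) = 1 \/
    (mu (S j) * h ^ 2 <= sdiff ph j /\ c * h ^ 2 <= sdiff ph j /\
     2 * c * h ^ 2 <= (ph (S (S j)) - ph j) ^ 2);
  gw_obs_pos : forall j, 0 <= o j;
  gw_mu : forall j, (j <= S N)%nat -> 0 <= mu j <= G;
  gw_mu_sdiff : forall j, (j < N)%nat -> Rabs (sdiff mu j) <= G * h ^ 2;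
  gw_left : ph O <= ph 1%nat;
  gw_right : ph (S N) <= ph N;
  gw_bound : forall j, (j <= S N)%nat -> Rabs (ph j) <= G }.

(** The two edges at the node [S j]. In the sum over interior nodes an interior edge counts twice
    and a boundary edge once. *)
Definition edges (h : R) (z : nat -> R) (j : nat) : R :=
  ((z (S (S j)) - z (S j)) / h) ^ 2 + ((z (S j) - z j) / h) ^ 2.

Lemma edges_ge0 h z j : 0 <= edges h z j.
Proof. unfold edges. apply Rplus_le_le_0_compat; apply pow2_ge_0. Qed.

(** [F] is the flux through an edge: it collects the terms of the product that involve one edge
    only, made symmetric in the two ends by a [z ^ 2] term. The compensation of that term and the
    product of the two outer values involve both edges, and combine into functions of the sum and
    the difference of the two increments. *)
Lemma symp_skew_local s ph z j :
  let F := fun j => cosh (dph s ph j) * sinh (dph s ph j) * (z j ^ 2 + z (S j) ^ 2)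
     - 2 * sinh (dph s ph j) * z j * z (S j) in
  symp s ph z j * skew s ph z j = F j - F (S j)
   + sinh (dph s ph (S j) - dph s ph j) *
     (cosh (dph s ph (S j) + dph s ph j) * z (S j) ^ 2 - z (S (S j)) * z j).
Proof.
intros F. rewrite Rmult_minus_distr_l, <- !Rmult_assoc, sinh_minus_cosh_plus, sinh_minus.
unfold F, symp, skew. ring.
Qed.

Lemma Rdiv_abs_le x y k : 0 < y -> Rabs x <= k * y -> Rabs (x / y) <= k.
Proof.
intros Hy H. unfold Rdiv. rewrite Rabs_mult, (Rabs_right (/ y)).
2:{ apply Rle_ge, Rlt_le, Rinv_0_lt_compat, Hy. }
apply Rmult_le_reg_r with y; [exact Hy|]. rewrite Rmult_assoc, Rinv_l by lra. lra.
Qed.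

Lemma Rle_div_r_pos k x y : 0 < y -> k * y <= x -> k <= x / y.
Proof.
intros Hy H. apply Rmult_le_reg_r with y; [exact Hy|].
unfold Rdiv. rewrite Rmult_assoc, Rinv_l by lra. lra.
Qed.

(** [local_coercivity] summed over the nodes, with [E] close to phi'', [P] to 2 phi'^2, [cp] and
    [cm] to phi'^2 / 2. The constant 20 G^2 comes from [cosh p - 1 <= 5 * p ^ 2] with |p| <= 2 G s
    h, and c^2 from the product of the lower bounds c for [E] and for [P]. *)
Lemma symp_skew_coercivity (G c h s tau : R) (N : nat) (ph mu o a z : nat -> R) :
  1 <= G -> 0 < c <= 1 -> 0 < h <= 1 -> 1 <= tau -> 0 < s ->
  s * h <= c ^ 2 / (200 * (20 * G ^ 2) ^ 3) ->
  200 * (20 * G ^ 2) ^ 2 / c ^ 2 <= s -> 200 * (20 * G ^ 2) ^ 2 / c ^ 2 <= tau ->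
  grid_weight G c h N ph mu o ->
  (forall j, (j <= S N)%nat -> Rabs (a j) <= G ^ 2 * s ^ 2 / tau) ->
  z O = 0 -> z (S N) = 0 ->
  sumR (fun j => c ^ 2 / 4 * (s ^ 3 * z (S j) ^ 2 + s * edges h z j)
     - 6 * (20 * G ^ 2) ^ 2 * o (S j) * (s ^ 3 * z (S j) ^ 2)
     - (symp s ph z j / h ^ 2 + a (S j) * z (S j)) ^ 2 / 8
     - G / (2 * s ^ 2) * (s ^ 3 * z (S j) ^ 2)) N
  <= sumR (fun j => symp s ph z j * skew s ph z j / h ^ 4) N.
Proof.
intros HG Hc Hh Htau Hs Hsh Hs0 Ht0 W Ha Z0 ZN.
set (F := fun j => cosh (dph s ph j) * sinh (dph s ph j) * (z j ^ 2 + z (S j) ^ 2)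
     - 2 * sinh (dph s ph j) * z j * z (S j)).
(* The flux of a discrete Green formula: [H j - H (S j)] is z^2 times the second difference of mu
   minus mu times the second difference of z^2. The latter equals 2 z times the second difference of
   z plus two squared increments, so adding this flux inserts the multiplier term and leaves only
   the second difference of mu as an error. *)
set (H := fun j => mu j * z (S j) ^ 2 - mu (S j) * z j ^ 2).
set (Phi := fun j => F j / h ^ 4 + s / (2 * h ^ 2) * H j).
assert (h2 : 0 < h ^ 2) by (apply pow_lt; lra).
assert (h4 : 0 < h ^ 4) by (apply pow_lt; lra).
assert (G2 : 1 <= G ^ 2) by nra.
assert (Gam : 20 <= 20 * G ^ 2) by lra.
assert (GG : G <= 20 * G ^ 2) by nra.
assert (Gam3 : 8000 <= (20 * G ^ 2) ^ 3).
{ replace 8000 with (20 ^ 3) by ring. apply pow_incr; lra. }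
assert (eta0 : 0 < s * h) by (apply Rmult_lt_0_compat; lra).
assert (Gam3' : (20 * G ^ 2) ^ 3 * (s * h) <= c ^ 2 / 200).
{ apply Rmult_le_compat_l with (r := (20 * G ^ 2) ^ 3) in Hsh; [|lra].
  replace ((20 * G ^ 2) ^ 3 * (c ^ 2 / (200 * (20 * G ^ 2) ^ 3))) with (c ^ 2 / 200) in Hsh by (field; lra).
  exact Hsh. }
assert (c2 : 0 < c ^ 2 <= c) by nra.
assert (Geta2 : G ^ 2 * (s * h) <= c / 1600).
{ assert (Y : 400 * G ^ 2 <= (20 * G ^ 2) ^ 3).
  { replace ((20 * G ^ 2) ^ 3) with (8000 * (G ^ 2 * G ^ 2) * G ^ 2) by ring.
    apply Rmult_le_compat_r; [lra|]. nra. }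
  apply Rmult_le_compat_r with (r := s * h) in Y; [|lra]. lra. }
assert (Geta : G * (s * h) <= c / 1600).
{ apply Rle_trans with (2 := Geta2). apply Rmult_le_compat_r; [lra|]. nra. }
assert (Hd : forall j, (j <= N)%nat -> Rabs (dph s ph j) <= G * (s * h)).
{ intros j Hj. unfold dph. rewrite Rabs_mult, (Rabs_right s) by lra.
  replace (G * (s * h)) with (s * (G * h)) by ring.
  apply Rmult_le_compat_l; [lra|]. apply (gw_diff _ _ _ _ _ _ _ W); exact Hj. }
(* Since z vanishes at both ends, each flux retains a single square there. Its sign comes from the
   monotonicity of [ph] on the two boundary edges and from mu >= 0. *)
assert (Hbd : 0 <= Phi O - Phi N).
{ assert (F0 : 0 <= F O).
  { unfold F. rewrite Z0. assert (Y := gw_left _ _ _ _ _ _ _ W).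
    assert (Y1 : 0 <= dph s ph O) by (apply Rmult_le_pos; lra).
    assert (Y2 := sinh_ge _ Y1). assert (Y3 := cosh_ge_1 (dph s ph 0)).
    assert (Y4 := pow2_ge_0 (z 1%nat)).
    assert (0 <= cosh (dph s ph 0) * sinh (dph s ph 0) * z 1%nat ^ 2).
    { apply Rmult_le_pos; [apply Rmult_le_pos; lra|lra]. } lra. }
  assert (FN : F N <= 0).
  { unfold F. rewrite ZN. assert (Y := gw_right _ _ _ _ _ _ _ W).
    assert (Y1 : 0 <= - dph s ph N) by (unfold dph; nra).
    assert (Y2 := sinh_ge _ Y1). assert (Y3 := cosh_ge_1 (dph s ph N)).
    assert (Es : sinh (- dph s ph N) = - sinh (dph s ph N)).
    { unfold sinh. rewrite Ropp_involutive. field. }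
    rewrite Es in Y2. assert (Y4 := pow2_ge_0 (z N)).
    assert (0 <= cosh (dph s ph N) * (- sinh (dph s ph N)) * z N ^ 2).
    { apply Rmult_le_pos; [apply Rmult_le_pos; lra|lra]. } lra. }
  assert (H0 : 0 <= H O).
  { unfold H. rewrite Z0. assert (Y := gw_mu _ _ _ _ _ _ _ W 0 ltac:(lia)).
    assert (Y4 := pow2_ge_0 (z 1%nat)). nra. }
  assert (HN : H N <= 0).
  { unfold H. rewrite ZN. assert (Y := gw_mu _ _ _ _ _ _ _ W (S N) ltac:(lia)).
    assert (Y4 := pow2_ge_0 (z N)). nra. }
  unfold Phi. assert (i4 : 0 < / h ^ 4) by (apply Rinv_0_lt_compat; lra).
  assert (i2 : 0 < s / (2 * h ^ 2)) by (apply Rdiv_lt_0_compat; lra).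
  assert (0 <= F 0%nat / h ^ 4 - F N / h ^ 4).
  { unfold Rdiv. rewrite <- Rmult_minus_distr_r. apply Rmult_le_pos; lra. }
  assert (0 <= s / (2 * h ^ 2) * (H 0%nat - H N)) by (apply Rmult_le_pos; lra). lra. }
apply Rle_trans with (sumR (fun j => symp s ph z j * skew s ph z j / h ^ 4
    - (Phi j - Phi (S j))) N).
2:{ rewrite sumR_minus, sumR_telescope. lra. }
apply sumR_le. intros j Hj.
set (e := dph s ph (S j) - dph s ph j).
set (p := dph s ph (S j) + dph s ph j).
assert (D1 := Hd (S j) ltac:(lia)). assert (D0 := Hd j ltac:(lia)).
assert (Ee : e = s * sdiff ph j) by (unfold e, dph, sdiff; ring).
assert (sd := gw_sdiff _ _ _ _ _ _ _ W j Hj).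
assert (sh2 : 0 < s * h ^ 2) by (apply Rmult_lt_0_compat; lra).
assert (He : Rabs e <= G * (s * h ^ 2)).
{ rewrite Ee, Rabs_mult, (Rabs_right s) by lra.
  replace (G * (s * h ^ 2)) with (s * (G * h ^ 2)) by ring. apply Rmult_le_compat_l; lra. }
assert (Hsh2 : s * h ^ 2 <= s * h).
{ replace (s * h ^ 2) with (s * h * h) by ring. rewrite <- (Rmult_1_r (s * h)) at 2.
  apply Rmult_le_compat_l; lra. }
assert (He1 : Rabs e <= 1).
{ apply Rle_trans with (1 := He). apply Rle_trans with (G * (s * h)); [|lra].
  apply Rmult_le_compat_l; lra. }
assert (Hp : Rabs p <= 2 * (G * (s * h))).
{ apply Rle_trans with (1 := Rabs_triang _ _). lra. }
set (E := sinh e / (s * h ^ 2)).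
assert (s2h2 : 0 < s ^ 2 * h ^ 2) by (apply Rmult_lt_0_compat; [apply pow_lt|]; lra).
set (P := (cosh p - 1) / (s ^ 2 * h ^ 2)).
set (cp := (cosh (dph s ph (S j)) - 1) / (s ^ 2 * h ^ 2)).
set (cm := (cosh (dph s ph j) - 1) / (s ^ 2 * h ^ 2)).
assert (HE : Rabs E <= 20 * G ^ 2).
{ apply Rdiv_abs_le; [lra|]. apply Rle_trans with (1 := sinh_abs_le _ He1).
  apply Rle_trans with (3 * G * (s * h ^ 2)); [lra|]. apply Rmult_le_compat_r; [lra|nra]. }
assert (Hcosh : forall x, Rabs x <= 2 * (G * (s * h)) ->
   0 <= (cosh x - 1) / (s ^ 2 * h ^ 2) <= 20 * G ^ 2).
{ intros x Hx. split.
  - apply Rle_div_r_pos; [lra|]. assert (Y := cosh_ge_1 x). lra.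
  - apply Rle_trans with (1 := Rle_abs _). apply Rdiv_abs_le; [lra|].
    assert (Y := cosh_ge_1 x). rewrite Rabs_right by lra.
    apply Rle_trans with (5 * x ^ 2); [apply cosh_m1_le; lra|].
    apply sq_le_of_abs in Hx.
    replace (20 * G ^ 2 * (s ^ 2 * h ^ 2)) with (5 * (2 * (G * (s * h))) ^ 2) by ring. lra. }
assert (HP : 0 <= P <= 20 * G ^ 2) by (apply Hcosh; exact Hp).
assert (HGsh : 0 <= G * (s * h)) by (apply Rmult_le_pos; lra).
assert (Hcp : 0 <= cp <= 20 * G ^ 2) by (apply Hcosh; lra).
assert (Hcm : 0 <= cm <= 20 * G ^ 2) by (apply Hcosh; lra).
assert (Hmu := gw_mu _ _ _ _ _ _ _ W (S j) ltac:(lia)).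
assert (Ha1 : Rabs (a (S j)) <= 20 * G ^ 2 * s ^ 2 / tau).
{ apply Rle_trans with (1 := Ha (S j) ltac:(lia)). unfold Rdiv.
  apply Rmult_le_compat_r; [apply Rlt_le, Rinv_0_lt_compat; lra|].
  apply Rmult_le_compat_r; [apply pow2_ge_0|lra]. }
(* The factor 2 in [gw_conv] pays for the quadratic loss in [sinh_ge_quad], which is needed as [e]
   may be negative. *)
assert (HEm : c ^ 2 <= E + mu (S j)).
{ assert (Y := gw_conv _ _ _ _ _ _ _ W j Hj). assert (Y1 := sinh_ge_quad e He1).
  assert (Y2 : 2 * c * (s * h ^ 2) <= e + mu (S j) * (s * h ^ 2)).
  { rewrite Ee. apply Rmult_le_compat_l with (r := s) in Y; lra. }
  assert (Y3 : 5 * e ^ 2 <= c * (s * h ^ 2)).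
  { apply sq_le_of_abs in He.
    replace ((G * (s * h ^ 2)) ^ 2) with (G ^ 2 * (s * h ^ 2) * (s * h ^ 2)) in He by ring.
    apply Rle_trans with (5 * (G ^ 2 * (s * h ^ 2)) * (s * h ^ 2)); [lra|].
    apply Rmult_le_compat_r; [lra|].
    assert (G ^ 2 * (s * h ^ 2) <= G ^ 2 * (s * h)) by (apply Rmult_le_compat_l; lra). lra. }
  apply Rle_trans with c; [lra|].
  replace (E + mu (S j)) with ((sinh e + mu (S j) * (s * h ^ 2)) / (s * h ^ 2)) by (unfold E; field; lra).
  apply Rle_div_r_pos; [lra|]. lra. }
assert (Hobs : o (S j) = 1 \/ (mu (S j) <= E /\ c ^ 2 <= E * P)).
{ destruct (gw_obs _ _ _ _ _ _ _ W j Hj) as [O1|(O1 & O2 & O3)]; [left; exact O1|right].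
  assert (Y0 : 0 <= sdiff ph j) by (apply Rle_trans with (2 := O2), Rmult_le_pos; lra).
  assert (Y : e <= sinh e) by (apply sinh_ge; rewrite Ee; apply Rmult_le_pos; lra).
  assert (M1 : mu (S j) <= E).
  { apply Rle_div_r_pos; [lra|]. apply Rle_trans with (2 := Y). rewrite Ee.
    apply Rmult_le_compat_l with (r := s) in O1; lra. }
  assert (M2 : c <= E).
  { apply Rle_div_r_pos; [lra|]. apply Rle_trans with (2 := Y). rewrite Ee.
    apply Rmult_le_compat_l with (r := s) in O2; lra. }
  assert (M3 : c <= P).
  { apply Rle_div_r_pos; [lra|]. apply Rle_trans with (2 := cosh_m1_ge p).
    replace (p ^ 2) with (s ^ 2 * (ph (S (S j)) - ph j) ^ 2) by (unfold p, dph; ring).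
    apply Rmult_le_compat_l with (r := s ^ 2) in O3; [lra|apply pow2_ge_0]. }
  split; [exact M1|]. replace (c ^ 2) with (c * c) by ring. apply Rmult_le_compat; lra. }
set (u := z (S j)). set (vp := (z (S (S j)) - z (S j)) / h). set (vm := (z (S j) - z j) / h).
assert (L := local_coercivity (20 * G ^ 2) (c ^ 2) s h tau E P (mu (S j)) cp cm (a (S j)) u vp vm
  (symp s ph z j / h ^ 2 + a (S j) * u) (o (S j)) ltac:(lra) ltac:(lra) Hh Htau Hs Hsh Hs0 Ht0
  HE HP Hcp Hcm ltac:(lra) Ha1 HEm (gw_obs_pos _ _ _ _ _ _ _ W _) Hobs).
cbv zeta in L.
assert (ms := gw_mu_sdiff _ _ _ _ _ _ _ W j Hj).
assert (Mu : - (G / (2 * s ^ 2) * (s ^ 3 * u ^ 2)) <= - (s / (2 * h ^ 2) * (u ^ 2 * sdiff mu j))).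
{ apply Ropp_le_contravar.
  replace (G / (2 * s ^ 2) * (s ^ 3 * u ^ 2)) with (s / (2 * h ^ 2) * (u ^ 2 * (G * h ^ 2))) by (field; lra).
  apply Rmult_le_compat_l; [apply Rlt_le, Rdiv_lt_0_compat; lra|].
  apply Rmult_le_compat_l; [apply pow2_ge_0|]. apply Rle_trans with (2 := ms), Rle_abs. }
rewrite symp_skew_local. fold e p. cbv zeta.
change (cosh (dph s ph j) * sinh (dph s ph j) * (z j ^ 2 + z (S j) ^ 2) -
   2 * sinh (dph s ph j) * z j * z (S j)) with (F j).
change (cosh (dph s ph (S j)) * sinh (dph s ph (S j)) * (z (S j) ^ 2 + z (S (S j)) ^ 2) -
   2 * sinh (dph s ph (S j)) * z (S j) * z (S (S j))) with (F (S j)).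
replace (edges h z j) with (vp ^ 2 + vm ^ 2) by reflexivity. fold u.
eapply Rle_trans; [apply Rplus_le_compat; [exact L | exact Mu]|]. right.
(* What remains is an exact identity: once the hyperbolic functions and the neighbouring values are
   written in the normalised quantities, both sides are the same rational expression. *)
assert (E1 : sinh e = E * (s * h ^ 2)) by (unfold E; field; lra).
assert (E2 : cosh p = 1 + P * (s ^ 2 * h ^ 2)) by (unfold P; field; lra).
assert (E3 : cosh (dph s ph (S j)) = 1 + cp * (s ^ 2 * h ^ 2)) by (unfold cp; field; lra).
assert (E4 : cosh (dph s ph j) = 1 + cm * (s ^ 2 * h ^ 2)) by (unfold cm; field; lra).
assert (E5 : z (S (S j)) = u + h * vp) by (unfold u, vp; field; lra).
assert (E6 : z j = u - h * vm) by (unfold u, vm; field; lra).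
unfold Phi, H, sdiff, symp. rewrite E1, E2, E3, E4, E5, E6. fold u.
clearbody E P cp cm u vp vm.
field. lra.
Qed.

(* The thresholds at which [local_coercivity] applies with [20 G^2] and [c^2] for its [G] and [c]. *)
Definition carl_eps (G c : R) : R := c ^ 2 / (200 * (20 * G ^ 2) ^ 3).
Definition carl_big (G c : R) : R := 200 * (20 * G ^ 2) ^ 2 / c ^ 2.

(** [G ^ 6] cancels the whole power of G in the denominator, and 200 * 20 ^ 3 = 1600000. Hence every
    error with a factor of at most [G ^ 6 * eps] is a tiny multiple of [c ^ 2]. *)
Lemma carl_eps_facts G c : 1 <= G -> 0 < c <= 1 ->
  0 < carl_eps G c /\ G ^ 6 * carl_eps G c = c ^ 2 / 1600000.
Proof.
intros HG Hc. unfold carl_eps. assert (0 < G ^ 2) by (apply pow_lt; lra). split.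
- apply Rdiv_lt_0_compat; [apply pow_lt; lra|].
  apply Rmult_lt_0_compat; [lra|apply pow_lt; lra].
- field. lra.
Qed.

Lemma carl_big_facts G c : 1 <= G -> 0 < c <= 1 ->
  80000 <= carl_big G c /\ G ^ 4 = c ^ 2 / 80000 * carl_big G c.
Proof.
intros HG Hc. unfold carl_big. assert (G2 : 1 <= G ^ 2) by nra.
assert (c2 : 0 < c ^ 2 <= 1) by nra. split.
- apply Rle_div_r_pos; [lra|]. replace ((20 * G ^ 2) ^ 2) with (400 * (G ^ 2 * G ^ 2)) by ring. nra.
- field. lra.
Qed.

Lemma symp_symmetric s ph z y N : z O = 0 -> y O = 0 -> z (S N) = 0 -> y (S N) = 0 ->
  sumR (fun j => symp s ph z j * y (S j)) N = sumR (fun j => symp s ph y j * z (S j)) N.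
Proof.
intros Z0 Y0 ZN YN.
set (K := fun j => cosh (dph s ph j) * (y (S j) * z j - z (S j) * y j)).
rewrite (sumR_ext _ (fun j => symp s ph y j * z (S j) + (K j - K (S j)))).
2:{ intros j _. unfold symp, K. ring. }
rewrite sumR_plus, sumR_telescope. unfold K. rewrite Z0, Y0, ZN, YN. ring.
Qed.

(** Up to the flux [K], the form is minus a weighted sum of squared increments plus the potential c+
    + c- - 2, where c+ and c- are the two [cosh] values at a node. Discarding the squares gives an
    upper bound of order (s h)^2, which after division by h^2 has no negative power of h left. *)
Lemma symp_form_le s ph z N B : z O = 0 -> z (S N) = 0 ->
  (forall j, (j <= N)%nat -> cosh (dph s ph j) - 1 <= B) ->
  sumR (fun j => symp s ph z j * z (S j)) N <= 2 * B * sumR (fun j => z (S j) ^ 2) N.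
Proof.
intros Z0 ZN HB.
set (K := fun j => cosh (dph s ph j) / 2 * (z (S j) ^ 2 - z j ^ 2)).
rewrite <- sumR_scal.
apply Rle_trans with (sumR (fun j => 2 * B * z (S j) ^ 2 - (K j - K (S j))) N).
- apply sumR_le. intros j Hj. unfold symp, K.
  assert (B1 := HB (S j) ltac:(lia)). assert (B0 := HB j ltac:(lia)).
  assert (C1 := cosh_ge_1 (dph s ph (S j))). assert (C0 := cosh_ge_1 (dph s ph j)).
  set (c1 := cosh (dph s ph (S j))) in *. set (c0 := cosh (dph s ph j)) in *.
  assert (P1 : 0 <= c1 / 2 * (z (S (S j)) - z (S j)) ^ 2) by (apply Rmult_le_pos; [lra|apply pow2_ge_0]).
  assert (P0 : 0 <= c0 / 2 * (z (S j) - z j) ^ 2) by (apply Rmult_le_pos; [lra|apply pow2_ge_0]).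
  assert (P2 : 0 <= (2 * B - (c1 + c0 - 2)) * z (S j) ^ 2) by (apply Rmult_le_pos; [lra|apply pow2_ge_0]).
  nra.
- rewrite sumR_minus, sumR_telescope. unfold K. rewrite Z0, ZN.
  assert (C1 := cosh_ge_1 (dph s ph N)). assert (C0 := cosh_ge_1 (dph s ph 0)).
  assert (P1 : 0 <= cosh (dph s ph N) / 2 * z N ^ 2) by (apply Rmult_le_pos; [lra|apply pow2_ge_0]).
  assert (P0 : 0 <= cosh (dph s ph 0) / 2 * z 1%nat ^ 2) by (apply Rmult_le_pos; [lra|apply pow2_ge_0]).
  lra.
Qed.

Lemma sumR_shift_sq z N : z O = 0 ->
  sumR (fun j => z j ^ 2) N <= sumR (fun j => z (S j) ^ 2) N.
Proof.
intros Z0.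
assert (H : sumR (fun j => z j ^ 2 - z (S j) ^ 2) N <= 0).
{ rewrite (sumR_telescope (fun j => z j ^ 2)), Z0. assert (Y := pow2_ge_0 (z N)). lra. }
rewrite sumR_minus in H. lra.
Qed.

Lemma sumR_shift2_sq z N : z (S N) = 0 ->
  sumR (fun j => z (S (S j)) ^ 2) N <= sumR (fun j => z (S j) ^ 2) N.
Proof.
intros ZN.
assert (H : 0 <= sumR (fun j => z (S j) ^ 2 - z (S (S j)) ^ 2) N).
{ rewrite (sumR_telescope (fun j => z (S j) ^ 2)), ZN. assert (Y := pow2_ge_0 (z 1%nat)). lra. }
rewrite sumR_minus in H. lra.
Qed.

(* Abel summation moves the difference from [z] to [a], which is what makes this
   term of lower order although neither factor is. *)
Lemma diag_skew_ge s ph a z N B : z O = 0 -> z (S N) = 0 -> 0 <= B ->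
  (forall j, (j < N)%nat -> Rabs (sinh (dph s ph j) * (a (S j) - a j)) <= B) ->
  - (B * sumR (fun j => z (S j) ^ 2) N) <=
  sumR (fun j => a (S j) * z (S j) * skew s ph z j) N.
Proof.
intros Z0 ZN HB0 HB.
set (K := fun j => sinh (dph s ph j) * a j * z j * z (S j)).
rewrite (sumR_ext (fun j => a (S j) * z (S j) * skew s ph z j)
  (fun j => (K j - K (S j)) + sinh (dph s ph j) * (a (S j) - a j) * (z (S j) * z j))).
2:{ intros j _. unfold skew, K. ring. }
rewrite sumR_plus, sumR_telescope.
assert (K0 : K O = 0) by (unfold K; rewrite Z0; ring).
assert (KN : K N = 0) by (unfold K; rewrite ZN; ring).
rewrite K0, KN.
assert (Sh := sumR_shift_sq z N Z0).
apply Rle_trans with (sumR (fun j => - (B / 2) * z (S j) ^ 2 + - (B / 2) * z j ^ 2) N).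
- rewrite sumR_plus, !sumR_scal.
  apply Rmult_le_compat_l with (r := B / 2) in Sh; lra.
- rewrite Rminus_diag, Rplus_0_l. apply sumR_le. intros j Hj.
  assert (Y := Rmult_ge_of_abs _ _ _ _ (HB j Hj) (abs_mul_le_sq (z (S j)) (z j))). lra.
Qed.

(** The skew part is a first-order operator of size s: written around the value at the node, it has
    two difference quotients with coefficients sinh d / h and a zero-order term whose coefficient is
    of order s by the bound on the second difference of [ph]. The constant 27 is 3 from [sq_sum3]
    times 3^2. *)
Lemma skew_sq_le (G h s : R) ph z j : 1 <= G -> 0 < h <= 1 -> 0 < s -> G * (s * h) <= 1 ->
  Rabs (ph (S j) - ph j) <= G * h -> Rabs (ph (S (S j)) - ph (S j)) <= G * h ->
  Rabs (sdiff ph j) <= G * h ^ 2 ->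
  (skew s ph z j / h ^ 2) ^ 2 <= 27 * G ^ 2 * s ^ 2 * (edges h z j + z (S j) ^ 2).
Proof.
intros HG Hh Hs Hsh H0 H1 H2.
assert (D : forall k, Rabs (ph (S k) - ph k) <= G * h -> Rabs (dph s ph k) <= G * (s * h)).
{ intros k Hk. unfold dph. rewrite Rabs_mult, (Rabs_right s) by lra.
  replace (G * (s * h)) with (s * (G * h)) by ring. apply Rmult_le_compat_l; lra. }
assert (D0 := D j H0). assert (D1 := D (S j) H1).
set (d0 := dph s ph j) in *. set (d1 := dph s ph (S j)) in *.
assert (h2 : 0 < h ^ 2) by (apply pow_lt; lra).
assert (S0 : Rabs (sinh d0 / h) <= 3 * G * s).
{ apply Rdiv_abs_le; [lra|]. apply Rle_trans with (1 := sinh_abs_le d0 ltac:(lra)). lra. }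
assert (S1 : Rabs (sinh d1 / h) <= 3 * G * s).
{ apply Rdiv_abs_le; [lra|]. apply Rle_trans with (1 := sinh_abs_le d1 ltac:(lra)). lra. }
assert (S2 : Rabs ((sinh d1 - sinh d0) / h ^ 2) <= 3 * G * s).
{ apply Rdiv_abs_le; [lra|]. apply Rle_trans with (1 := sinh_lip d1 d0 ltac:(lra) ltac:(lra)).
  replace (d1 - d0) with (s * sdiff ph j) by (unfold d1, d0, dph, sdiff; ring).
  rewrite Rabs_mult, (Rabs_right s) by lra.
  apply Rmult_le_compat_l with (r := s) in H2; [|lra]. lra. }
replace (skew s ph z j / h ^ 2) with
 ((- (sinh d1 / h)) * ((z (S (S j)) - z (S j)) / h) + (- (sinh d0 / h)) * ((z (S j) - z j) / h)
   + (- ((sinh d1 - sinh d0) / h ^ 2)) * z (S j)).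
2:{ unfold skew. fold d0 d1. field. lra. }
apply Rle_trans with (1 := sq_sum3 _ _ _). rewrite !Rpow_mult_distr. unfold edges.
rewrite <- Rabs_Ropp in S0, S1, S2.
apply sq_le_of_abs in S0. apply sq_le_of_abs in S1. apply sq_le_of_abs in S2.
apply Rmult_le_compat_r with (r := ((z (S j) - z j) / h) ^ 2) in S0; [|apply pow2_ge_0].
apply Rmult_le_compat_r with (r := ((z (S (S j)) - z (S j)) / h) ^ 2) in S1; [|apply pow2_ge_0].
apply Rmult_le_compat_r with (r := z (S j) ^ 2) in S2; [|apply pow2_ge_0].
replace ((3 * G * s) ^ 2) with (9 * G ^ 2 * s ^ 2) in * by ring. lra.
Qed.

(** The full symmetric operator; the diagonal [a] carries the time derivative of the weight. [xform]
    is its quadratic form. *)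
Definition xop (h s : R) (ph a z : nat -> R) (j : nat) : R :=
  symp s ph z j / h ^ 2 + a (S j) * z (S j).
Definition xform (h s : R) (ph a z : nat -> R) (N : nat) : R :=
  sumR (fun j => xop h s ph a z j * z (S j)) N.

(** Expanding the form at z' around z leaves the two mixed terms in z and z' - z, which agree by
    [symp_symmetric]. *)
Lemma xform_diff h s ph a z z' N : z O = 0 -> z' O = 0 -> z (S N) = 0 -> z' (S N) = 0 ->
  sumR (fun j => 2 * (xop h s ph a z j * (z' (S j) - z (S j)))) N =
  xform h s ph a z' N - xform h s ph a z N - xform h s ph a (fun i => z' i - z i) N.
Proof.
intros Z0 Z0' ZN ZN'. unfold xform. rewrite <- !sumR_minus.
assert (Y := symp_symmetric s ph z (fun i => z' i - z i) N Z0 ltac:(lra) ZN ltac:(lra)).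
apply (f_equal (Rmult (/ h ^ 2))) in Y. rewrite <- !sumR_scal in Y.
apply Rminus_diag_eq in Y. rewrite <- sumR_minus in Y.
apply Rminus_diag_uniq. rewrite <- sumR_minus. rewrite <- Y.
apply sumR_ext. intros j _. unfold xop, symp, Rdiv. ring.
Qed.

(* With [z = e^{s ph} q] and [z' = e^{s' ph} q'] at the next time, this is
   [e^{s ph} (- (q' - q)/dt - Lap_h q)]. *)
Definition residual (h dt s s' : R) (ph z z' : nat -> R) (j : nat) : R :=
  - (exp ((s - s') * ph (S j)) * z' (S j) - z (S j)) / dt
  - (symp s ph z j + skew s ph z j) / h ^ 2.

(** The linear part of (exp ((s - s') ph) - 1) / dt, that is, the discrete - s_t phi. *)
Definition acoef (dt s s' : R) (ph : nat -> R) (j : nat) : R := - ((s' - s) / dt * ph j).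

(** * One time step *)

(** With [w] the time difference and [A] the skew part, [Y = w + A]. The double product 2 X Y splits
    into the time increment of the form ([L4]), the cross term of the two parts of the Laplacian
    ([L1]) and the product of the diagonal [a] with the skew part ([L2]). The coefficients 3/4 and
    12 reflect that [L1] enters twice. *)
Lemma step_estimate (G c h dt s s' tau : R) (N : nat) (ph mu o z z' : nat -> R) :
  1 <= G -> 0 < c <= 1 -> 0 < h <= 1 -> 0 < dt ->
  s * h <= carl_eps G c -> s ^ 4 * dt <= carl_eps G c ->
  carl_big G c <= s -> carl_big G c <= tau ->
  Rabs (s' - s) <= G * s ^ 2 * dt / tau ->
  grid_weight G c h N ph mu o ->
  z O = 0 -> z (S N) = 0 -> z' O = 0 -> z' (S N) = 0 ->
  let a := acoef dt s s' ph in
  sumR (fun j => 3 / 4 * xop h s ph a z j ^ 2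
     + c ^ 2 / 4 * (s ^ 3 * z (S j) ^ 2 + s * edges h z j)) N
  + (xform h s ph a z' N - xform h s ph a z N) / dt
  <= sumR (fun j => 3 * residual h dt s s' ph z z' j ^ 2
     + 12 * (20 * G ^ 2) ^ 2 * o (S j) * (s ^ 3 * z (S j) ^ 2)) N.
Proof.
intros HG Hc Hh Hdt Hsh Hsdt Hs Htau Hss W Z0 ZN Z0' ZN' a.
destruct (carl_eps_facts G c HG Hc) as [eps0 Geps].
destruct (carl_big_facts G c HG Hc) as [big0 Gbig].
set (eps := carl_eps G c) in *. set (big := carl_big G c) in *.
assert (G2 : 1 <= G ^ 2) by nra. assert (GG2 : G <= G ^ 2) by nra.
assert (G4 : G ^ 2 <= G ^ 4) by nra. assert (G6 : G ^ 4 <= G ^ 6) by nra.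
assert (G34 : G ^ 3 <= G ^ 4) by nra.
assert (c2 : 0 < c ^ 2 <= 1) by nra.
assert (eps1 : eps <= / 1600000).
{ assert (1 * eps <= G ^ 6 * eps) by (apply Rmult_le_compat_r; lra). lra. }
assert (Ge2 : G ^ 2 * eps <= / 1600000).
{ assert (G ^ 2 * eps <= G ^ 6 * eps) by (apply Rmult_le_compat_r; lra). lra. }
assert (Ge4 : G ^ 4 * eps <= c ^ 2 / 1600000).
{ rewrite <- Geps. apply Rmult_le_compat_r; lra. }
assert (sh0 : 0 < s * h) by (apply Rmult_lt_0_compat; lra).
assert (Gsh : G * (s * h) <= 1).
{ apply Rle_trans with (G ^ 2 * eps); [|lra]. apply Rmult_le_compat; lra. }
assert (s2 : 1 <= s ^ 2) by nra.
assert (s3 : s <= s ^ 3) by nra. assert (s4 : s ^ 2 <= s ^ 4) by nra.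
assert (h2 : 0 < h ^ 2) by (apply pow_lt; lra).
assert (x1 : forall j, (j <= S N)%nat -> Rabs ((s' - s) * ph j) <= G ^ 2 * s ^ 2 * dt / tau).
{ intros j Hj. replace (G ^ 2 * s ^ 2 * dt / tau) with ((G * s ^ 2 * dt / tau) * G) by (field; lra).
  apply Rmult_abs_le; [exact Hss|]. apply (gw_bound _ _ _ _ _ _ _ W); exact Hj. }
assert (Ha : forall j, (j <= S N)%nat -> Rabs (a j) <= G ^ 2 * s ^ 2 / tau).
{ intros j Hj. unfold a, acoef. rewrite Rabs_Ropp.
  replace ((s' - s) / dt * ph j) with (((s' - s) * ph j) / dt) by (field; lra).
  apply Rdiv_abs_le; [lra|]. apply Rle_trans with (1 := x1 j Hj). right. field. lra. }
set (X := xop h s ph a z).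
set (A := fun j => skew s ph z j / h ^ 2).
set (w := fun j => (z' (S j) - z (S j)) / dt).
set (Y := fun j => w j + A j).
set (Q := fun j => s ^ 3 * z (S j) ^ 2). set (V := fun j => s * edges h z j).
assert (HQ : forall j, 0 <= Q j) by (intros j; apply Rmult_le_pos; [lra|apply pow2_ge_0]).
assert (HV : forall j, 0 <= V j) by (intros j; apply Rmult_le_pos; [lra|apply edges_ge0]).
assert (SQ : sumR Q N = s ^ 3 * sumR (fun j => z (S j) ^ 2) N).
{ rewrite <- sumR_scal. reflexivity. }
assert (L1 := symp_skew_coercivity G c h s tau N ph mu o a z HG Hc Hh ltac:(lra) ltac:(lra) Hsh Hs Htau W Ha Z0 ZN).
assert (L2 : - (3 * G ^ 3 / tau * sumR Q N) <= sumR (fun j => a (S j) * z (S j) * A j) N).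
{ rewrite SQ.
  assert (L2 := diag_skew_ge s ph a z N (3 * G ^ 3 / tau * s ^ 3 * h ^ 2) Z0 ZN).
  assert (G3 : 0 < G ^ 3) by (apply pow_lt; lra).
  assert (q0 : 0 < 3 * G ^ 3 / tau * s ^ 3 * h ^ 2).
  { repeat apply Rmult_lt_0_compat; try lra. apply Rinv_0_lt_compat; lra. }
  specialize (L2 ltac:(lra)).
  assert (L3 := L2 ltac:(intros j Hj;
    replace (3 * G ^ 3 / tau * s ^ 3 * h ^ 2) with ((3 * (G * (s * h))) * (G * s ^ 2 / tau * (G * h))) by (field; lra);
    apply Rmult_abs_le;
    [ assert (D : Rabs (dph s ph j) <= G * (s * h)) by
       (unfold dph; rewrite Rabs_mult, (Rabs_right s) by lra;
        replace (G * (s * h)) with (s * (G * h)) by ring;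
        apply Rmult_le_compat_l; [lra|apply (gw_diff _ _ _ _ _ _ _ W); lia]);
      apply Rle_trans with (1 := sinh_abs_le _ (Rle_trans _ _ _ D Gsh)); lra
    | unfold a, acoef;
      replace (- ((s' - s) / dt * ph (S j)) - - ((s' - s) / dt * ph j)) with
        (((s' - s) / dt) * (- (ph (S j) - ph j))) by ring;
      apply Rmult_abs_le;
      [ apply Rdiv_abs_le; [lra|]; apply Rle_trans with (1 := Hss); right; field; lra
      | rewrite Rabs_Ropp; apply (gw_diff _ _ _ _ _ _ _ W); lia ] ])).
  apply Rmult_le_compat_l with (r := / h ^ 2) in L3; [|apply Rlt_le, Rinv_0_lt_compat; lra].
  rewrite <- (sumR_scal (/ h ^ 2)) in L3.
  eapply Rle_trans; [|eapply Rle_trans; [exact L3|]].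
  - right. field. lra.
  - right. apply sumR_ext. intros j _. unfold A, Rdiv. ring. }
(* Only an upper bound for the form of the increment is required. The constant 11 is 2 * 5 from the
   potential of [symp_form_le] plus 1 from [a]. *)
assert (L4 : (xform h s ph a z' N - xform h s ph a z N) / dt
   - 11 * G ^ 2 * s ^ 2 * dt * sumR (fun j => w j ^ 2) N <= sumR (fun j => 2 * (X j * w j)) N).
{ assert (E := xform_diff h s ph a z z' N Z0 Z0' ZN ZN').
  apply (f_equal (Rmult (/ dt))) in E. rewrite <- (sumR_scal (/ dt)) in E.
  rewrite (sumR_ext (fun j => 2 * (X j * w j)) (fun j => / dt * (2 * (xop h s ph a z j * (z' (S j) - z (S j)))))).
  2:{ intros j _. unfold w, X. field. lra. }
  rewrite E.
  assert (K : xform h s ph a (fun i => z' i - z i) N <= 11 * G ^ 2 * s ^ 2 * (dt ^ 2 * sumR (fun j => w j ^ 2) N)).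
  { replace (dt ^ 2 * sumR (fun j => w j ^ 2) N) with (sumR (fun j => (z' (S j) - z (S j)) ^ 2) N).
    2:{ rewrite <- sumR_scal. apply sumR_ext. intros j _. unfold w. field. lra. }
    unfold xform.
    assert (K := symp_form_le s ph (fun i => z' i - z i) N (5 * G ^ 2 * s ^ 2 * h ^ 2) ltac:(lra) ltac:(lra)).
    assert (K1 := K ltac:(intros j Hj;
      assert (D : Rabs (dph s ph j) <= G * (s * h)) by
       (unfold dph; rewrite Rabs_mult, (Rabs_right s) by lra;
        replace (G * (s * h)) with (s * (G * h)) by ring;
        apply Rmult_le_compat_l; [lra|apply (gw_diff _ _ _ _ _ _ _ W); lia]);
      apply Rle_trans with (1 := cosh_m1_le _ (Rle_trans _ _ _ D Gsh));
      apply sq_le_of_abs in D;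
      replace (5 * G ^ 2 * s ^ 2 * h ^ 2) with (5 * (G * (s * h)) ^ 2) by ring; lra)).
    cbv beta in K1.
    apply Rmult_le_compat_l with (r := / h ^ 2) in K1; [|apply Rlt_le, Rinv_0_lt_compat; lra].
    rewrite <- (sumR_scal (/ h ^ 2)) in K1.
    apply Rle_trans with (sumR (fun j => / h ^ 2 * (symp s ph (fun i => z' i - z i) j * (z' (S j) - z (S j)))
      + G ^ 2 * s ^ 2 * (z' (S j) - z (S j)) ^ 2) N).
    - apply sumR_le. intros j Hj. unfold xop.
      assert (Y1 : a (S j) <= G ^ 2 * s ^ 2).
      { apply Rle_trans with (1 := Rle_abs _), Rle_trans with (1 := Ha (S j) ltac:(lia)).
        unfold Rdiv. rewrite <- (Rmult_1_r (G ^ 2 * s ^ 2)) at 2.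
        apply Rmult_le_compat_l; [apply Rmult_le_pos; lra|]. rewrite <- Rinv_1. apply Rinv_le_contravar; lra. }
      apply Rmult_le_compat_r with (r := (z' (S j) - z (S j)) ^ 2) in Y1; [|apply pow2_ge_0].
      unfold Rdiv. lra.
    - rewrite sumR_plus, (sumR_scal (G ^ 2 * s ^ 2)).
      replace (/ h ^ 2 * (2 * (5 * G ^ 2 * s ^ 2 * h ^ 2) * sumR (fun j => (z' (S j) - z (S j)) ^ 2) N))
       with (10 * G ^ 2 * s ^ 2 * sumR (fun j => (z' (S j) - z (S j)) ^ 2) N) in K1 by (field; lra).
      lra. }
  apply Rmult_le_compat_l with (r := / dt) in K; [|apply Rlt_le, Rinv_0_lt_compat; lra].
  replace (/ dt * (11 * G ^ 2 * s ^ 2 * (dt ^ 2 * sumR (fun j => w j ^ 2) N)))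
    with (11 * G ^ 2 * s ^ 2 * dt * sumR (fun j => w j ^ 2) N) in K by (field; lra).
  lra. }
assert (dt3 : s ^ 2 * dt * s <= eps).
{ apply Rle_trans with (2 := Hsdt). replace (s ^ 2 * dt * s) with (s ^ 3 * dt) by ring.
  apply Rmult_le_compat_r; [lra|]. nra. }
assert (dts : s ^ 2 * dt <= eps).
{ apply Rle_trans with (2 := Hsdt). apply Rmult_le_compat_r; lra. }
(* The negative multiple of [w j ^ 2] on the right is a reserve that cancels the loss in [L4]. It is
   available because all [w] errors are first paid by [Y] and the first-order terms through
   [w = Y - A]. *)
assert (L5 : forall j, (j < N)%nat ->
   X j ^ 2 + Y j ^ 2 + 2 * (X j * Y j) - 3 * residual h dt s s' ph z z' j ^ 2
   <= 11 * G ^ 2 * s ^ 2 * dt * w j ^ 2 * (-1) + Y j ^ 2 + c ^ 2 / 100 * (Q j + V j)).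
{ intros j Hj.
  set (x := (s - s') * ph (S j)).
  assert (Hx : Rabs x <= G ^ 2 * s ^ 2 * dt / tau).
  { unfold x. rewrite <- Rabs_Ropp. replace (- ((s - s') * ph (S j))) with ((s' - s) * ph (S j)) by ring.
    apply x1; lia. }
  assert (itau : / tau <= 1) by (rewrite <- Rinv_1; apply Rinv_le_contravar; lra).
  assert (Hx2 : Rabs x <= G ^ 2 * (s ^ 2 * dt)).
  { apply Rle_trans with (1 := Hx). unfold Rdiv.
    rewrite <- (Rmult_1_r (G ^ 2 * (s ^ 2 * dt))).
    replace (G ^ 2 * s ^ 2 * dt * / tau) with (G ^ 2 * (s ^ 2 * dt) * / tau) by ring.
    apply Rmult_le_compat_l; [|lra]. repeat apply Rmult_le_pos; lra. }
  assert (Hx1 : Rabs x <= 1).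
  { apply Rle_trans with (1 := Hx2).
    apply Rmult_le_compat_l with (r := G ^ 2) in dts; lra. }
  (* [ba] is the Taylor remainder of the exponential factor, bounded by a multiple of s^4 dt; [bd]
     is the deviation of this factor from 1 and multiplies the time difference. The linear part x /
     dt is [a]. *)
  set (ba := (exp x - 1 - x) / dt). set (bd := exp x - 1).
  assert (Hba : ba ^ 2 <= c ^ 2 / 1000).
  { assert (B0 : Rabs ba <= 3 * (G ^ 4 * eps)).
    { apply Rdiv_abs_le; [lra|]. apply Rle_trans with (1 := exp_taylor1 x Hx1).
      apply sq_le_of_abs in Hx2.
      replace ((G ^ 2 * (s ^ 2 * dt)) ^ 2) with (G ^ 4 * (s ^ 4 * dt) * dt) in Hx2 by ring.
      assert (G ^ 4 * (s ^ 4 * dt) * dt <= G ^ 4 * eps * dt).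
      { apply Rmult_le_compat_r; [lra|]. apply Rmult_le_compat_l; lra. } lra. }
    apply sq_le_of_abs in B0. apply Rle_trans with (1 := B0).
    assert (0 <= G ^ 4 * eps) by (apply Rmult_le_pos; lra). nra. }
  assert (Hbd : bd ^ 2 <= 9 * G ^ 4 * (s ^ 2 * dt)).
  { assert (B0 : Rabs bd <= 3 * (G ^ 2 * (s ^ 2 * dt))).
    { apply Rle_trans with (1 := exp_m1_abs_le x Hx1). lra. }
    apply sq_le_of_abs in B0. apply Rle_trans with (1 := B0).
    replace ((3 * (G ^ 2 * (s ^ 2 * dt))) ^ 2) with (9 * G ^ 4 * (s ^ 2 * dt) * (s ^ 2 * dt)) by ring.
    rewrite <- (Rmult_1_r (9 * G ^ 4 * (s ^ 2 * dt))) at 2.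
    assert (0 <= s ^ 2 * dt) by (apply Rmult_le_pos; lra).
    apply Rmult_le_compat_l; [apply Rmult_le_pos|]; lra. }
  set (g := residual h dt s s' ph z z' j).
  assert (EXY : X j + Y j = - g + (- ba) * z (S j) + (- bd) * w j).
  { unfold X, Y, g, residual, xop, A, w, ba, bd, a, acoef. fold x. unfold x at 3. field. lra. }
  assert (Hw : w j ^ 2 <= 2 * Y j ^ 2 + 54 * G ^ 2 * s ^ 2 * (edges h z j + z (S j) ^ 2)).
  { replace (w j) with (Y j + - A j) by (unfold Y; ring).
    apply Rle_trans with (1 := sq_sum2 _ _).
    assert (K := skew_sq_le G h s ph z j HG Hh ltac:(lra) Gsh
      (gw_diff _ _ _ _ _ _ _ W j ltac:(lia)) (gw_diff _ _ _ _ _ _ _ W (S j) ltac:(lia))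
      (gw_sdiff _ _ _ _ _ _ _ W j Hj)).
    fold (A j) in K. replace ((- A j) ^ 2) with (A j ^ 2) by ring. lra. }
  assert (Sq : X j ^ 2 + Y j ^ 2 + 2 * (X j * Y j) <=
     3 * (g ^ 2 + ba ^ 2 * z (S j) ^ 2 + bd ^ 2 * w j ^ 2)).
  { replace (X j ^ 2 + Y j ^ 2 + 2 * (X j * Y j)) with ((X j + Y j) ^ 2) by ring.
    rewrite EXY. apply Rle_trans with (1 := sq_sum3 _ _ _). right. ring. }
  assert (z2 := pow2_ge_0 (z (S j))). assert (w2 := pow2_ge_0 (w j)).
  assert (R1 : ba ^ 2 * z (S j) ^ 2 <= c ^ 2 / 1000 * Q j).
  { apply Rmult_le_compat; [apply pow2_ge_0|lra|lra|]. unfold Q.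
    rewrite <- (Rmult_1_l (z (S j) ^ 2)) at 1. apply Rmult_le_compat_r; lra. }
  assert (R2 : bd ^ 2 * w j ^ 2 <= 9 * G ^ 4 * (s ^ 2 * dt) * w j ^ 2) by (apply Rmult_le_compat_r; lra).
  assert (R3 : 11 * G ^ 2 * s ^ 2 * dt * w j ^ 2 <= 11 * G ^ 4 * (s ^ 2 * dt) * w j ^ 2).
  { apply Rmult_le_compat_r; [lra|]. replace (11 * G ^ 2 * s ^ 2 * dt) with (11 * G ^ 2 * (s ^ 2 * dt)) by ring.
    apply Rmult_le_compat_r; [apply Rmult_le_pos; lra|lra]. }
  assert (om0 : 0 <= G ^ 4 * (s ^ 2 * dt)) by (repeat apply Rmult_le_pos; lra).
  assert (om1 : G ^ 4 * (s ^ 2 * dt) <= / 1600000).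
  { apply Rle_trans with (G ^ 4 * eps); [apply Rmult_le_compat_l; lra|lra]. }
  apply Rmult_le_compat_l with (r := G ^ 4 * (s ^ 2 * dt)) in Hw; [|lra].
  assert (R4 : G ^ 4 * (s ^ 2 * dt) * (54 * G ^ 2 * s ^ 2 * (edges h z j + z (S j) ^ 2)) <=
     54 * (c ^ 2 / 1600000) * (Q j + V j)).
  { rewrite <- Geps.
    replace (G ^ 4 * (s ^ 2 * dt) * (54 * G ^ 2 * s ^ 2 * (edges h z j + z (S j) ^ 2))) with
     (54 * (G ^ 6 * (s ^ 2 * dt * s)) * (s * (edges h z j + z (S j) ^ 2))) by ring.
    assert (e0 := edges_ge0 h z j).
    apply Rmult_le_compat.
    - repeat apply Rmult_le_pos; lra.
    - apply Rmult_le_pos; lra.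
    - apply Rmult_le_compat_l; [lra|]. apply Rmult_le_compat_l; lra.
    - unfold Q, V. assert (s * z (S j) ^ 2 <= s ^ 3 * z (S j) ^ 2) by (apply Rmult_le_compat_r; lra). lra. }
  assert (R5 : G ^ 4 * (s ^ 2 * dt) * (2 * Y j ^ 2) <= / 1600000 * (2 * Y j ^ 2)).
  { apply Rmult_le_compat_r; [|lra]. assert (K := pow2_ge_0 (Y j)). lra. }
  assert (Y2 := pow2_ge_0 (Y j)).
  assert (cQ : 0 <= c ^ 2 * Q j) by (apply Rmult_le_pos; [lra|apply HQ]).
  assert (cV : 0 <= c ^ 2 * V j) by (apply Rmult_le_pos; [lra|apply HV]).
  lra. }
assert (L6 := sumR_le _ _ N L5).
set (B := 6 * (20 * G ^ 2) ^ 2) in *.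
assert (i2 : G / s ^ 2 <= c ^ 2 / 100).
{ unfold Rdiv. apply Rmult_le_reg_r with (s ^ 2); [lra|]. rewrite Rmult_assoc, Rinv_l by lra.
  assert (c ^ 2 / 80000 * big <= c ^ 2 / 80000 * s) by (apply Rmult_le_compat_l; lra).
  assert (c ^ 2 / 80000 * s <= c ^ 2 / 80000 * s ^ 2) by (apply Rmult_le_compat_l; [lra|nra]).
  assert (0 <= c ^ 2 * s ^ 2) by (apply Rmult_le_pos; lra). lra. }
assert (i3 : G ^ 3 / tau <= c ^ 2 / 80000).
{ unfold Rdiv at 1. apply Rmult_le_reg_r with tau; [lra|]. rewrite Rmult_assoc, Rinv_l by lra.
  assert (c ^ 2 / 80000 * big <= c ^ 2 / 80000 * tau) by (apply Rmult_le_compat_l; lra). lra. }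
assert (SQ0 : 0 <= sumR Q N) by (apply sumR_ge0; auto).
assert (J1 : G / s ^ 2 * sumR Q N <= c ^ 2 / 100 * sumR Q N) by (apply Rmult_le_compat_r; lra).
assert (J2 : G ^ 3 / tau * sumR Q N <= c ^ 2 / 80000 * sumR Q N) by (apply Rmult_le_compat_r; lra).
assert (X2 : 0 <= sumR (fun j => X j ^ 2) N) by (apply sumR_ge0; intros; apply pow2_ge_0).
assert (V2 : 0 <= sumR V N) by (apply sumR_ge0; auto).
assert (cV2 : 0 <= c ^ 2 * sumR V N) by (apply Rmult_le_pos; lra).
assert (cQ2 : 0 <= c ^ 2 * sumR Q N) by (apply Rmult_le_pos; lra).
rewrite (sumR_ext _ (fun j => 3 / 4 * X j ^ 2 + (c ^ 2 / 4 * Q j + c ^ 2 / 4 * V j))).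
2:{ intros j _. unfold X, Q, V. ring. }
rewrite (sumR_ext (fun j => 3 * residual h dt s s' ph z z' j ^ 2 + _)
   (fun j => 3 * residual h dt s s' ph z z' j ^ 2 + 2 * B * (o (S j) * Q j))).
2:{ intros j _. unfold B, Q. ring. }
rewrite !sumR_plus, !sumR_scal.
rewrite (sumR_ext _ (fun j => c ^ 2 / 4 * Q j + c ^ 2 / 4 * V j + - B * (o (S j) * Q j)
   + (- / 8) * X j ^ 2 + - (G / (2 * s ^ 2)) * Q j)) in L1.
2:{ intros j _. unfold B, Q, V, X, xop. field. lra. }
rewrite !sumR_plus, !sumR_scal in L1.
rewrite (sumR_ext _ (fun j => X j ^ 2 + Y j ^ 2 + 2 * (X j * w j) + 2 * (symp s ph z j * skew s ph z j / h ^ 4)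
   + 2 * (a (S j) * z (S j) * A j) - 3 * residual h dt s s' ph z z' j ^ 2)) in L6.
2:{ intros j _. unfold Y, X, xop, A. field. lra. }
rewrite (sumR_ext (fun j => 11 * G ^ 2 * s ^ 2 * dt * w j ^ 2 * -1 + _ + _)
   (fun j => - (11 * G ^ 2 * s ^ 2 * dt) * w j ^ 2 + Y j ^ 2 + c ^ 2 / 100 * Q j + c ^ 2 / 100 * V j)) in L6.
2:{ intros j _. ring. }
rewrite sumR_minus, !sumR_plus, !sumR_scal in L6.
rewrite sumR_scal in L4.
replace (G / (2 * s ^ 2)) with (G / s ^ 2 / 2) in L1 by (field; lra).
replace (3 * G ^ 3 / tau) with (3 * (G ^ 3 / tau)) in L2 by (field; lra).
lra.
Qed.

(** * Summation in time *)

(** These are discrete forms of |s_t| <= G s^2 / tau and |s_tt| <= G s^3 / tau^2. [tw_prev] and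
    [tw_second] are normalised by the value at [S m], the step whose zero-order term pays for the
    change of the form. The value at [M], beyond the final time, enters only through differences. *)
Record time_weight (G eps big tau h dt : R) (M : nat) (s : nat -> R) : Prop := {
  tw_low : forall m, (m < M)%nat -> big <= s m;
  tw_h : forall m, (m < M)%nat -> s m * h <= eps;
  tw_dt : forall m, (m < M)%nat -> s m ^ 4 * dt <= eps;
  tw_next : forall m, (m < M)%nat -> Rabs (s (S m) - s m) <= G * s m ^ 2 * dt / tau;
  tw_prev : forall m, (S m < M)%nat -> Rabs (s (S m) - s m) <= G * s (S m) ^ 2 * dt / tau;
  tw_second : forall m, (S m < M)%nat ->
    Rabs (sdiff s m) <= G * s (S m) ^ 3 * dt ^ 2 / tau ^ 2 }.

(** A Schur bound for a tridiagonal form; the boundary zeros make the shifted sums of squares no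
    larger than the unshifted one. *)
Lemma sumR_tridiag_abs_le (al be ga z : nat -> R) N B C : z O = 0 -> z (S N) = 0 -> 0 <= B ->
  (forall j, (j < N)%nat -> Rabs (al j) <= B /\ Rabs (be j) <= B /\ Rabs (ga j) <= C) ->
  Rabs (sumR (fun j => (al j * z (S (S j)) + be j * z j + ga j * z (S j)) * z (S j)) N)
  <= (2 * B + C) * sumR (fun j => z (S j) ^ 2) N.
Proof.
intros Z0 ZN HB H. apply Rle_trans with (1 := sumR_abs _ _).
apply Rle_trans with (sumR (fun j => B / 2 * z (S (S j)) ^ 2 + B / 2 * z j ^ 2 + (B + C) * z (S j) ^ 2) N).
- apply sumR_le. intros j Hj. destruct (H j Hj) as (H1 & H2 & H3).
  assert (K1 := Rmult_abs_le _ _ _ _ H1 (abs_mul_le_sq (z (S (S j))) (z (S j)))).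
  assert (K2 := Rmult_abs_le _ _ _ _ H2 (abs_mul_le_sq (z j) (z (S j)))).
  assert (K3 : Rabs (z (S j) * z (S j)) <= z (S j) ^ 2).
  { rewrite Rabs_right; [right; ring|]. assert (Y := pow2_ge_0 (z (S j))). lra. }
  assert (K4 := Rmult_abs_le _ _ _ _ H3 K3).
  replace ((al j * z (S (S j)) + be j * z j + ga j * z (S j)) * z (S j)) with
   (al j * (z (S (S j)) * z (S j)) + be j * (z j * z (S j)) + ga j * (z (S j) * z (S j))) by ring.
  apply Rle_trans with (1 := Rabs_triang _ _).
  assert (K5 := Rabs_triang (al j * (z (S (S j)) * z (S j))) (be j * (z j * z (S j)))). lra.
- rewrite !sumR_plus, !sumR_scal.
  assert (Y1 := sumR_shift_sq z N Z0). assert (Y2 := sumR_shift2_sq z N ZN).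
  apply Rmult_le_compat_l with (r := B / 2) in Y1; [|lra].
  apply Rmult_le_compat_l with (r := B / 2) in Y2; [|lra]. lra.
Qed.

(** The origin of the factor h^{-2} at the end points: two off-diagonal coefficients and one
    diagonal coefficient, each at most 3 / h^2, give 9. *)
Lemma xform_abs_le (h s : R) ph a z N : z O = 0 -> z (S N) = 0 -> 0 < h ->
  (forall j, (j <= N)%nat -> Rabs (dph s ph j) <= 1) ->
  (forall j, (j <= N)%nat -> Rabs (a (S j)) <= 1 / h ^ 2) ->
  Rabs (xform h s ph a z N) <= 9 / h ^ 2 * sumR (fun j => z (S j) ^ 2) N.
Proof.
intros Z0 ZN Hh Hd Ha. unfold xform.
assert (h2 : 0 < / h ^ 2) by (apply Rinv_0_lt_compat, pow_lt; lra).
rewrite (sumR_ext _ (fun j => (cosh (dph s ph (S j)) / h ^ 2 * z (S (S j))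
  + cosh (dph s ph j) / h ^ 2 * z j + (a (S j) - 2 / h ^ 2) * z (S j)) * z (S j))).
2:{ intros j _. unfold xop, symp. field. lra. }
apply Rle_trans with ((2 * (3 / h ^ 2) + 3 / h ^ 2) * sumR (fun j => z (S j) ^ 2) N).
2:{ right. field. lra. }
apply sumR_tridiag_abs_le; auto.
{ unfold Rdiv. apply Rmult_le_pos; lra. }
intros j Hj.
assert (K : forall i, (i <= N)%nat -> Rabs (cosh (dph s ph i) / h ^ 2) <= 3 / h ^ 2).
{ intros i Hi. unfold Rdiv. rewrite Rabs_mult, (Rabs_right (/ h ^ 2)) by lra.
  apply Rmult_le_compat_r; [lra|]. assert (Y := cosh_ge_1 (dph s ph i)).
  rewrite Rabs_right by lra. apply cosh_le_3, Hd, Hi. }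
split; [apply K; lia|split; [apply K; lia|]].
assert (Y := Ha j ltac:(lia)). unfold Rdiv in *. apply Rabs_le_between in Y. apply Rabs_le. lra.
Qed.

(** Unlike the form itself, its change in time has no negative power of h: the constant -2 on the
    diagonal cancels, and [cosh_lip] supplies s h from the size of the exponents and h |s - s1| from
    their difference. The constant 37 is 2 * 18 + 1. *)
Lemma xform_time_diff (G h s s1 D : R) ph a a1 z N : 1 <= G -> 0 < h -> 0 < s -> 0 < s1 <= 2 * s ->
  2 * (G * (s * h)) <= 1 -> Rabs (s - s1) <= D -> z O = 0 -> z (S N) = 0 ->
  (forall j, (j <= N)%nat -> Rabs (ph (S j) - ph j) <= G * h) ->
  (forall j, (j <= N)%nat -> Rabs (a (S j) - a1 (S j)) <= G ^ 2 * s * D) ->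
  Rabs (xform h s ph a z N - xform h s1 ph a1 z N) <=
   37 * G ^ 2 * s * D * sumR (fun j => z (S j) ^ 2) N.
Proof.
intros HG Hh Hs Hs1 Hsh HD Z0 ZN Hph Ha. unfold xform. rewrite <- sumR_minus.
assert (h2 : 0 < h ^ 2) by (apply pow_lt; lra).
assert (HD0 : 0 <= D) by (apply Rle_trans with (2 := HD), Rabs_pos).
rewrite (sumR_ext _ (fun j => ((cosh (dph s ph (S j)) - cosh (dph s1 ph (S j))) / h ^ 2 * z (S (S j))
  + (cosh (dph s ph j) - cosh (dph s1 ph j)) / h ^ 2 * z j + (a (S j) - a1 (S j)) * z (S j)) * z (S j))).
2:{ intros j _. unfold xop, symp. field. lra. }
apply Rle_trans with ((2 * (18 * G ^ 2 * s * D) + G ^ 2 * s * D) * sumR (fun j => z (S j) ^ 2) N).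
2:{ right. ring. }
assert (K : forall i, (i <= N)%nat -> Rabs ((cosh (dph s ph i) - cosh (dph s1 ph i)) / h ^ 2) <= 18 * G ^ 2 * s * D).
{ intros i Hi. apply Rdiv_abs_le; [lra|]. assert (P := Hph i Hi).
  assert (B : forall t, 0 <= t <= 2 * s -> Rabs (dph t ph i) <= 2 * (G * (s * h))).
  { intros t Ht. unfold dph. replace (2 * (G * (s * h))) with ((2 * s) * (G * h)) by ring.
    apply Rmult_abs_le; [rewrite Rabs_right; lra|exact P]. }
  apply Rle_trans with (1 := cosh_lip _ _ _ (B s ltac:(lra)) (B s1 ltac:(lra)) Hsh).
  replace (18 * G ^ 2 * s * D * h ^ 2) with (9 * (2 * (G * (s * h))) * (D * (G * h))) by ring.
  apply Rmult_le_compat_l.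
  { assert (0 <= G * (s * h)) by (repeat apply Rmult_le_pos; lra). lra. }
  replace (dph s ph i - dph s1 ph i) with ((s - s1) * (ph (S i) - ph i)) by (unfold dph; ring).
  apply Rmult_abs_le; assumption. }
apply sumR_tridiag_abs_le; auto.
{ repeat apply Rmult_le_pos; lra. }
intros j Hj. split; [apply K; lia|split; [apply K; lia|apply Ha; lia]].
Qed.

(** [U m] and [V m] stand for the form of step m at the new and at the old value of z. [V (S m)] and
    [U m] share their argument but not their coefficients, and [e] measures the mismatch. *)
Lemma sumR_almost_telescope (U V e : nat -> R) M : (forall m, 0 <= e m) ->
  (forall m, (m < M)%nat -> V (S m) - e (S m) <= U m) ->
  U M - V O - sumR e (S M) <= sumR (fun m => U m - V m) (S M).
Proof.
intros He. induction M as [|M IH]; intros H.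
- assert (Y := He O). simpl. lra.
- assert (K := IH ltac:(intros m Hm; apply H; lia)). assert (K1 := H M ltac:(lia)).
  change (sumR e (S (S M))) with (sumR e (S M) + e (S M)).
  change (sumR (fun m => U m - V m) (S (S M))) with (sumR (fun m => U m - V m) (S M) + (U (S M) - V (S M))).
  lra.
Qed.

Lemma conjugated_carleman (G c h dt tau : R) (N M : nat) (ph mu o s : nat -> R) (z : nat -> nat -> R) :
  1 <= G -> 0 < c <= 1 -> 0 < h <= 1 -> 0 < dt -> (1 <= M)%nat -> carl_big G c <= tau ->
  time_weight G (carl_eps G c) (carl_big G c) tau h dt M s ->
  grid_weight G c h N ph mu o ->
  (forall m, z m O = 0 /\ z m (S N) = 0) ->
  let a := fun m => acoef dt (s m) (s (S m)) ph in
  sumR (fun m => dt * sumR (fun j => 3 / 4 * xop h (s m) ph (a m) (z m) j ^ 2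
     + c ^ 2 / 8 * (s m ^ 3 * z m (S j) ^ 2 + s m * edges h (z m) j)) N) M
  <= sumR (fun m => dt * sumR (fun j => 3 * residual h dt (s m) (s (S m)) ph (z m) (z (S m)) j ^ 2
     + 12 * (20 * G ^ 2) ^ 2 * o (S j) * (s m ^ 3 * z m (S j) ^ 2)) N) M
   + 9 / h ^ 2 * (sumR (fun j => z O (S j) ^ 2) N + sumR (fun j => z M (S j) ^ 2) N).
Proof.
intros HG Hc Hh Hdt HM Htau TW W Z a.
destruct (carl_eps_facts G c HG Hc) as [eps0 Geps].
destruct (carl_big_facts G c HG Hc) as [big0 Gbig].
set (eps := carl_eps G c) in *. set (big := carl_big G c) in *.
assert (G2 : 1 <= G ^ 2) by nra. assert (GG2 : G <= G ^ 2) by nra.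
assert (G4 : G ^ 2 <= G ^ 4) by nra. assert (G6 : G ^ 4 <= G ^ 6) by nra.
assert (G34 : G ^ 3 <= G ^ 4) by nra.
assert (c2 : 0 < c ^ 2 <= 1) by nra.
assert (Ge2 : G ^ 2 * eps <= / 1600000).
{ assert (G ^ 2 * eps <= G ^ 6 * eps) by (apply Rmult_le_compat_r; lra). lra. }
assert (Ge : G * eps <= / 1600000).
{ assert (G * eps <= G ^ 2 * eps) by (apply Rmult_le_compat_r; lra). lra. }
assert (eps1 : eps <= / 1600000).
{ assert (1 * eps <= G * eps) by (apply Rmult_le_compat_r; lra). lra. }
assert (h2 : 0 < h ^ 2) by (apply pow_lt; lra).
assert (itau : / tau <= 1) by (rewrite <- Rinv_1; apply Rinv_le_contravar; lra).
assert (itau0 : 0 < / tau) by (apply Rinv_0_lt_compat; lra).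
assert (Hs : forall m, (m < M)%nat -> 80000 <= s m).
{ intros m Hm. apply Rle_trans with (1 := big0). apply (tw_low _ _ _ _ _ _ _ _ TW m Hm). }
assert (Gsh : forall m, (m < M)%nat -> G * (s m * h) <= / 1600000).
{ intros m Hm. apply Rle_trans with (2 := Ge). apply Rmult_le_compat_l; [lra|].
  apply (tw_h _ _ _ _ _ _ _ _ TW m Hm). }
assert (Hph : forall j, (j <= N)%nat -> Rabs (ph (S j) - ph j) <= G * h) by apply (gw_diff _ _ _ _ _ _ _ W).
assert (Hend : forall m y, (m < M)%nat -> y O = 0 -> y (S N) = 0 ->
   Rabs (xform h (s m) ph (a m) y N) <= 9 / h ^ 2 * sumR (fun j => y (S j) ^ 2) N).
{ intros m y Hm Y0 YN. assert (sm := Hs m Hm). apply xform_abs_le; auto; [lra| |].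
  - intros j Hj. unfold dph. apply Rle_trans with (s m * (G * h)).
    + apply Rmult_abs_le; [rewrite Rabs_right; lra|apply Hph, Hj].
    + assert (K := Gsh m Hm). lra.
  - intros j Hj. unfold a, acoef. rewrite Rabs_Ropp.
    apply Rle_trans with (G * s m ^ 2 / tau * G).
    + apply Rmult_abs_le; [|apply (gw_bound _ _ _ _ _ _ _ W); lia].
      apply Rdiv_abs_le; [lra|]. apply Rle_trans with (1 := tw_next _ _ _ _ _ _ _ _ TW m Hm). right. field. lra.
    + apply Rle_div_r_pos; [lra|]. assert (K := Gsh m Hm).
      replace (G * s m ^ 2 / tau * G * h ^ 2) with ((G * (s m * h)) ^ 2 * / tau) by (field; lra).
      assert (K0 : 0 <= G * (s m * h)) by (repeat apply Rmult_le_pos; lra).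
      assert (K2 : (G * (s m * h)) ^ 2 <= 1) by nra.
      rewrite <- (Rmult_1_r 1). apply Rmult_le_compat; try lra. apply pow2_ge_0. }
(* Half of the zero-order term of [step_estimate] is reserved for the telescoping error, whence c^2
   / 8 in the conclusion. The absolute value makes [e] nonnegative also at indices where nothing is
   known about [s]. *)
set (e := fun m => dt * (c ^ 2 / 8 * (Rabs (s m) ^ 3 * sumR (fun j => z m (S j) ^ 2) N))).
assert (He : forall m, 0 <= e m).
{ intros m. unfold e. assert (0 <= sumR (fun j => z m (S j) ^ 2) N) by (apply sumR_ge0; intros; apply pow2_ge_0).
  assert (0 <= Rabs (s m) ^ 3) by (apply pow_le, Rabs_pos).
  apply Rmult_le_pos; [lra|]. apply Rmult_le_pos; [lra|]. apply Rmult_le_pos; lra. }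
set (U := fun m => xform h (s m) ph (a m) (z (S m)) N).
set (V := fun m => xform h (s m) ph (a m) (z m) N).
assert (HUV : forall m, (S m < M)%nat -> V (S m) - e (S m) <= U m).
{ intros m Hm. assert (sm := Hs (S m) Hm). assert (sm0 := Hs m ltac:(lia)).
  assert (prev := tw_prev _ _ _ _ _ _ _ _ TW m Hm).
  assert (sec := tw_second _ _ _ _ _ _ _ _ TW m Hm).
  assert (sdt := tw_dt _ _ _ _ _ _ _ _ TW (S m) Hm). assert (gsh := Gsh (S m) Hm).
  set (t := s (S m)) in *.
  assert (t3 : 0 < t ^ 3) by (apply pow_lt; lra).
  assert (t2dt : G * t ^ 2 * dt / tau <= 1).
  { apply Rle_trans with (G * (t ^ 4 * dt)).
    - unfold Rdiv. apply Rle_trans with (G * t ^ 2 * dt * 1).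
      + apply Rmult_le_compat_l; [|exact itau]. repeat apply Rmult_le_pos; lra.
      + rewrite Rmult_1_r, Rmult_assoc. apply Rmult_le_compat_l; [lra|]. apply Rmult_le_compat_r; [lra|]. nra.
    - apply Rle_trans with (G * eps); [apply Rmult_le_compat_l; lra|lra]. }
  assert (K := xform_time_diff G h t (s m) (G * t ^ 2 * dt / tau) ph (a (S m)) (a m) (z (S m)) N HG
     ltac:(lra) ltac:(lra)).
  assert (st : 0 < s m <= 2 * t).
  { apply Rabs_le_between in prev. lra. }
  specialize (K st ltac:(lra) prev (proj1 (Z (S m))) (proj2 (Z (S m))) Hph).
  assert (K1 := K ltac:(intros j Hj;
    unfold a, acoef; fold t;
    replace (- ((s (S (S m)) - t) / dt * ph (S j)) - - ((t - s m) / dt * ph (S j)))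
      with ((- (sdiff s m / dt)) * ph (S j)) by (unfold sdiff; fold t; field; lra);
    apply Rle_trans with (G * t ^ 3 * dt / tau ^ 2 * G);
    [ apply Rmult_abs_le; [|apply (gw_bound _ _ _ _ _ _ _ W); lia];
      rewrite Rabs_Ropp; apply Rdiv_abs_le; [lra|]; apply Rle_trans with (1 := sec); right; field; lra
    | replace (G * t ^ 3 * dt / tau ^ 2 * G) with (G ^ 2 * t ^ 3 * dt / tau * / tau) by (field; lra);
      replace (G ^ 2 * t * (G * t ^ 2 * dt / tau)) with (G ^ 2 * t ^ 3 * dt / tau * G) by (field; lra);
      apply Rmult_le_compat_l; [|lra]; unfold Rdiv; repeat apply Rmult_le_pos; lra ])).
  assert (E : 37 * G ^ 2 * t * (G * t ^ 2 * dt / tau) * sumR (fun j => z (S m) (S j) ^ 2) N <= e (S m)).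
  { unfold e. fold t. rewrite (Rabs_right t) by lra.
    replace (37 * G ^ 2 * t * (G * t ^ 2 * dt / tau) * sumR (fun j => z (S m) (S j) ^ 2) N) with
     (37 * (G ^ 3 / tau) * (dt * (t ^ 3 * sumR (fun j => z (S m) (S j) ^ 2) N))) by (field; lra).
    replace (dt * (c ^ 2 / 8 * (t ^ 3 * sumR (fun j => z (S m) (S j) ^ 2) N))) with
     (c ^ 2 / 8 * (dt * (t ^ 3 * sumR (fun j => z (S m) (S j) ^ 2) N))) by ring.
    apply Rmult_le_compat_r.
    - assert (0 <= sumR (fun j => z (S m) (S j) ^ 2) N) by (apply sumR_ge0; intros; apply pow2_ge_0).
      apply Rmult_le_pos; [lra|]. apply Rmult_le_pos; lra.
    - assert (i3 : G ^ 3 / tau <= c ^ 2 / 80000).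
      { unfold Rdiv at 1. apply Rmult_le_reg_r with tau; [lra|]. rewrite Rmult_assoc, Rinv_l by lra.
        assert (c ^ 2 / 80000 * big <= c ^ 2 / 80000 * tau) by (apply Rmult_le_compat_l; lra). lra. }
      lra. }
  unfold U, V. fold t. apply Rabs_le_between in K1. lra. }
(* The last form is that of step [M'] evaluated at [z (S M')], so no coefficients of a step beyond
   the final one occur. *)
destruct M as [|M']; [lia|].
assert (Tel := sumR_almost_telescope U V e M' He ltac:(intros m Hm; apply HUV; lia)).
assert (E1 := Hend M' (z (S M')) ltac:(lia) (proj1 (Z _)) (proj2 (Z _))). fold (U M') in E1.
assert (E0 := Hend O (z O) ltac:(lia) (proj1 (Z _)) (proj2 (Z _))). fold (V O) in E0.
apply Rabs_le_between in E1. apply Rabs_le_between in E0.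
assert (Steps : sumR (fun m => dt * sumR (fun j => 3 / 4 * xop h (s m) ph (a m) (z m) j ^ 2
     + c ^ 2 / 8 * (s m ^ 3 * z m (S j) ^ 2 + s m * edges h (z m) j)) N + (e m + (U m - V m))) (S M')
   <= sumR (fun m => dt * sumR (fun j => 3 * residual h dt (s m) (s (S m)) ph (z m) (z (S m)) j ^ 2
     + 12 * (20 * G ^ 2) ^ 2 * o (S j) * (s m ^ 3 * z m (S j) ^ 2)) N) (S M')).
{ apply sumR_le. intros m Hm. assert (sm := Hs m Hm).
  assert (K := step_estimate G c h dt (s m) (s (S m)) tau N ph mu o (z m) (z (S m)) HG Hc Hh Hdt
    (tw_h _ _ _ _ _ _ _ _ TW m Hm) (tw_dt _ _ _ _ _ _ _ _ TW m Hm) (tw_low _ _ _ _ _ _ _ _ TW m Hm) Htau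
    (tw_next _ _ _ _ _ _ _ _ TW m Hm) W (proj1 (Z _)) (proj2 (Z _)) (proj1 (Z _)) (proj2 (Z _))).
  cbv zeta in K. fold (a m) in K. fold (U m) (V m) in K.
  apply Rmult_le_compat_l with (r := dt) in K; [|lra].
  apply Rle_trans with (2 := K).
  assert (s3 : 0 < s m ^ 3) by (apply pow_lt; lra).
  rewrite (Rmult_plus_distr_l dt). replace (dt * ((U m - V m) / dt)) with (U m - V m) by (field; lra).
  rewrite <- Rplus_assoc. apply Rplus_le_compat_r.
  unfold e. rewrite (Rabs_right (s m)) by lra.
  rewrite <- Rmult_plus_distr_l. apply Rmult_le_compat_l; [lra|].
  rewrite <- !sumR_scal, <- sumR_plus. apply sumR_le. intros j _.
  assert (P1 : 0 <= c ^ 2 * (s m * edges h (z m) j)).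
  { apply Rmult_le_pos; [lra|]. apply Rmult_le_pos; [lra|apply edges_ge0]. }
  lra. }
rewrite sumR_plus, (sumR_plus e) in Steps. lra.
Qed.

(** * Back to the original variable *)

Lemma exp_sq x : exp x ^ 2 = exp (2 * x).
Proof. replace (2 * x) with (x + x) by ring. rewrite exp_plus. ring. Qed.

Lemma conj_lap s ph q z L N j :
  (forall i, (j <= i <= S (S j))%nat -> z i = exp (s * ph i) * q i) ->
  exp (s * ph (S j)) * lap L N q (S j) =
  (symp s ph z j + skew s ph z j) / hstep L N ^ 2.
Proof.
intros H. unfold lap, symp, skew. replace (S j - 1)%nat with j by lia.
rewrite (H j), (H (S j)), (H (S (S j))) by lia.
replace (cosh (dph s ph (S j)) * (exp (s * ph (S (S j))) * q (S (S j))) -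
   2 * (exp (s * ph (S j)) * q (S j)) + cosh (dph s ph j) * (exp (s * ph j) * q j) +
   (- sinh (dph s ph (S j)) * (exp (s * ph (S (S j))) * q (S (S j))) +
    sinh (dph s ph j) * (exp (s * ph j) * q j)))
 with ((cosh (dph s ph (S j)) - sinh (dph s ph (S j))) * exp (s * ph (S (S j))) * q (S (S j))
   - 2 * exp (s * ph (S j)) * q (S j) + (cosh (dph s ph j) + sinh (dph s ph j)) * exp (s * ph j) * q j) by ring.
assert (E1 : (cosh (dph s ph (S j)) - sinh (dph s ph (S j))) * exp (s * ph (S (S j))) = exp (s * ph (S j))).
{ replace (cosh (dph s ph (S j)) - sinh (dph s ph (S j))) with (exp (- dph s ph (S j)))
    by (unfold cosh, sinh; field).
  rewrite <- exp_plus. f_equal. unfold dph. ring. }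
assert (E0 : (cosh (dph s ph j) + sinh (dph s ph j)) * exp (s * ph j) = exp (s * ph (S j))).
{ replace (cosh (dph s ph j) + sinh (dph s ph j)) with (exp (dph s ph j))
    by (unfold cosh, sinh; field).
  rewrite <- exp_plus. f_equal. unfold dph. ring. }
rewrite E1, E0. unfold Rdiv. ring.
Qed.

(* [x] is the exponent at the point where the weight is sampled. *)
Lemma conj_dh s h G x p0 p1 q0 q1 : 1 <= G -> 0 < h -> 0 < s -> G * (s * h) <= 1 ->
  Rabs (x - p0) <= G * h -> Rabs (x - p1) <= G * h ->
  (exp (s * x) * ((q1 - q0) / h)) ^ 2 <=
  18 * ((exp (s * p1) * q1 - exp (s * p0) * q0) / h) ^ 2 + 72 * G ^ 2 * s ^ 2 * (exp (s * p0) * q0) ^ 2.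
Proof.
intros HG Hh Hs Hsh H0 H1.
set (z1 := exp (s * p1) * q1). set (z0 := exp (s * p0) * q0).
assert (K : forall p, Rabs (x - p) <= G * h ->
   Rabs (exp (s * (x - p)) - 1) <= 3 * (G * (s * h))).
{ intros p Hp. assert (Hp' : Rabs (s * (x - p)) <= G * (s * h)).
  { rewrite Rabs_mult, (Rabs_right s) by lra. apply Rmult_le_compat_l with (r := s) in Hp; lra. }
  apply Rle_trans with (1 := exp_m1_abs_le _ (Rle_trans _ _ _ Hp' Hsh)). lra. }
assert (K0 := K _ H0). assert (K1 := K _ H1).
set (al := exp (s * (x - p1))) in *. set (be := exp (s * (x - p0))) in *.
assert (al3 : Rabs al <= 3).
{ assert (Y : Rabs (s * (x - p1)) <= 1).
  { rewrite Rabs_mult, (Rabs_right s) by lra. apply Rmult_le_compat_l with (r := s) in H1; lra. }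
  assert (Y1 := exp_le_3_of_abs _ Y). fold al in Y1. unfold al in *.
  rewrite Rabs_right; [exact Y1|]. apply Rle_ge, Rlt_le, exp_pos. }
(* A discrete product rule: [al] and [be] move the weight from the sampling point to the two ends
   and differ by O(s h). *)
replace (exp (s * x) * ((q1 - q0) / h)) with (al * ((z1 - z0) / h) + (al - be) / h * z0).
2:{ unfold z1, z0.
  replace (exp (s * x) * ((q1 - q0) / h)) with ((exp (s * x) * q1 - exp (s * x) * q0) / h) by (field; lra).
  replace (exp (s * x)) with (al * exp (s * p1)) at 1 by (unfold al; rewrite <- exp_plus; f_equal; ring).
  replace (exp (s * x)) with (be * exp (s * p0)) by (unfold be; rewrite <- exp_plus; f_equal; ring).
  field. lra. }
apply Rle_trans with (1 := sq_sum2 _ _). rewrite !Rpow_mult_distr.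
assert (ab : Rabs ((al - be) / h) <= 6 * G * s).
{ apply Rdiv_abs_le; [lra|]. apply Rabs_le_between in K0. apply Rabs_le_between in K1. apply Rabs_le. lra. }
apply sq_le_of_abs in ab. apply sq_le_of_abs in al3.
apply Rmult_le_compat_r with (r := z0 ^ 2) in ab; [|apply pow2_ge_0].
apply Rmult_le_compat_r with (r := ((z1 - z0) / h) ^ 2) in al3; [|apply pow2_ge_0].
lra.
Qed.

Lemma sumR_edges_ge h z N : (1 <= N)%nat ->
  sumR (fun j => ((z (S j) - z j) / h) ^ 2) (S N) <= sumR (edges h z) N.
Proof.
intros HN. rewrite sumR_succ_l. unfold edges. rewrite sumR_plus.
destruct N as [|N]; [lia|]. rewrite (sumR_succ_l (fun j => ((z (S j) - z j) / h) ^ 2)).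
assert (0 <= sumR (fun j => ((z (S (S j)) - z (S j)) / h) ^ 2) N) by (apply sumR_ge0; intros; apply pow2_ge_0).
lra.
Qed.

(** With s = tau theta the four weights become s^{-1}, s, s and s^3. The weighted Laplacian [P] is
    [X] minus the diagonal term plus the skew part, and the weighted time difference is minus the
    residual minus [P]; so the second-order terms cost [X ^ 2] with the factor 3 * 3 = 9 and
    first-order quantities. *)
Lemma slice_estimate (G L T dt tau th th' : R) (N M : nat) (ph phd q q' z z' : nat -> R) :
  let h := hstep L N in let s := tau * th in let s' := tau * th' in
  1 <= G -> 0 < h <= 1 -> 0 < dt -> (1 <= N)%nat -> 1 <= tau -> 0 < th -> 1 <= s ->
  G * (s * h) <= 1 -> Rabs (s' - s) <= G * s ^ 2 * dt / tau ->
  (forall j, (j <= N)%nat -> Rabs (ph (S j) - ph j) <= G * h) ->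
  (forall j, (j < N)%nat -> Rabs (sdiff ph j) <= G * h ^ 2) ->
  (forall j, (j <= S N)%nat -> Rabs (ph j) <= G) ->
  (forall j, (j <= N)%nat -> Rabs (phd j - ph j) <= G * h /\ Rabs (phd j - ph (S j)) <= G * h) ->
  z O = 0 ->
  (forall i, (i <= S N)%nat -> z i = exp (s * ph i) * q i) ->
  (forall i, (1 <= i <= N)%nat -> z' i = exp (s' * ph i) * q' i) ->
  / tau * sumR (fun j => exp (2 * s * ph (S j)) * / th *
       (((q' (S j) - q (S j)) / dt) ^ 2 + lap L N q (S j) ^ 2)) N
  + tau * sumR (fun j => exp (2 * s * phd j) * th * dh L N q j ^ 2) (S N)
  + tau * sumR (fun j => exp (2 * s * ph (S j)) * th * dhbar L N q (S j) ^ 2) N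
  + tau ^ 3 * sumR (fun j => exp (2 * s * ph (S j)) * th ^ 3 * q (S j) ^ 2) N
  <= sumR (fun j => 2 * residual h dt s s' ph z z' j ^ 2 + 9 * xop h s ph (acoef dt s s' ph) z j ^ 2
      + 500 * G ^ 4 * (s ^ 3 * z (S j) ^ 2 + s * edges h z j)) N.
Proof.
intros h s s' HG Hh Hdt HN Htau Hth Hs Hsh Hss Hph Hsd Hb Hphd Z0 Hz Hz'.
assert (G2 : 1 <= G ^ 2) by nra. assert (G4 : G ^ 2 <= G ^ 4) by nra.
assert (s3 : s <= s ^ 3) by nra. assert (s2 : 1 <= s ^ 2) by nra.
assert (h2 : 0 < h ^ 2) by (apply pow_lt; lra).
assert (is1 : 0 < / s <= 1).
{ split; [apply Rinv_0_lt_compat; lra|]. rewrite <- Rinv_1. apply Rinv_le_contravar; lra. }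
set (a := acoef dt s s' ph).
set (Q := fun j => s ^ 3 * z (S j) ^ 2). set (V := fun j => s * edges h z j).
assert (HQ : forall j, 0 <= Q j) by (intros j; apply Rmult_le_pos; [lra|apply pow2_ge_0]).
assert (HV : forall j, 0 <= V j) by (intros j; apply Rmult_le_pos; [lra|apply edges_ge0]).
assert (A1 : / tau * sumR (fun j => exp (2 * s * ph (S j)) * / th *
       (((q' (S j) - q (S j)) / dt) ^ 2 + lap L N q (S j) ^ 2)) N <=
   sumR (fun j => 2 * residual h dt s s' ph z z' j ^ 2 + 9 * xop h s ph a z j ^ 2
     + (9 * G ^ 4 + 243 * G ^ 2) * (Q j + V j)) N).
{ rewrite <- sumR_scal. apply sumR_le. intros j Hj.
  assert (EL := conj_lap s ph q z L N j ltac:(intros i Hi; apply Hz; lia)). fold h in EL.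
  set (r := exp (s * ph (S j))) in *. set (P := (symp s ph z j + skew s ph z j) / h ^ 2) in *.
  set (g := residual h dt s s' ph z z' j).
  assert (ED : r * ((q' (S j) - q (S j)) / dt) = - g - P).
  { unfold g, residual. fold P. rewrite (Hz (S j)), (Hz' (S j)) by lia. fold r.
    replace (exp ((s - s') * ph (S j)) * (exp (s' * ph (S j)) * q' (S j))) with (r * q' (S j)).
    - field. lra.
    - unfold r. rewrite <- Rmult_assoc, <- exp_plus. f_equal. f_equal. ring. }
  replace (/ tau * (exp (2 * s * ph (S j)) * / th * (((q' (S j) - q (S j)) / dt) ^ 2 + lap L N q (S j) ^ 2)))
   with (/ s * ((r * ((q' (S j) - q (S j)) / dt)) ^ 2 + (r * lap L N q (S j)) ^ 2)).
  2:{ replace (2 * s * ph (S j)) with (2 * (s * ph (S j))) by ring. rewrite <- exp_sq. fold r.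
      unfold s. field. lra. }
  rewrite EL, ED.
  assert (K1 : (- g - P) ^ 2 <= 2 * g ^ 2 + 2 * P ^ 2).
  { assert (Y := sq_sum2 (- g) (- P)). replace (- g - P) with (- g + - P) by ring. nra. }
  assert (K2 : P ^ 2 <= 3 * (xop h s ph a z j ^ 2 + (a (S j) * z (S j)) ^ 2 + (skew s ph z j / h ^ 2) ^ 2)).
  { replace P with (xop h s ph a z j + - (a (S j) * z (S j)) + skew s ph z j / h ^ 2).
    - apply Rle_trans with (1 := sq_sum3 _ _ _). right. ring.
    - unfold P, xop. field. lra. }
  assert (K3 : (a (S j) * z (S j)) ^ 2 <= G ^ 4 * s ^ 4 * z (S j) ^ 2).
  { rewrite Rpow_mult_distr. apply Rmult_le_compat_r; [apply pow2_ge_0|].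
    replace (G ^ 4 * s ^ 4) with ((G * s ^ 2 * G) ^ 2) by ring. apply sq_le_of_abs.
    unfold a, acoef. rewrite Rabs_Ropp. apply Rmult_abs_le; [|apply Hb; lia].
    apply Rdiv_abs_le; [lra|]. apply Rle_trans with (1 := Hss).
    unfold Rdiv. rewrite <- (Rmult_1_r (G * s ^ 2 * dt)) at 2.
    apply Rmult_le_compat_l; [repeat apply Rmult_le_pos; lra|].
    rewrite <- Rinv_1. apply Rinv_le_contravar; lra. }
  assert (K4 := skew_sq_le G h s ph z j HG Hh ltac:(lra) Hsh (Hph j ltac:(lia)) (Hph (S j) ltac:(lia)) (Hsd j Hj)).
  apply Rle_trans with (/ s * (2 * g ^ 2 + 9 * xop h s ph a z j ^ 2 + 9 * (G ^ 4 * s ^ 4 * z (S j) ^ 2)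
     + 9 * (27 * G ^ 2 * s ^ 2 * (edges h z j + z (S j) ^ 2)))).
  { apply Rmult_le_compat_l; lra. }
  assert (g2 := pow2_ge_0 g). assert (x2 := pow2_ge_0 (xop h s ph a z j)).
  assert (B1 : / s * g ^ 2 <= 1 * g ^ 2) by (apply Rmult_le_compat_r; lra).
  assert (B2 : / s * xop h s ph a z j ^ 2 <= 1 * xop h s ph a z j ^ 2) by (apply Rmult_le_compat_r; lra).
  assert (B3 : / s * (G ^ 4 * s ^ 4 * z (S j) ^ 2) = G ^ 4 * Q j) by (unfold Q; field; lra).
  assert (B4 : / s * (27 * G ^ 2 * s ^ 2 * (edges h z j + z (S j) ^ 2)) = 27 * G ^ 2 * (V j + s * z (S j) ^ 2))
    by (unfold V; field; lra).
  assert (B5 : s * z (S j) ^ 2 <= Q j) by (apply Rmult_le_compat_r; [apply pow2_ge_0|lra]).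
  assert (B6 : G ^ 2 * (V j + s * z (S j) ^ 2) <= G ^ 2 * (V j + Q j)) by (apply Rmult_le_compat_l; lra).
  assert (B7 : 0 <= G ^ 4 * V j) by (apply Rmult_le_pos; [lra|apply HV]).
  lra. }
assert (A2 : tau * sumR (fun j => exp (2 * s * phd j) * th * dh L N q j ^ 2) (S N) <=
   18 * sumR V N + 72 * G ^ 2 * sumR Q N).
{ rewrite <- sumR_scal.
  apply Rle_trans with (sumR (fun j => 18 * s * ((z (S j) - z j) / h) ^ 2 + 72 * G ^ 2 * s ^ 3 * z j ^ 2) (S N)).
  - apply sumR_le. intros j Hj. destruct (Hphd j ltac:(lia)) as [H0 H1].
    assert (K := conj_dh s h G (phd j) (ph j) (ph (S j)) (q j) (q (S j)) HG ltac:(lra) ltac:(lra) Hsh H0 H1).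
    rewrite <- (Hz j), <- (Hz (S j)) in K by lia.
    apply Rmult_le_compat_l with (r := s) in K; [|lra].
    eapply Rle_trans; [eapply Rle_trans; [|exact K]|right; ring].
    right. replace (2 * s * phd j) with (2 * (s * phd j)) by ring. rewrite <- exp_sq.
    unfold dh. fold h. unfold s. ring.
  - rewrite sumR_plus, !sumR_scal. rewrite (sumR_succ_l (fun j => z j ^ 2)), Z0.
    assert (K := sumR_edges_ge h z N HN).
    apply Rmult_le_compat_l with (r := 18 * s) in K; [|lra].
    unfold Q, V. rewrite !sumR_scal. lra. }
assert (A3 : tau * sumR (fun j => exp (2 * s * ph (S j)) * th * dhbar L N q (S j) ^ 2) N <=
   18 * sumR V N + 72 * G ^ 2 * sumR Q N).
{ rewrite <- !sumR_scal, <- sumR_plus. apply sumR_le. intros j Hj.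
  assert (H0 : Rabs (ph (S j) - ph j) <= G * h) by (apply Hph; lia).
  assert (H1 : Rabs (ph (S j) - ph (S (S j))) <= G * h) by (rewrite Rabs_minus_sym; apply Hph; lia).
  assert (H2 : Rabs (ph (S j) - ph (S j)) <= G * h).
  { rewrite Rminus_diag, Rabs_R0. apply Rmult_le_pos; lra. }
  assert (K1 := conj_dh s h G (ph (S j)) (ph (S j)) (ph (S (S j))) (q (S j)) (q (S (S j))) HG ltac:(lra) ltac:(lra) Hsh H2 H1).
  assert (K0 := conj_dh s h G (ph (S j)) (ph (S j)) (ph j) (q (S j)) (q j) HG ltac:(lra) ltac:(lra) Hsh H2 H0).
  rewrite <- (Hz (S j)), <- (Hz (S (S j))) in K1 by lia.
  rewrite <- (Hz (S j)), <- (Hz j) in K0 by lia.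
  set (r := exp (s * ph (S j))) in *.
  replace (exp (2 * s * ph (S j))) with (r ^ 2).
  2:{ unfold r. rewrite exp_sq. f_equal. ring. }
  assert (E : dhbar L N q (S j) = ((q (S (S j)) - q (S j)) / h + - ((q j - q (S j)) / h)) / 2).
  { unfold dhbar. replace (S j - 1)%nat with j by lia. fold h. field. lra. }
  assert (Y := sq_sum2 (r * ((q (S (S j)) - q (S j)) / h)) (- (r * ((q j - q (S j)) / h)))).
  replace ((- (r * ((q j - q (S j)) / h))) ^ 2) with ((r * ((q j - q (S j)) / h)) ^ 2) in Y by ring.
  replace (tau * (r ^ 2 * th * dhbar L N q (S j) ^ 2)) with
   (s / 4 * (r * ((q (S (S j)) - q (S j)) / h) + - (r * ((q j - q (S j)) / h))) ^ 2).
  2:{ rewrite E. unfold s. field. lra. }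
  apply Rle_trans with (s / 4 * (36 * edges h z j + 288 * G ^ 2 * s ^ 2 * z (S j) ^ 2)).
  - apply Rmult_le_compat_l; [lra|].
    replace (((z j - z (S j)) / h) ^ 2) with (((z (S j) - z j) / h) ^ 2) in K0 by (field; lra).
    unfold edges. lra.
  - assert (Y1 := HV j). unfold V, Q in *. lra. }
assert (A4 : tau ^ 3 * sumR (fun j => exp (2 * s * ph (S j)) * th ^ 3 * q (S j) ^ 2) N = sumR Q N).
{ rewrite <- sumR_scal. apply sumR_ext. intros j Hj. unfold Q. rewrite (Hz (S j)) by lia.
  rewrite Rpow_mult_distr, exp_sq. replace (2 * (s * ph (S j))) with (2 * s * ph (S j)) by ring.
  unfold s. ring. }
rewrite A4.
assert (SQ : 0 <= sumR Q N) by (apply sumR_ge0; auto).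
assert (SV : 0 <= sumR V N) by (apply sumR_ge0; auto).
assert (B1 : G ^ 2 * sumR Q N <= G ^ 4 * sumR Q N) by (apply Rmult_le_compat_r; lra).
assert (B2 : G ^ 2 * sumR V N <= G ^ 4 * sumR V N) by (apply Rmult_le_compat_r; lra).
assert (B3 : 1 * sumR Q N <= G ^ 4 * sumR Q N) by (apply Rmult_le_compat_r; lra).
assert (B4 : 1 * sumR V N <= G ^ 4 * sumR V N) by (apply Rmult_le_compat_r; lra).
rewrite !sumR_plus, !sumR_scal, !sumR_plus in A1.
rewrite !sumR_plus, !sumR_scal, !sumR_plus. fold Q V a.
change (fun j : nat => s ^ 3 * z (S j) ^ 2) with Q. change (fun j : nat => s * edges h z j) with V.
lra.
Qed.

(** * The weight in time *)

(* [th0] and [th1] are consecutive values of [theta], with [u = t + delta T] and [v = T + delta T - t]. *)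
Lemma inv_prod_step u v dt T : 0 < u -> 0 < dt -> 2 * dt <= v -> Rabs (u - v) <= T -> dt <= T ->
  let th0 := / (u * v) in let th1 := / ((u + dt) * (v - dt)) in
  0 < th0 /\ 0 < th1 /\ th1 <= 2 * th0 /\ th1 - th0 = dt * (u - v + dt) * (th0 * th1) /\
  Rabs (th1 - th0) <= 4 * T * th0 ^ 2 * dt /\ Rabs (th1 - th0) <= 2 * T * (th0 * th1) * dt.
Proof.
intros Hu Hdt Hv Huv HT th0 th1.
assert (p0 : 0 < u * v) by (apply Rmult_lt_0_compat; lra).
assert (p1 : 0 < (u + dt) * (v - dt)) by (apply Rmult_lt_0_compat; lra).
assert (t0 : 0 < th0) by (apply Rinv_0_lt_compat; lra).
assert (t1 : 0 < th1) by (apply Rinv_0_lt_compat; lra).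
assert (H2 : th1 <= 2 * th0).
{ unfold th1, th0. replace (2 * / (u * v)) with (/ (u * v / 2)) by (field; lra).
  apply Rinv_le_contravar; [lra|]. nra. }
assert (E : th1 - th0 = dt * (u - v + dt) * (th0 * th1)) by (unfold th1, th0; field; lra).
assert (B : Rabs (th1 - th0) <= 2 * T * (th0 * th1) * dt).
{ rewrite E. apply Rabs_le_between in Huv.
  replace (2 * T * (th0 * th1) * dt) with (dt * (2 * T) * (th0 * th1)) by ring.
  assert (pt : 0 < th0 * th1) by (apply Rmult_lt_0_compat; lra).
  rewrite !Rabs_mult, (Rabs_right dt), (Rabs_right th0), (Rabs_right th1) by lra.
  apply Rmult_le_compat_r; [lra|]. apply Rmult_le_compat_l; [lra|]. apply Rabs_le. lra. }
repeat split; try assumption.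
apply Rle_trans with (1 := B).
replace (4 * T * th0 ^ 2 * dt) with (2 * T * dt * (th0 * (2 * th0))) by ring.
replace (2 * T * (th0 * th1) * dt) with (2 * T * dt * (th0 * th1)) by ring.
assert (0 <= T) by lra.
apply Rmult_le_compat_l; [repeat apply Rmult_le_pos; lra|]. apply Rmult_le_compat_l; lra.
Qed.

(** Both one-sided differences have the factor [dt * th0]. Their sum is this factor times (u -
    v)(th1 - thm) + dt (th1 + thm), whose first term contains another first difference. The bound u
    v <= T^2 raises the second term to the same power of [th0]. *)
Lemma inv_prod_second u v dt T : 0 < u -> 0 < dt -> 2 * dt <= v -> 2 * dt <= u -> Rabs (u - v) <= T -> dt <= T ->
  u * v <= T ^ 2 ->
  let th0 := / (u * v) in let th1 := / ((u + dt) * (v - dt)) in let thm := / ((u - dt) * (v + dt)) in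
  Rabs (th1 - 2 * th0 + thm) <= 12 * T ^ 2 * th0 ^ 3 * dt ^ 2.
Proof.
intros Hu Hdt Hv Hu2 Huv HT HuvT th0 th1 thm.
destruct (inv_prod_step u v dt T Hu Hdt Hv Huv HT) as (t0 & t1 & H2 & E1 & B1 & _).
fold th0 th1 in t0, t1, H2, E1, B1.
assert (Step := inv_prod_step v u dt T ltac:(lra) Hdt Hu2 ltac:(rewrite Rabs_minus_sym; exact Huv) HT).
cbv zeta in Step. rewrite (Rmult_comm v u), (Rmult_comm (v + dt)) in Step. fold th0 thm in Step.
destruct Step as (t0' & tm & H2m & Em & Bm & _).
assert (E : th1 - 2 * th0 + thm = dt * th0 * ((u - v) * (th1 - thm) + dt * (th1 + thm))).
{ replace (th1 - 2 * th0 + thm) with ((th1 - th0) + (thm - th0)) by ring. rewrite E1, Em. ring. }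
rewrite E, Rabs_mult, (Rabs_right (dt * th0)).
2:{ apply Rle_ge, Rmult_le_pos; lra. }
assert (D : Rabs (th1 - thm) <= 8 * T * th0 ^ 2 * dt).
{ apply Rabs_le_between in B1. apply Rabs_le_between in Bm. apply Rabs_le. lra. }
assert (one : th0 ^ 2 <= T ^ 2 * th0 ^ 3).
{ replace (T ^ 2 * th0 ^ 3) with ((T ^ 2 * th0) * th0 ^ 2) by ring.
  rewrite <- (Rmult_1_l (th0 ^ 2)) at 1. apply Rmult_le_compat_r; [apply pow2_ge_0|].
  replace 1 with ((u * v) * th0) by (unfold th0; field; lra).
  apply Rmult_le_compat_r; lra. }
assert (K : Rabs ((u - v) * (th1 - thm) + dt * (th1 + thm)) <= 8 * T ^ 2 * th0 ^ 2 * dt + 4 * th0 * dt).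
{ apply Rle_trans with (1 := Rabs_triang _ _).
  assert (K1 := Rmult_abs_le _ _ _ _ Huv D).
  assert (K2 : Rabs (dt * (th1 + thm)) <= dt * (4 * th0)).
  { apply Rmult_abs_le; rewrite Rabs_right; lra. }
  lra. }
apply Rmult_le_compat_l with (r := dt * th0) in K; [|apply Rmult_le_pos; lra].
apply Rle_trans with (1 := K).
apply Rmult_le_compat_l with (r := 4 * dt ^ 2) in one; [|assert (0 <= dt ^ 2) by apply pow2_ge_0; lra].
lra.
Qed.

(** All bounds rest on delta T^2 <= u v <= T^2 for half-integer times below T: the upper one makes s
    at least tau / T^2, the lower one at most tau / (delta T^2), the quantity in the smallness
    conditions. *)
Lemma theta_time_weight (G c T delta tau tau0 eps0 h : R) (M : nat) :
  1 <= G -> 0 < c <= 1 -> 0 < T -> 0 < delta <= / 2 -> (1 <= M)%nat -> 0 < h ->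
  4 * T <= G -> 12 * T ^ 2 <= G ->
  1 <= tau0 -> carl_big G c <= tau0 -> carl_big G c <= tau0 * T -> tau0 * (T + T ^ 2) <= tau ->
  0 < eps0 -> eps0 <= carl_eps G c -> eps0 <= carl_eps G c * T ^ 2 -> eps0 * T <= 1 ->
  tau ^ 4 * dtstep T M / (delta ^ 4 * T ^ 6) <= eps0 ->
  tau * h / (delta * T ^ 2) <= eps0 ->
  0 < dtstep T M /\
  (forall m, (m <= M)%nat -> 0 < theta T delta (thalf T M m)) /\
  time_weight G (carl_eps G c) (carl_big G c) tau h (dtstep T M) M
    (fun m => tau * theta T delta (thalf T M m)).
Proof.
intros HG Hc HT Hdel HM Hh HG1 HG2 Ht01 Ht0 Ht0T Htau He0 He1 He2 He3 Hdt Hth.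
set (dt := dtstep T M) in *.
assert (iM : 1 <= INR M) by (apply (le_INR 1); exact HM).
assert (MT : INR M * dt = T) by (unfold dt, dtstep; field; lra).
assert (dt0 : 0 < dt) by (apply Rdiv_lt_0_compat; lra).
assert (T2 : 0 < T ^ 2) by (apply pow_lt; lra).
assert (tT : T <= tau).
{ apply Rle_trans with (2 := Htau). apply Rle_trans with (1 * (T + T ^ 2)); [lra|].
  apply Rmult_le_compat_r; lra. }
assert (d4 : 0 < delta ^ 4) by (apply pow_lt; lra).
assert (T6 : 0 < T ^ 6) by (apply pow_lt; lra). assert (T4 : 0 < T ^ 4) by (apply pow_lt; lra).
assert (dT6 : 0 < delta ^ 4 * T ^ 6) by (apply Rmult_lt_0_compat; lra).
assert (Hdt' : tau ^ 4 * dt <= eps0 * (delta ^ 4 * T ^ 6)).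
{ apply Rmult_le_compat_r with (r := delta ^ 4 * T ^ 6) in Hdt; [|lra].
  unfold Rdiv in Hdt. rewrite Rmult_assoc, Rinv_l, Rmult_1_r in Hdt by lra. exact Hdt. }
assert (dT2 : 0 < delta * T ^ 2) by (apply Rmult_lt_0_compat; lra).
assert (Hth' : tau * h <= eps0 * (delta * T ^ 2)).
{ apply Rmult_le_compat_r with (r := delta * T ^ 2) in Hth; [|lra].
  unfold Rdiv in Hth. rewrite Rmult_assoc, Rinv_l, Rmult_1_r in Hth by lra. exact Hth. }
(* From T <= tau the condition on tau^4 dt bounds [dt] itself. Hence a step changes u and v by a
   small part of delta T, and the time t_{M+1/2} > T stays inside the domain of theta. *)
assert (Hdt8 : dt <= delta * T / 8).
{ assert (K : T ^ 4 * dt <= T ^ 4 * (eps0 * T * (T * delta ^ 4))).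
  { replace (T ^ 4 * (eps0 * T * (T * delta ^ 4))) with (eps0 * (delta ^ 4 * T ^ 6)) by ring.
    apply Rle_trans with (2 := Hdt'). apply Rmult_le_compat_r; [lra|]. apply pow_incr; lra. }
  apply Rmult_le_reg_l in K; [|lra]. apply Rle_trans with (1 := K).
  assert (d3 : delta ^ 3 <= / 8) by (replace (/ 8) with ((/ 2) ^ 3) by field; apply pow_incr; lra).
  assert (K1 : T * delta ^ 4 <= delta * T / 8).
  { replace (T * delta ^ 4) with ((delta * T) * delta ^ 3) by ring. unfold Rdiv.
    apply Rmult_le_compat_l; [apply Rmult_le_pos; lra|lra]. }
  assert (K2 : 0 <= T * delta ^ 4) by (apply Rmult_le_pos; lra).
  apply Rle_trans with (1 * (T * delta ^ 4)); [apply Rmult_le_compat_r; lra|lra]. }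
assert (dTT : delta * T <= T / 2).
{ assert (delta * T <= / 2 * T) by (apply Rmult_le_compat_r; lra). lra. }
set (u := fun m => thalf T M m + delta * T). set (v := fun m => T + delta * T - thalf T M m).
assert (dT0 : 0 < delta * T) by (apply Rmult_lt_0_compat; lra).
assert (Eu : forall m, u (S m) = u m + dt).
{ intros m. unfold u, thalf. fold dt. rewrite S_INR. ring. }
assert (Ev : forall m, v (S m) = v m - dt).
{ intros m. unfold v, thalf. fold dt. rewrite S_INR. ring. }
assert (tpos : forall m, 0 < thalf T M m).
{ intros m. unfold thalf. fold dt. assert (0 <= INR m) by apply pos_INR. apply Rmult_lt_0_compat; lra. }
assert (tlt : forall m, (m < M)%nat -> thalf T M m < T).
{ intros m Hm. apply (le_INR (S m) M) in Hm. rewrite S_INR in Hm.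
  apply Rmult_le_compat_r with (r := dt) in Hm; [|lra]. unfold thalf. fold dt. lra. }
assert (Hu : forall m, delta * T < u m) by (intros m; unfold u; assert (K := tpos m); lra).
assert (Hv : forall m, (m < M)%nat -> delta * T < v m) by (intros m Hm; unfold v; assert (K := tlt m Hm); lra).
assert (Huv : forall m, (m < M)%nat -> Rabs (u m - v m) <= T).
{ intros m Hm. unfold u, v. assert (K := tlt m Hm). assert (K1 := tpos m). apply Rabs_le. lra. }
assert (Huv2 : forall m, (m < M)%nat -> u m * v m <= T ^ 2).
{ intros m Hm. assert (K : u m + v m <= 2 * T) by (unfold u, v; lra).
  assert (K1 := Hu m). assert (K2 := Hv m Hm). assert (K3 := pow2_ge_0 (u m - v m)).
  assert ((u m + v m) ^ 2 <= (2 * T) ^ 2) by (apply pow_incr; lra). nra. }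
assert (Huv3 : forall m, (m < M)%nat -> delta * T ^ 2 <= u m * v m).
{ intros m Hm. assert (K := tlt m Hm). assert (K1 := tpos m).
  unfold u, v. assert (0 <= thalf T M m * (T - thalf T M m)) by (apply Rmult_le_pos; lra).
  assert (0 <= (delta * T) ^ 2) by apply pow2_ge_0. nra. }
assert (Eth : forall m, theta T delta (thalf T M m) = / (u m * v m)) by reflexivity.
assert (Hsteps : forall m, (m < M)%nat -> 2 * dt <= v m) by (intros m Hm; assert (K := Hv m Hm); lra).
assert (thpos : forall m, (m < M)%nat -> 0 < / (u m * v m)).
{ intros m Hm. assert (K1 := Hu m). assert (K2 := Hv m Hm). apply Rinv_0_lt_compat, Rmult_lt_0_compat; lra. }
assert (tau1 : 0 < tau) by lra.
assert (thlow : forall m, (m < M)%nat -> / T ^ 2 <= / (u m * v m)).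
{ intros m Hm. apply Rinv_le_contravar; [|apply Huv2, Hm].
  assert (K1 := Hu m). assert (K2 := Hv m Hm). apply Rmult_lt_0_compat; lra. }
assert (thup : forall m, (m < M)%nat -> / (u m * v m) <= / (delta * T ^ 2)).
{ intros m Hm. apply Rinv_le_contravar; [lra|]. apply Huv3, Hm. }
assert (scale1 : forall m x, (m < M)%nat -> Rabs x <= 4 * T * (/ (u m * v m)) ^ 2 * dt ->
   Rabs (tau * x) <= G * (tau * / (u m * v m)) ^ 2 * dt / tau).
{ intros m x Hm Hx. rewrite Rabs_mult, (Rabs_right tau) by lra.
  replace (G * (tau * / (u m * v m)) ^ 2 * dt / tau) with (tau * (G * (/ (u m * v m)) ^ 2 * dt)).
  2:{ field. assert (K1 := Hu m). assert (K2 := Hv m Hm). lra. }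
  apply Rmult_le_compat_l; [lra|]. apply Rle_trans with (1 := Hx).
  apply Rmult_le_compat_r; [lra|]. apply Rmult_le_compat_r; [apply pow2_ge_0|lra]. }
split; [exact dt0|split].
- intros m Hm. rewrite Eth. apply Rinv_0_lt_compat, Rmult_lt_0_compat; [assert (K := Hu m); lra|].
  destruct (Nat.eq_dec m M) as [->|Hne].
  + destruct M as [|M']; [lia|]. rewrite Ev. assert (K := Hv M' ltac:(lia)). lra.
  + assert (K := Hv m ltac:(lia)). lra.
- constructor.
  + intros m Hm. rewrite Eth. apply Rle_trans with (1 := Ht0).
    apply Rle_trans with (tau * / T ^ 2); [|apply Rmult_le_compat_l; [lra|apply thlow, Hm]].
    apply Rle_div_r_pos; [lra|]. apply Rle_trans with (2 := Htau).
    apply Rmult_le_compat_l; lra.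
  + intros m Hm. rewrite Eth. apply Rle_trans with (2 := He1).
    apply Rle_trans with (tau * h * / (delta * T ^ 2)); [|exact Hth].
    replace (tau * / (u m * v m) * h) with (tau * h * / (u m * v m)) by ring.
    apply Rmult_le_compat_l; [apply Rmult_le_pos; lra|apply thup, Hm].
  + intros m Hm. rewrite Eth. rewrite Rpow_mult_distr.
    apply Rle_trans with (tau ^ 4 * (/ (delta * T ^ 2)) ^ 4 * dt).
    { apply Rmult_le_compat_r; [lra|]. apply Rmult_le_compat_l; [apply pow_le; lra|].
      apply pow_incr. split; [apply Rlt_le, thpos, Hm|apply thup, Hm]. }
    (* The power T^8 exceeds the T^6 of the hypothesis, which is why [eps0] is compared with
       [carl_eps G c * T ^ 2]. *)
    replace (tau ^ 4 * (/ (delta * T ^ 2)) ^ 4 * dt) with ((tau ^ 4 * dt / (delta ^ 4 * T ^ 6)) / T ^ 2) by (field; lra).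
    apply Rmult_le_reg_r with (T ^ 2); [lra|]. unfold Rdiv at 1. rewrite Rmult_assoc, Rinv_l by lra. lra.
  + intros m Hm. rewrite !Eth, <- Rmult_minus_distr_l. apply scale1; [exact Hm|].
    rewrite Eu, Ev. assert (K := Hu m).
    apply (inv_prod_step (u m) (v m) dt T); [lra|lra|apply Hsteps, Hm|apply Huv, Hm|lra].
  + intros m Hm. rewrite !Eth, <- Rmult_minus_distr_l.
    apply scale1; [exact Hm|]. rewrite Rabs_minus_sym.
    assert (K := Hu m). assert (K1 := Hv (S m) Hm). assert (Eu' := Eu m). assert (Ev' := Ev m).
    (* The step is read backwards in time, with u and v exchanged, to normalise by the later
       value. *)
    replace (u m * v m) with ((v (S m) + dt) * (u (S m) - dt)) by (rewrite Eu', Ev'; ring).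
    replace (u (S m) * v (S m)) with (v (S m) * u (S m)) by ring.
    apply (inv_prod_step (v (S m)) (u (S m)) dt T); [lra|lra|lra| |lra].
    rewrite Rabs_minus_sym. apply Huv, Hm.
  + intros m Hm. unfold sdiff. rewrite !Eth.
    assert (K := Hu m). assert (K1 := Hv (S m) Hm). assert (Eu' := Eu m). assert (Ev' := Ev m).
    assert (pos := thpos (S m) Hm).
    assert (Sd := inv_prod_second (u (S m)) (v (S m)) dt T ltac:(lra) dt0 ltac:(lra) ltac:(lra)
       (Huv _ Hm) ltac:(lra) (Huv2 _ Hm)). cbv zeta in Sd.
    rewrite <- Eu, <- Ev in Sd.
    replace (u (S m) - dt) with (u m) in Sd by lra. replace (v (S m) + dt) with (v m) in Sd by lra.
    set (t := / (u (S m) * v (S m))) in *.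
    replace (tau * / (u (S (S m)) * v (S (S m))) - 2 * (tau * t) + tau * / (u m * v m))
      with (tau * (/ (u (S (S m)) * v (S (S m))) - 2 * t + / (u m * v m))) by ring.
    rewrite Rabs_mult, (Rabs_right tau) by lra.
    replace (G * (tau * t) ^ 3 * dt ^ 2 / tau ^ 2) with (tau * (G * t ^ 3 * dt ^ 2)) by (field; lra).
    apply Rmult_le_compat_l; [lra|]. apply Rle_trans with (1 := Sd).
    apply Rmult_le_compat_r; [apply pow2_ge_0|]. apply Rmult_le_compat_r; [|lra].
    apply pow_le. lra.
Qed.

(** * The weight in space *)

Lemma continuous_bounded (f : R -> R) l r : l <= r ->
  (forall x, l <= x <= r -> continuous f x) ->
  exists B, 0 <= B /\ forall x, l <= x <= r -> Rabs (f x) <= B.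
Proof.
intros Hlr H.
destruct (continuity_ab_maj (fun x => Rabs (f x)) l r Hlr) as (m & Hm & _).
{ intros c Hc. apply continuity_pt_filterlim.
  apply (continuous_comp f Rabs); [apply H, Hc|apply continuous_Rabs]. }
exists (Rabs (f m)). split; [apply Rabs_pos|exact Hm].
Qed.

Lemma mvt_is_derive (f f' : R -> R) x y : x < y ->
  (forall t, x <= t <= y -> is_derive f t (f' t)) ->
  exists c, x < c < y /\ f y - f x = f' c * (y - x).
Proof.
intros Hxy H. destruct (MVT_cor2 f f' x y Hxy) as (c & E & Hc).
- intros t Ht. apply is_derive_Reals, H, Ht.
- exists c. split; assumption.
Qed.

Lemma abs_diff_le_of_derive (f f' : R -> R) B l r x y :
  (forall t, l <= t <= r -> is_derive f t (f' t)) ->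
  (forall t, l <= t <= r -> Rabs (f' t) <= B) ->
  l <= x <= r -> l <= y <= r -> Rabs (f x - f y) <= B * Rabs (x - y).
Proof.
intros Hf HB.
assert (W : forall x y, x < y -> l <= x <= r -> l <= y <= r -> Rabs (f x - f y) <= B * Rabs (x - y)).
{ clear x y. intros x y Hxy Hx Hy.
  destruct (mvt_is_derive f f' x y Hxy) as (c & Hc & E); [intros t Ht; apply Hf; lra|].
  rewrite Rabs_minus_sym, E, Rabs_mult, (Rabs_minus_sym x).
  apply Rmult_le_compat_r; [apply Rabs_pos|]. apply HB; lra. }
intros Hx Hy. destruct (Rtotal_order x y) as [H|[->|H]].
- auto.
- rewrite !Rminus_diag, Rabs_R0; lra.
- rewrite Rabs_minus_sym, (Rabs_minus_sym x). auto.
Qed.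

(** The mean value theorem for g(t) = f(x + t) + f(x - t) - t^2 f''(x), then for f', reduces the
    error to an increment of f'', which the third derivative bounds. *)
Lemma second_difference_taylor (f f1 f2 f3 : R -> R) B l r x h :
  (forall t, l <= t <= r -> is_derive f t (f1 t)) ->
  (forall t, l <= t <= r -> is_derive f1 t (f2 t)) ->
  (forall t, l <= t <= r -> is_derive f2 t (f3 t)) ->
  (forall t, l <= t <= r -> Rabs (f3 t) <= B) ->
  0 < h -> l <= x - h -> x + h <= r ->
  Rabs (f (x + h) - 2 * f x + f (x - h) - h ^ 2 * f2 x) <= 2 * B * h ^ 3.
Proof.
intros H1 H2 H3 HB Hh Hl Hr.
set (g := fun t => f (x + t) + f (x - t) - t ^ 2 * f2 x).
destruct (mvt_is_derive g (fun t => f1 (x + t) - f1 (x - t) - 2 * t * f2 x) 0 h Hh) as (e & He & E).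
{ intros t Ht. unfold g.
  assert (D1 := H1 (x + t) ltac:(lra)). assert (D2 := H1 (x - t) ltac:(lra)).
  auto_derive.
  - split; [eexists; exact D1|split; [eexists; exact D2|exact I]].
  - replace (Derive (fun x0 => f x0) (x + t)) with (f1 (x + t)) by (symmetry; apply is_derive_unique, D1).
    replace (Derive (fun x0 => f x0) (x + - t)) with (f1 (x - t)) by (symmetry; apply is_derive_unique, D2).
    ring. }
destruct (mvt_is_derive f1 f2 (x - e) (x + e)) as (k & Hk & Ek); [lra|intros t Ht; apply H2; lra|].
cbv beta in E. rewrite Ek in E.
assert (D : Rabs (f2 k - f2 x) <= B * h).
{ apply Rle_trans with (1 := abs_diff_le_of_derive f2 f3 B l r k x H3 HB ltac:(lra) ltac:(lra)).
  apply Rmult_le_compat_l.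
  - apply Rle_trans with (2 := HB x ltac:(lra)), Rabs_pos.
  - apply Rabs_le. lra. }
replace (f (x + h) - 2 * f x + f (x - h) - h ^ 2 * f2 x) with (g h - g 0).
2:{ unfold g. rewrite Rplus_0_r, Rminus_0_r. ring. }
rewrite E.
replace ((f2 k * (x + e - (x - e)) - 2 * e * f2 x) * (h - 0)) with ((f2 k - f2 x) * (2 * e * h)) by ring.
replace (2 * B * h ^ 3) with ((B * h) * (2 * h * h)) by ring.
apply Rmult_abs_le; [exact D|]. rewrite Rabs_right.
- apply Rmult_le_compat_r; lra.
- apply Rle_ge. repeat apply Rmult_le_pos; lra.
Qed.

Definition varphi1 (psi : R -> R) lam x := lam * Derive psi x * exp (lam * psi x).
Definition varphi2 (psi : R -> R) lam x :=
  (lam ^ 2 * Derive psi x ^ 2 + lam * Derive_n psi 2 x) * exp (lam * psi x).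
Definition varphi3 (psi : R -> R) lam x :=
  (lam ^ 3 * Derive psi x ^ 3 + 3 * lam ^ 2 * Derive psi x * Derive_n psi 2 x
   + lam * Derive_n psi 3 x) * exp (lam * psi x).

Lemma is_derive_exp_scal (psi : R -> R) lam x : ex_derive psi x ->
  is_derive (fun t => exp (lam * psi t)) x (lam * Derive psi x * exp (lam * psi x)).
Proof.
intros H. auto_derive; [auto|]. replace (Derive (fun x0 => psi x0) x) with (Derive psi x) by reflexivity. ring.
Qed.

Lemma varphi_derivatives (psi : R -> R) lam K a b : Ck_on 3 a b psi ->
  forall x, a < x < b ->
  is_derive (varphi psi lam K) x (varphi1 psi lam x) /\
  is_derive (varphi1 psi lam) x (varphi2 psi lam x) /\
  is_derive (varphi2 psi lam) x (varphi3 psi lam x) /\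
  continuous (varphi3 psi lam) x /\ continuous (Derive_n psi 2) x.
Proof.
intros H x Hx.
assert (D1 : ex_derive psi x) by (apply (H x Hx 1%nat); lia).
assert (D2 : ex_derive (Derive psi) x) by (apply (H x Hx 2%nat); lia).
assert (D3 : ex_derive (Derive_n psi 2) x) by (apply (H x Hx 3%nat); lia).
assert (C3 : continuous (Derive_n psi 3) x) by (apply (H x Hx 3%nat); lia).
assert (E := is_derive_exp_scal psi lam x D1).
assert (CE : continuous (fun t => exp (lam * psi t)) x) by (apply (ex_derive_continuous (fun t => exp (lam * psi t))); eexists; exact E).
assert (C1 : continuous (Derive psi) x) by (apply (ex_derive_continuous (Derive psi)), D2).
assert (C2 : continuous (Derive_n psi 2) x) by (apply (ex_derive_continuous (Derive_n psi 2)), D3).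
split; [|split; [|split; [|split; [|exact C2]]]].
- unfold varphi. eapply is_derive_ext; [intros t; reflexivity|].
  replace (varphi1 psi lam x) with (minus (varphi1 psi lam x) zero).
  2:{ unfold minus, plus, opp, zero; simpl. ring. }
  apply (is_derive_minus (fun t => exp (lam * psi t))); [exact E|apply (is_derive_const (exp (lam * K)) x)].
- unfold varphi1. set (p1 := Derive psi) in *.
  assert (F : is_derive (fun t => lam * p1 t) x (lam * Derive_n psi 2 x)).
  { apply (is_derive_scal p1 x lam). apply Derive_correct, D2. }
  assert (M := is_derive_mult _ _ _ _ _ F E Rmult_comm). unfold mult, plus in M; simpl in M.
  replace (varphi2 psi lam x) with (lam * Derive_n psi 2 x * exp (lam * psi x)
    + lam * p1 x * (lam * p1 x * exp (lam * psi x))); [exact M|].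
  unfold varphi2. fold p1. ring.
- unfold varphi2. set (p1 := Derive psi) in *. set (p2 := Derive_n psi 2) in *.
  assert (F1 : is_derive p1 x (p2 x)) by (apply Derive_correct, D2).
  assert (F2 : is_derive p2 x (Derive_n psi 3 x)) by (apply Derive_correct, D3).
  assert (F : is_derive (fun t => lam ^ 2 * p1 t ^ 2 + lam * p2 t) x
     (lam ^ 2 * (2 * p2 x * p1 x) + lam * Derive_n psi 3 x)).
  { apply (is_derive_plus (fun t => lam ^ 2 * p1 t ^ 2) (fun t => lam * p2 t)).
    - apply (is_derive_scal (fun t => p1 t ^ 2) x (lam ^ 2)).
      replace (2 * p2 x * p1 x) with (INR 2 * p2 x * p1 x ^ pred 2) by (simpl; ring).
      apply is_derive_pow, F1.
    - apply (is_derive_scal p2 x lam), F2. }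
  assert (M := is_derive_mult _ _ _ _ _ F E Rmult_comm). unfold mult, plus in M; simpl in M.
  eapply is_derive_ext; [|evar_last; [exact M|]].
  + intros t. simpl. reflexivity.
  + unfold varphi3. fold p1 p2. simpl. ring.
- unfold varphi3.
  assert (S : forall f k, continuous f x -> continuous (fun t : R => k * f t) x).
  { intros f k Hf. apply (continuous_scal_r k f x Hf). }
  assert (Mu : forall f g : R -> R, continuous f x -> continuous g x -> continuous (fun t => f t * g t) x).
  { intros f g Hf Hg. apply (continuous_mult f g x Hf Hg). }
  apply (Mu (fun t => lam ^ 3 * Derive psi t ^ 3 + 3 * lam ^ 2 * Derive psi t * Derive_n psi 2 t + lam * Derive_n psi 3 t));
    [|exact CE].
  apply (continuous_plus (fun t => lam ^ 3 * Derive psi t ^ 3 + 3 * lam ^ 2 * Derive psi t * Derive_n psi 2 t)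
    (fun t => lam * Derive_n psi 3 t)); [|apply S, C3].
  apply (continuous_plus (fun t => lam ^ 3 * Derive psi t ^ 3) (fun t => 3 * lam ^ 2 * Derive psi t * Derive_n psi 2 t)).
  + apply S. apply (Mu (Derive psi) (fun t => Derive psi t ^ 2)); [exact C1|].
    apply (Mu (Derive psi) (fun t => Derive psi t ^ 1)); [exact C1|].
    apply (Mu (Derive psi) (fun t => 1)); [exact C1|apply continuous_const].
  + apply (Mu (fun t => 3 * lam ^ 2 * Derive psi t)); [apply S, C1|exact C2].
Qed.

(** With mu = kap e^{lam psi}, phi'' + mu and phi'' - mu are lam e^{lam psi} times lam psi'^2 +
    psi'' plus or minus (1 + P), where P bounds |psi''|. The plus sign gives positivity everywhere,
    the minus sign off [B0] for large lam. [G] is left free above [G0] so that it can later also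
    dominate constants depending on T. *)
Lemma exists_grid_weight (L : R) (B0 B : R -> Prop) (psi : R -> R) (a b c K r : R) :
  0 < L -> (forall x, B0 x -> B x) -> a < 0 -> L < b -> Ck_on 3 a b psi ->
  (forall x, a < x < b -> 0 < psi x) -> 0 < c ->
  (forall x, a < x < b -> ~ B0 x -> c <= Rabs (Derive psi x)) ->
  0 < r ->
  (forall x, a < x < b -> Rabs x < r -> c <= Derive psi x) ->
  (forall x, a < x < b -> Rabs (x - L) < r -> Derive psi x <= - c) ->
  exists lam1, 1 <= lam1 /\ forall lam, lam1 <= lam ->
  exists G0 cg h0 kap : R, 0 < cg <= 1 /\ 0 < h0 /\
  forall G N, G0 <= G -> (1 <= N)%nat -> hstep L N <= h0 ->
  grid_weight G cg (hstep L N) N (fun i => varphi psi lam K (xp L N i))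
    (fun i => kap * exp (lam * psi (xp L N i))) (fun i => indic (B (xp L N i))) /\
  (forall j, (j <= N)%nat ->
    Rabs (varphi psi lam K (xd L N j) - varphi psi lam K (xp L N j)) <= G * hstep L N /\
    Rabs (varphi psi lam K (xd L N j) - varphi psi lam K (xp L N (S j))) <= G * hstep L N).
Proof.
intros HL HB0 Ha Hb Hck Hpos Hc Hgrad Hr Hleft Hright.
destruct (continuous_bounded (Derive_n psi 2) 0 L ltac:(lra)) as (P & HP & HPb).
{ intros x Hx. apply (varphi_derivatives psi 1 0 a b Hck x ltac:(lra)). }
assert (c2 : 0 < c ^ 2) by (apply pow_lt; lra).
exists (Rmax 1 ((2 * P + 2) / c ^ 2)). split; [apply Rmax_l|]. intros lam Hlam.
assert (Hlam1 : 1 <= lam) by (apply Rle_trans with (2 := Hlam), Rmax_l).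
assert (Hlamc : 2 * P + 2 <= lam * c ^ 2).
{ assert (Y : (2 * P + 2) / c ^ 2 <= lam) by (apply Rle_trans with (2 := Hlam), Rmax_r).
  apply Rmult_le_compat_r with (r := c ^ 2) in Y; [|lra].
  unfold Rdiv in Y. rewrite Rmult_assoc, Rinv_l, Rmult_1_r in Y by lra. exact Y. }
set (phi := varphi psi lam K). set (f1 := varphi1 psi lam). set (f2 := varphi2 psi lam). set (f3 := varphi3 psi lam).
assert (D1 : forall t, 0 <= t <= L -> is_derive phi t (f1 t)).
{ intros t Ht. apply (varphi_derivatives psi lam K a b Hck t ltac:(lra)). }
assert (D2 : forall t, 0 <= t <= L -> is_derive f1 t (f2 t)).
{ intros t Ht. apply (varphi_derivatives psi lam K a b Hck t ltac:(lra)). }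
assert (D3 : forall t, 0 <= t <= L -> is_derive f2 t (f3 t)).
{ intros t Ht. apply (varphi_derivatives psi lam K a b Hck t ltac:(lra)). }
destruct (continuous_bounded phi 0 L ltac:(lra)) as (b0 & Hb0 & B0b).
{ intros x Hx. apply (ex_derive_continuous phi). eexists. apply D1, Hx. }
destruct (continuous_bounded f1 0 L ltac:(lra)) as (b1 & Hb1 & B1b).
{ intros x Hx. apply (ex_derive_continuous f1). eexists. apply D2, Hx. }
destruct (continuous_bounded f2 0 L ltac:(lra)) as (b2 & Hb2 & B2b).
{ intros x Hx. apply (ex_derive_continuous f2). eexists. apply D3, Hx. }
destruct (continuous_bounded f3 0 L ltac:(lra)) as (b3 & Hb3 & B3b).
{ intros x Hx. apply (varphi_derivatives psi lam K a b Hck x ltac:(lra)). }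
set (kap := (1 + P) * lam).
assert (Hkap : 1 <= kap) by (unfold kap; nra).
set (X := exp (lam * K)). assert (HX : 0 < X) by apply exp_pos.
assert (e1 : forall x, 0 <= x <= L -> 1 <= exp (lam * psi x)).
{ intros x Hx. assert (Y := Hpos x ltac:(lra)). assert (0 < lam * psi x) by (apply Rmult_lt_0_compat; lra).
  assert (Z := exp_ineq1_le (lam * psi x)). lra. }
assert (conv : forall x, 0 <= x <= L -> 1 <= f2 x + kap * exp (lam * psi x)).
{ intros x Hx. assert (Y := e1 x Hx). assert (Q := HPb x Hx). apply Rabs_le_between in Q.
  replace (f2 x + kap * exp (lam * psi x)) with
   (lam * (lam * Derive psi x ^ 2 + Derive_n psi 2 x + 1 + P) * exp (lam * psi x)) by (unfold f2, varphi2, kap; ring).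
  assert (0 <= lam * Derive psi x ^ 2) by (apply Rmult_le_pos; [lra|apply pow2_ge_0]).
  replace 1 with (1 * 1 * 1) at 1 by ring. apply Rmult_le_compat; try lra.
  apply Rmult_le_compat; lra. }
assert (obs : forall x, 0 <= x <= L -> ~ B0 x -> 1 + kap * exp (lam * psi x) <= f2 x /\ c <= Rabs (f1 x)).
{ intros x Hx HnB. assert (Y := e1 x Hx). assert (Q := HPb x Hx). apply Rabs_le_between in Q.
  assert (Gr := Hgrad x ltac:(lra) HnB).
  split.
  - assert (G2 : c ^ 2 <= Derive psi x ^ 2) by (rewrite <- (pow2_abs (Derive psi x)); apply pow_incr; lra).
    apply Rmult_le_compat_l with (r := lam) in G2; [|lra].
    assert (1 <= lam * (lam * Derive psi x ^ 2 + Derive_n psi 2 x - 1 - P) * exp (lam * psi x)).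
    { replace 1 with (1 * 1 * 1) at 1 by ring. apply Rmult_le_compat; try lra.
      apply Rmult_le_compat; lra. }
    unfold f2, varphi2, kap. lra.
  - unfold f1, varphi1. rewrite !Rabs_mult, (Rabs_right lam), (Rabs_right (exp _)) by lra.
    apply Rle_trans with (1 * Rabs (Derive psi x) * 1); [lra|].
    apply Rmult_le_compat; try lra.
    apply Rmult_le_compat_r; [apply Rabs_pos|lra]. }
set (G0 := kap * (b0 + X) + b0 + b1 + (kap + 1) * (b2 + 1)).
assert (p0 : 0 <= kap * (b0 + X)) by (apply Rmult_le_pos; lra).
assert (p2 : 0 <= kap * (b2 + 1)) by (apply Rmult_le_pos; lra).
(* In turn: the Taylor error of a second difference is at most h^2 / 2; phi' varies by at most c / 2
   over one step; the boundary edges lie where the sign of psi' is known. *)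
set (h0 := Rmin (/ (4 * (b3 + 1))) (Rmin (c / (2 * (b2 + 1))) (r / 2))).
set (cg := Rmin (/ 4) (c ^ 2 / 2)).
assert (cg1 : 0 < cg) by (apply Rmin_glb_lt; lra).
assert (cg2 : cg <= / 4) by apply Rmin_l. assert (cg3 : cg <= c ^ 2 / 2) by apply Rmin_r.
exists G0, cg, h0, kap. split; [lra|split].
{ unfold h0. repeat apply Rmin_glb_lt.
  - apply Rinv_0_lt_compat; lra.
  - apply Rdiv_lt_0_compat; lra.
  - lra. }
intros G N HG HN Hh.
set (h := hstep L N) in *.
assert (iN : 1 <= INR (N + 1)) by (apply (le_INR 1); lia).
assert (hN : INR (N + 1) * h = L) by (unfold h, hstep; field; lra).
assert (hpos : 0 < h) by (apply Rdiv_lt_0_compat; lra).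
assert (hb3 : 2 * b3 * h <= / 2).
{ assert (Y : h <= / (4 * (b3 + 1))) by (apply Rle_trans with (1 := Hh), Rmin_l).
  apply Rmult_le_compat_l with (r := 2 * (b3 + 1)) in Y; [|lra].
  replace (2 * (b3 + 1) * / (4 * (b3 + 1))) with (/ 2) in Y by (field; lra). lra. }
assert (hb2 : b2 * h <= c / 2).
{ assert (Y : h <= c / (2 * (b2 + 1))).
  { apply Rle_trans with (1 := Hh), Rle_trans with (1 := Rmin_r _ _), Rmin_l. }
  apply Rmult_le_compat_l with (r := b2 + 1) in Y; [|lra].
  replace ((b2 + 1) * (c / (2 * (b2 + 1)))) with (c / 2) in Y by (field; lra). lra. }
assert (hr : h < r).
{ assert (Y : h <= r / 2) by (apply Rle_trans with (1 := Hh), Rle_trans with (1 := Rmin_r _ _), Rmin_r). lra. }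
assert (xpS : forall j, xp L N (S j) = xp L N j + h) by (intros j; unfold xp; fold h; rewrite S_INR; ring).
assert (xdE : forall j, xd L N j = xp L N j + h / 2) by (intros j; unfold xd, xp; fold h; field).
assert (xp0 : xp L N 0 = 0) by (unfold xp; simpl; ring).
assert (xpL : xp L N (S N) = L) by (unfold xp; fold h; replace (S N) with (N + 1)%nat by lia; exact hN).
assert (xpr : forall j, (j <= S N)%nat -> 0 <= xp L N j <= L).
{ intros j Hj. split.
  - apply Rmult_le_pos; [apply pos_INR|fold h; lra].
  - apply Rle_trans with (INR (N + 1) * h); [|lra]. unfold xp. fold h.
    apply Rmult_le_compat_r; [lra|]. apply le_INR. lia. }
assert (h2 : 0 < h ^ 2) by (apply pow_lt; lra).
assert (sd : forall j, (j < N)%nat ->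
   Rabs (sdiff (fun i => phi (xp L N i)) j - h ^ 2 * f2 (xp L N (S j))) <= h ^ 2 / 2).
{ intros j Hj. assert (R0 := xpr j ltac:(lia)). assert (R2 := xpr (S (S j)) ltac:(lia)).
  assert (E1 := xpS j). assert (E2 := xpS (S j)).
  assert (Y := second_difference_taylor phi f1 f2 f3 b3 0 L (xp L N (S j)) h D1 D2 D3 B3b hpos ltac:(lra) ltac:(lra)).
  rewrite <- E2 in Y. replace (xp L N (S j) - h) with (xp L N j) in Y by lra.
  unfold sdiff. apply Rle_trans with (1 := Y).
  replace (2 * b3 * h ^ 3) with ((2 * b3 * h) * h ^ 2) by ring.
  apply Rmult_le_compat_r with (r := h ^ 2) in hb3; lra. }
assert (sdB : forall j, (j < N)%nat -> Rabs (sdiff (fun i => phi (xp L N i)) j) <= (b2 + 1) * h ^ 2).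
{ intros j Hj. assert (Y := sd j Hj). assert (Y2 := B2b (xp L N (S j)) (xpr (S j) ltac:(lia))).
  apply Rabs_le_between in Y. apply Rabs_le_between in Y2.
  assert (Z1 : h ^ 2 * f2 (xp L N (S j)) <= h ^ 2 * b2) by (apply Rmult_le_compat_l; lra).
  assert (Z2 : h ^ 2 * (- b2) <= h ^ 2 * f2 (xp L N (S j))) by (apply Rmult_le_compat_l; lra).
  apply Rabs_le. lra. }
assert (lip : forall x y d, 0 <= x <= L -> 0 <= y <= L -> Rabs (x - y) <= d -> Rabs (phi x - phi y) <= b1 * d).
{ intros x y d Hx Hy Hd. apply Rle_trans with (1 := abs_diff_le_of_derive phi f1 b1 0 L x y D1 B1b Hx Hy).
  apply Rmult_le_compat_l; lra. }
assert (Gb1 : b1 * h <= G * h) by (apply Rmult_le_compat_r; unfold G0 in HG; lra).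
split.
- constructor.
  + intros j Hj. apply Rle_trans with (2 := Gb1). apply lip; try (apply xpr; lia).
    rewrite xpS. replace (xp L N j + h - xp L N j) with h by ring. rewrite Rabs_right; lra.
  + intros j Hj. apply Rle_trans with (1 := sdB j Hj). apply Rmult_le_compat_r; [lra|]. unfold G0 in HG. lra.
  + intros j Hj. assert (Y := sd j Hj). apply Rabs_le_between in Y.
    assert (Y1 := conv (xp L N (S j)) (xpr (S j) ltac:(lia))).
    apply Rmult_le_compat_l with (r := h ^ 2) in Y1; [|lra].
    assert (2 * cg * h ^ 2 <= / 2 * h ^ 2) by (apply Rmult_le_compat_r; lra). fold phi. lra.
  + intros j Hj. unfold indic. destruct (excluded_middle_informative (B (xp L N (S j)))) as [HB|HnB]; [left; reflexivity|right].
    assert (Rj := xpr (S j) ltac:(lia)).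
    destruct (obs (xp L N (S j)) Rj ltac:(intros HH; apply HnB, HB0, HH)) as [O1 O2].
    assert (Y := sd j Hj). apply Rabs_le_between in Y.
    apply Rmult_le_compat_l with (r := h ^ 2) in O1; [|lra].
    assert (Z1 : cg * h ^ 2 <= / 4 * h ^ 2) by (apply Rmult_le_compat_r; lra).
    assert (Z2 : 0 <= h ^ 2 * (kap * exp (lam * psi (xp L N (S j))))).
    { assert (Y1 := e1 _ Rj). apply Rmult_le_pos; [lra|]. apply Rmult_le_pos; lra. }
    fold phi. split; [lra|split; [lra|]].
    assert (R0 := xpr j ltac:(lia)). assert (R2 := xpr (S (S j)) ltac:(lia)).
    assert (E1 := xpS j). assert (E2 := xpS (S j)).
    destruct (mvt_is_derive phi f1 (xp L N j) (xp L N (S (S j)))) as (k & Hk & Ek); [lra|intros t Ht; apply D1; lra|].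
    rewrite Ek. replace (xp L N (S (S j)) - xp L N j) with (2 * h) by lra.
    assert (Lf : Rabs (f1 k - f1 (xp L N (S j))) <= b2 * h).
    { apply Rle_trans with (1 := abs_diff_le_of_derive f1 f2 b2 0 L k (xp L N (S j)) D2 B2b ltac:(lra) ltac:(lra)).
      apply Rmult_le_compat_l; [lra|]. apply Rabs_le. lra. }
    assert (f1k : c / 2 <= Rabs (f1 k)).
    { assert (T := Rabs_triang_inv (f1 (xp L N (S j))) (f1 k)). rewrite Rabs_minus_sym in T. lra. }
    rewrite Rpow_mult_distr, <- (pow2_abs (f1 k)).
    assert ((c / 2) ^ 2 <= Rabs (f1 k) ^ 2) by (apply pow_incr; lra).
    replace ((2 * h) ^ 2) with (4 * h ^ 2) by ring.
    apply Rle_trans with ((c / 2) ^ 2 * (4 * h ^ 2)).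
    * replace ((c / 2) ^ 2 * (4 * h ^ 2)) with (c ^ 2 * h ^ 2) by field. apply Rmult_le_compat_r; lra.
    * apply Rmult_le_compat_r; lra.
  + intros j. unfold indic. destruct (excluded_middle_informative _); lra.
  + intros j Hj. assert (Rj := xpr j Hj). assert (Y := e1 _ Rj). assert (Z := B0b _ Rj).
    apply Rabs_le_between in Z. unfold phi, varphi in Z. fold X in Z.
    split; [apply Rmult_le_pos; lra|].
    apply Rle_trans with (kap * (b0 + X)); [apply Rmult_le_compat_l; lra|unfold G0 in HG; lra].
  + intros j Hj.
    (* The multiplier is kap times the weight up to an additive constant, so it needs no estimates
       of its own. *)
    replace (sdiff (fun i => kap * exp (lam * psi (xp L N i))) j) with (kap * sdiff (fun i => phi (xp L N i)) j)
      by (unfold sdiff, phi, varphi; ring).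
    rewrite Rabs_mult, (Rabs_right kap) by lra.
    apply Rle_trans with (kap * ((b2 + 1) * h ^ 2)); [apply Rmult_le_compat_l; [lra|apply sdB, Hj]|].
    rewrite <- Rmult_assoc. apply Rmult_le_compat_r; [lra|]. unfold G0 in HG. lra.
  + fold phi. rewrite xp0. replace (xp L N 1) with h by (rewrite xpS, xp0; ring).
    assert (R1 := xpr 1%nat ltac:(lia)). rewrite xpS, xp0 in R1.
    destruct (mvt_is_derive phi f1 0 h hpos) as (k & Hk & Ek); [intros t Ht; apply D1; lra|].
    assert (Y := Hleft k ltac:(lra) ltac:(rewrite Rabs_right; lra)).
    assert (0 <= f1 k).
    { unfold f1, varphi1. assert (Y1 := e1 k ltac:(lra)). apply Rmult_le_pos; [apply Rmult_le_pos|]; lra. }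
    assert (0 <= f1 k * (h - 0)) by (apply Rmult_le_pos; lra). lra.
  + fold phi. rewrite xpL. assert (E := xpS N). rewrite xpL in E.
    assert (RN := xpr N ltac:(lia)).
    destruct (mvt_is_derive phi f1 (xp L N N) L ltac:(lra)) as (k & Hk & Ek); [intros t Ht; apply D1; lra|].
    assert (Y := Hright k ltac:(lra) ltac:(rewrite Rabs_left; lra)).
    assert (0 <= - f1 k).
    { unfold f1, varphi1. assert (Y1 := e1 k ltac:(lra)).
      replace (- (lam * Derive psi k * exp (lam * psi k))) with (lam * (- Derive psi k) * exp (lam * psi k)) by ring.
      apply Rmult_le_pos; [apply Rmult_le_pos|]; lra. }
    assert (0 <= - f1 k * (L - xp L N N)) by (apply Rmult_le_pos; lra). lra.
  + intros j Hj. apply Rle_trans with (1 := B0b _ (xpr j Hj)). unfold G0 in HG. lra.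
- intros j Hj. fold phi. assert (R0 := xpr j ltac:(lia)). assert (R1 := xpr (S j) ltac:(lia)).
  assert (E := xpS j). rewrite xdE. split; apply Rle_trans with (2 := Gb1); apply lip; try lra; apply Rabs_le; lra.
Qed.

(** * The Carleman estimate *)

Lemma iint_sumR T M F : iint T M F = sumR (fun m => dtstep T M * F (S m)) M.
Proof. unfold iint, sum_range. replace (S M - 1)%nat with M by lia. reflexivity. Qed.

Lemma int_p_sumR L N F : int_p L N F = hstep L N * sumR (fun j => F (S j)) N.
Proof.
unfold int_p, sum_range. replace (S N - 1)%nat with N by lia.
rewrite <- sumR_scal. reflexivity.
Qed.

Lemma int_d_sumR L N F : int_d L N F = hstep L N * sumR F (S N).
Proof.
unfold int_d, sum_range. replace (S N - 0)%nat with (S N) by lia.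
rewrite <- sumR_scal. reflexivity.
Qed.

Lemma int_pB_sumR L N B F :
  int_pB L N B F = hstep L N * sumR (fun j => indic (B (xp L N (S j))) * F (S j)) N.
Proof.
unfold int_pB, sum_range. replace (S N - 1)%nat with N by lia.
rewrite <- sumR_scal. apply sumR_ext. intros j _. apply Rmult_assoc.
Qed.

Lemma residual_conj L T N M q ph z z' s s' m j :
  (forall i, (j <= i <= S (S j))%nat -> z i = exp (s * ph i) * q m i) ->
  z' (S j) = exp (s' * ph (S j)) * q (S m) (S j) -> dtstep T M <> 0 ->
  residual (hstep L N) (dtstep T M) s s' ph z z' j = exp (s * ph (S j)) * Lop L T N M q (S m) (S j).
Proof.
intros Hz Hz' Hdt. unfold residual, Lop, Dtb. rewrite <- (conj_lap s ph (q m) z L N j Hz).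
replace (S m - 1)%nat with m by lia.
rewrite Hz', (Hz (S j)) by lia.
replace (exp ((s - s') * ph (S j)) * (exp (s' * ph (S j)) * q (S m) (S j)))
  with (exp (s * ph (S j)) * q (S m) (S j)).
- field. exact Hdt.
- rewrite <- Rmult_assoc, <- exp_plus. f_equal. f_equal. ring.
Qed.

Theorem theorem1p1 :
  exists k : nat,
  forall (L T : R) (B0 B : R -> Prop) (psi : R -> R) (a b c K : R),
    0 < L -> 0 < T ->
    (* B0 : nonempty open subset of Omega = (0,L) *)
    open B0 -> (exists x, B0 x) -> (forall x, B0 x -> 0 < x < L) ->
    (* B : open subset of Omega with B0 compactly contained in B *)
    open B -> (forall x, B x -> 0 < x < L) -> compactly_contained B0 B ->
    (* standing weight assumption on tilde-Omega = (a,b) containing [0,L] *)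
    a < 0 -> L < b ->
    Ck_on k a b psi ->
    (forall x, a < x < b -> 0 < psi x) ->
    0 < c ->
    (forall x, a < x < b -> ~ B0 x -> c <= Rabs (Derive psi x)) ->
    (exists r, 0 < r /\
       (forall x, a < x < b -> Rabs x < r -> c <= Derive psi x) /\
       (forall x, a < x < b -> Rabs (x - L) < r -> Derive psi x <= - c)) ->
    (* K > ||psi||_{C([0,L])} *)
    (forall x, 0 <= x <= L -> Rabs (psi x) < K) ->
    exists lam1 : R, 1 <= lam1 /\
    forall lam : R, lam1 <= lam ->
    exists (C tau0 h0 eps0 : R),
      0 < C /\ 1 <= tau0 /\ 0 < h0 /\ 0 < eps0 /\
      forall (tau delta : R) (N M : nat) (q : nat -> nat -> R),
        (1 <= N)%nat -> (1 <= M)%nat ->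
        let h := hstep L N in
        let dt := dtstep T M in
        tau0 * (T + T ^ 2) <= tau ->
        0 < h -> h <= h0 ->
        0 < dt ->
        0 < delta -> delta <= / 2 ->
        tau ^ 4 * dt / (delta ^ 4 * T ^ 6) <= eps0 ->
        tau * h / (delta * T ^ 2) <= eps0 ->
        (forall n, (n <= M - 1)%nat -> q n O = 0 /\ q n (N + 1)%nat = 0) ->
        let w := fun (p : Z) (n : nat) (x : R) =>
                   wgt psi lam K T delta tau p (thalf T M (n - 1)) x in
        / tau * iint T M (fun n => int_p L N (fun i =>
              w (-1)%Z n (xp L N i) *
              (Dtb T M q n i ^ 2 + lap L N (tbm q n) i ^ 2)))
        + tau * iint T M (fun n => int_d L N (fun i =>
              w 1%Z n (xd L N i) * dh L N (tbm q n) i ^ 2))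
        + tau * iint T M (fun n => int_p L N (fun i =>
              w 1%Z n (xp L N i) * dhbar L N (tbm q n) i ^ 2))
        + tau ^ 3 * iint T M (fun n => int_p L N (fun i =>
              w 3%Z n (xp L N i) * tbm q n i ^ 2))
        <=
        C * ( iint T M (fun n => int_p L N (fun i =>
                 w 0%Z n (xp L N i) * Lop L T N M q n i ^ 2))
              + tau ^ 3 * iint T M (fun n => int_pB L N B (fun i =>
                 w 3%Z n (xp L N i) * tbm q n i ^ 2)) )
        + C * / h ^ 2 *
          ( int_p L N (fun i =>
              (exp (tau * theta T delta (thalf T M 0) * varphi psi lam K (xp L N i))
               * q O i) ^ 2)
          + int_p L N (fun i =>
              (exp (tau * theta T delta (thalf T M M) * varphi psi lam K (xp L N i))
               * q M i) ^ 2) ).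
Proof.
(* Three derivatives of psi bound the Taylor error in the second differences of the weight. *)
exists 3%nat.
intros L T B0 B psi a b c K HL HT _ _ _ _ _ [_ Hcc] Ha Hb Hck Hpos Hc Hgrad (r & Hr & Hleft & Hright) _.
assert (HB0 : forall x, B0 x -> B x).
{ intros x Hx. apply Hcc. intros e He. exists x. split; [exact Hx|]. rewrite Rminus_diag, Rabs_R0. exact He. }
destruct (exists_grid_weight L B0 B psi a b c K r HL HB0 Ha Hb Hck Hpos Hc Hgrad Hr Hleft Hright)
  as (lam1 & Hlam1 & Hw).
exists lam1. split; [exact Hlam1|]. intros lam Hlam.
destruct (Hw lam Hlam) as (G0 & cg & h0 & kap & Hcg & Hh0 & Hgw). clear Hw.
assert (T2 : 0 < T ^ 2) by (apply pow_lt; lra).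
(* 4 T and 12 T^2 are the constants in the first and second differences of theta. *)
set (G := 1 + Rabs G0 + 4 * T + 12 * T ^ 2).
assert (HG0 : G0 <= G) by (assert (Y := Rle_abs G0); unfold G; lra).
assert (HG1 : 1 <= G) by (assert (Y := Rabs_pos G0); unfold G; lra).
assert (HG4 : 4 * T <= G) by (assert (Y := Rabs_pos G0); unfold G; lra).
assert (HG12 : 12 * T ^ 2 <= G) by (assert (Y := Rabs_pos G0); unfold G; lra).
clearbody G.
destruct (carl_eps_facts G cg HG1 Hcg) as [eps0 Geps].
destruct (carl_big_facts G cg HG1 Hcg) as [big0 _].
assert (cg2 : 0 < cg ^ 2 <= 1) by nra.
assert (G4 : 1 <= G ^ 4) by (replace 1 with (1 ^ 4) by ring; apply pow_incr; lra).
(* Chosen so that [K' * (cg ^ 2 / 8)] is the 500 G^4 of [slice_estimate]; it also exceeds what its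
   term 9 X^2 requires. *)
set (K' := 4000 * G ^ 4 / cg ^ 2).
assert (K'1 : 4000 <= K') by (apply Rle_div_r_pos; nra).
set (Gam := (20 * G ^ 2) ^ 2).
assert (Gam1 : 1 <= Gam) by (unfold Gam; replace ((20 * G ^ 2) ^ 2) with (400 * G ^ 4) by ring; lra).
set (C := 2 + 12 * (K' * Gam)).
assert (KG : K' <= K' * Gam) by (rewrite <- (Rmult_1_r K') at 1; apply Rmult_le_compat_l; lra).
set (big := carl_big G cg) in *. set (eps := carl_eps G cg) in *.
assert (bT : 0 < big / T) by (apply Rdiv_lt_0_compat; lra).
(* [big] in tau0 makes tau theta large and [big / T] makes tau itself large; [/ T] is what bounds
   [dt] by delta T / 8. *)
exists C, (1 + big + big / T), (Rmin h0 1), (Rmin eps (Rmin (eps * T ^ 2) (/ T))).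
split; [unfold C; lra|]. split; [lra|]. split; [apply Rmin_glb_lt; lra|].
assert (iT : 0 < / T) by (apply Rinv_0_lt_compat; lra).
assert (eT : 0 < eps * T ^ 2) by (apply Rmult_lt_0_compat; lra).
split; [repeat apply Rmin_glb_lt; lra|].
intros tau delta N M q HN HM h dt Htau Hh Hhh _ Hdel Hdel2 Hdt Hth Hq w.
set (e0 := Rmin eps (Rmin (eps * T ^ 2) (/ T))) in *.
assert (e0pos : 0 < e0) by (repeat apply Rmin_glb_lt; lra).
assert (e01 : e0 <= eps) by apply Rmin_l.
assert (e02 : e0 <= eps * T ^ 2) by (apply Rle_trans with (1 := Rmin_r _ _), Rmin_l).
assert (e03 : e0 * T <= 1).
{ assert (Y : e0 <= / T) by (apply Rle_trans with (1 := Rmin_r _ _), Rmin_r).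
  apply Rmult_le_compat_r with (r := T) in Y; [|lra]. rewrite Rinv_l in Y by lra. exact Y. }
assert (h1 : 0 < h <= 1) by (split; [exact Hh|apply Rle_trans with (1 := Hhh), Rmin_r]).
assert (hh0 : h <= h0) by (apply Rle_trans with (1 := Hhh), Rmin_l).
set (t0 := 1 + big + big / T) in *.
assert (t0T : big <= t0 * T).
{ assert (big / T * T = big) by (field; lra). assert (0 < (1 + big) * T) by (apply Rmult_lt_0_compat; lra).
  unfold t0. lra. }
destruct (theta_time_weight G cg T delta tau t0 e0 h M HG1 Hcg HT ltac:(lra) HM Hh HG4 HG12
  ltac:(unfold t0; lra) ltac:(unfold t0; fold big; lra) t0T Htau e0pos e01 e02 e03 Hdt Hth)
  as (dt0 & thpos & TW).
fold dt in dt0, TW.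
destruct (Hgw G N HG0 HN hh0) as [W Hphd]. fold h in W, Hphd.
set (ph := fun i => varphi psi lam K (xp L N i)) in *.
set (phd := fun i => varphi psi lam K (xd L N i)).
set (th := fun m => theta T delta (thalf T M m)) in *.
set (s := fun m => tau * th m) in *.
set (o := fun i => indic (B (xp L N i))) in *.
(* The boundary values of q are prescribed only for n < M. Setting z to 0 there makes the summations
   by parts valid at level M too; at that level the estimate sees interior values only. *)
set (z := fun m i => if andb (1 <=? i)%nat (i <=? N)%nat then exp (s m * ph i) * q m i else 0).
assert (Zin : forall m i, (1 <= i <= N)%nat -> z m i = exp (s m * ph i) * q m i).
{ intros m i Hi. unfold z. destruct (Nat.leb_spec 1 i); [|lia]. destruct (Nat.leb_spec i N); [|lia]. reflexivity. }
assert (Zbd : forall m, z m O = 0 /\ z m (S N) = 0).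
{ intros m. split; [reflexivity|]. unfold z. destruct (Nat.leb_spec (S N) N); [lia|]. reflexivity. }
assert (Zall : forall m i, (m < M)%nat -> (i <= S N)%nat -> z m i = exp (s m * ph i) * q m i).
{ intros m i Hm Hi. destruct (Hq m ltac:(lia)) as [q0 qN].
  destruct (Nat.eq_dec i 0) as [->|]; [rewrite (proj1 (Zbd m)), q0; ring|].
  destruct (Nat.eq_dec i (S N)) as [->|].
  - rewrite (proj2 (Zbd m)). replace (S N) with (N + 1)%nat by lia. rewrite qN. ring.
  - apply Zin. lia. }
assert (tT : big <= tau).
{ apply Rle_trans with (1 := t0T), Rle_trans with (2 := Htau). apply Rmult_le_compat_l; unfold t0; lra. }
assert (Core := conjugated_carleman G cg h dt tau N M ph _ o s z HG1 Hcg h1 dt0 HM tT TW W Zbd).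
cbv zeta in Core. fold Gam in Core.
set (g2 := fun m j => residual h dt (s m) (s (S m)) ph (z m) (z (S m)) j ^ 2).
set (X2 := fun m j => xop h (s m) ph (acoef dt (s m) (s (S m)) ph) (z m) j ^ 2).
set (E2 := fun m j => s m ^ 3 * z m (S j) ^ 2 + s m * edges h (z m) j).
set (O2 := fun m j => o (S j) * (s m ^ 3 * z m (S j) ^ 2)).
assert (spos : forall m, (m < M)%nat -> 80000 <= s m).
{ intros m Hm. apply Rle_trans with (1 := big0), (tw_low _ _ _ _ _ _ _ _ TW m Hm). }
assert (Slices : sumR (fun m => dt * (
    / tau * sumR (fun j => exp (2 * s m * ph (S j)) * / th m *
       (((q (S m) (S j) - q m (S j)) / dt) ^ 2 + lap L N (q m) (S j) ^ 2)) N
  + tau * sumR (fun j => exp (2 * s m * phd j) * th m * dh L N (q m) j ^ 2) (S N)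
  + tau * sumR (fun j => exp (2 * s m * ph (S j)) * th m * dhbar L N (q m) (S j) ^ 2) N
  + tau ^ 3 * sumR (fun j => exp (2 * s m * ph (S j)) * th m ^ 3 * q m (S j) ^ 2) N)) M
  <= 2 * sumR (fun m => dt * sumR (g2 m) N)
       M + K' * sumR (fun m => dt * sumR (fun j => 3 / 4 * X2 m j + cg ^ 2 / 8 * E2 m j) N) M).
{ rewrite <- !sumR_scal, <- sumR_plus. apply sumR_le. intros m Hm.
  replace (2 * (dt * sumR (g2 m) N) + K' * (dt * sumR (fun j => 3 / 4 * X2 m j + cg ^ 2 / 8 * E2 m j) N))
    with (dt * (2 * sumR (g2 m) N + K' * sumR (fun j => 3 / 4 * X2 m j + cg ^ 2 / 8 * E2 m j) N)) by ring.
  apply Rmult_le_compat_l; [lra|].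
  assert (sm := spos m Hm).
  assert (shm : G * (s m * h) <= 1).
  { assert (Y := tw_h _ _ _ _ _ _ _ _ TW m Hm). fold eps in Y.
    assert (Y1 : G * (s m * h) <= G ^ 6 * eps).
    { apply Rmult_le_compat; [lra|apply Rmult_le_pos; lra| |exact Y].
      replace (G ^ 6) with (G * (G * G ^ 4)) by ring.
      rewrite <- (Rmult_1_r G) at 1. apply Rmult_le_compat_l; [lra|]. nra. }
    lra. }
  eapply Rle_trans.
  - apply (slice_estimate G L T dt tau (th m) (th (S m)) N M ph phd (q m) (q (S m)) (z m) (z (S m)));
      fold h; try assumption.
    + lra.
    + apply thpos. lia.
    + change (tau * th m) with (s m). lra.
    + apply (tw_next _ _ _ _ _ _ _ _ TW m Hm).
    + apply (gw_diff _ _ _ _ _ _ _ W).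
    + apply (gw_sdiff _ _ _ _ _ _ _ W).
    + apply (gw_bound _ _ _ _ _ _ _ W).
    + apply Zbd.
    + intros i Hi. apply Zall; assumption.
    + intros i Hi. apply Zin, Hi.
  - fold h. change (tau * th m) with (s m). change (tau * th (S m)) with (s (S m)).
    rewrite <- !sumR_scal, <- sumR_plus. apply sumR_le. intros j Hj.
    change (residual h dt (s m) (s (S m)) ph (z m) (z (S m)) j ^ 2) with (g2 m j).
    change (xop h (s m) ph (acoef dt (s m) (s (S m)) ph) (z m) j ^ 2) with (X2 m j).
    change (s m ^ 3 * z m (S j) ^ 2 + s m * edges h (z m) j) with (E2 m j).
    assert (X0 : 0 <= X2 m j) by apply pow2_ge_0.
    assert (E0 : 0 <= E2 m j).
    { apply Rplus_le_le_0_compat; apply Rmult_le_pos; try lra.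
      - apply pow_le; lra.
      - apply pow2_ge_0.
      - apply edges_ge0. }
    assert (EQ : K' * (cg ^ 2 / 8 * E2 m j) = 500 * G ^ 4 * E2 m j) by (unfold K'; field; lra).
    assert (4000 * X2 m j <= K' * X2 m j) by (apply Rmult_le_compat_r; lra).
    lra. }
assert (RHS1 : sumR (fun m => dt * sumR (fun j => 3 * g2 m j
     + 12 * Gam * o (S j) * (s m ^ 3 * z m (S j) ^ 2)) N) M =
   3 * sumR (fun m => dt * sumR (g2 m) N) M + 12 * Gam * sumR (fun m => dt * sumR (O2 m) N) M).
{ rewrite <- !sumR_scal, <- sumR_plus. apply sumR_ext. intros m Hm.
  rewrite (sumR_ext _ (fun j => 3 * g2 m j + 12 * Gam * O2 m j)).
  - rewrite sumR_plus, !sumR_scal. ring.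
  - intros j _. unfold O2. ring. }
assert (Wg : forall p m x, w p (S m) x = exp (2 * s m * varphi psi lam K x) * powerRZ (th m) p).
{ intros p m x. unfold w, wgt. replace (S m - 1)%nat with m by lia. fold (th m).
  f_equal. f_equal. unfold s. ring. }
assert (L1 : forall k F1 F2, (forall m, (m < M)%nat -> F1 (S m) = h * F2 m) ->
   k * iint T M F1 = h * sumR (fun m => dt * (k * F2 m)) M).
{ intros k F1 F2 HF. rewrite iint_sumR, <- !sumR_scal. fold dt. apply sumR_ext. intros m Hm. rewrite (HF m Hm). ring. }
rewrite (L1 (/ tau) _ (fun m => sumR (fun j => exp (2 * s m * ph (S j)) * / th m *
       (((q (S m) (S j) - q m (S j)) / dt) ^ 2 + lap L N (q m) (S j) ^ 2)) N)).
2:{ intros m Hm. rewrite int_p_sumR. fold h. f_equal. apply sumR_ext. intros j _. rewrite Wg.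
    unfold Dtb, tbm. replace (S m - 1)%nat with m by lia. fold dt. f_equal. f_equal.
    simpl. rewrite Rmult_1_r. reflexivity. }
rewrite (L1 tau _ (fun m => sumR (fun j => exp (2 * s m * phd j) * th m * dh L N (q m) j ^ 2) (S N))).
2:{ intros m Hm. rewrite int_d_sumR. fold h. f_equal. apply sumR_ext. intros j _. rewrite Wg.
    unfold tbm. replace (S m - 1)%nat with m by lia. rewrite powerRZ_1. reflexivity. }
rewrite (L1 tau _ (fun m => sumR (fun j => exp (2 * s m * ph (S j)) * th m * dhbar L N (q m) (S j) ^ 2) N)).
2:{ intros m Hm. rewrite int_p_sumR. fold h. f_equal. apply sumR_ext. intros j _. rewrite Wg.
    unfold tbm. replace (S m - 1)%nat with m by lia. rewrite powerRZ_1. reflexivity. }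
rewrite (L1 (tau ^ 3) (fun n => int_p L N (fun i => w 3%Z n (xp L N i) * tbm q n i ^ 2))
  (fun m => sumR (fun j => exp (2 * s m * ph (S j)) * th m ^ 3 * q m (S j) ^ 2) N)).
2:{ intros m Hm. rewrite int_p_sumR. fold h. f_equal. apply sumR_ext. intros j _. rewrite Wg.
    unfold tbm. replace (S m - 1)%nat with m by lia. reflexivity. }
(* [O2] already contains tau^3 through s^3, so the prefactor is compensated by [/ tau ^ 3]. *)
rewrite (L1 (tau ^ 3) (fun n => int_pB L N B (fun i => w 3%Z n (xp L N i) * tbm q n i ^ 2))
  (fun m => / tau ^ 3 * sumR (O2 m) N)).
2:{ intros m Hm. rewrite int_pB_sumR. fold h. f_equal. rewrite <- sumR_scal. apply sumR_ext. intros j Hj. rewrite Wg.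
    unfold tbm, O2. replace (S m - 1)%nat with m by lia. rewrite (Zin m (S j)) by lia.
    rewrite Rpow_mult_distr, exp_sq. change (powerRZ (th m) 3) with (th m ^ 3).
    change (varphi psi lam K (xp L N (S j))) with (ph (S j)). change (indic (B (xp L N (S j)))) with (o (S j)).
    replace (2 * (s m * ph (S j))) with (2 * s m * ph (S j)) by ring.
    replace (s m ^ 3) with (tau ^ 3 * th m ^ 3) by (unfold s; ring). field. lra. }
assert (RG : iint T M (fun n => int_p L N (fun i => w 0%Z n (xp L N i) * Lop L T N M q n i ^ 2))
   = h * sumR (fun m => dt * sumR (g2 m) N) M).
{ rewrite iint_sumR, <- sumR_scal. fold dt. apply sumR_ext. intros m Hm. rewrite int_p_sumR. fold h.
  replace (h * (dt * sumR (g2 m) N)) with (dt * (h * sumR (g2 m) N)) by ring.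
  f_equal. f_equal. apply sumR_ext. intros j Hj. rewrite Wg. unfold g2.
  assert (RC := residual_conj L T N M q ph (z m) (z (S m)) (s m) (s (S m)) m j
    ltac:(intros i Hi; apply Zall; lia) ltac:(apply Zin; lia) ltac:(fold dt; lra)).
  fold h dt in RC. rewrite RC.
  rewrite Rpow_mult_distr, exp_sq. change (varphi psi lam K (xp L N (S j))) with (ph (S j)).
  replace (2 * (s m * ph (S j))) with (2 * s m * ph (S j)) by ring. simpl powerRZ. ring. }
rewrite RG.
assert (End : forall m, int_p L N (fun i => (exp (tau * theta T delta (thalf T M m) * varphi psi lam K (xp L N i))
               * q m i) ^ 2) = h * sumR (fun j => z m (S j) ^ 2) N).
{ intros m. rewrite int_p_sumR. fold h. f_equal. apply sumR_ext. intros j Hj. rewrite Zin by lia. reflexivity. }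
rewrite !End.
rewrite <- !Rmult_plus_distr_l.
change (sumR (fun m => dt * sumR (fun j => 3 / 4 * X2 m j + cg ^ 2 / 8 * E2 m j) N) M <=
  sumR (fun m => dt * sumR (fun j => 3 * g2 m j + 12 * Gam * o (S j) * (s m ^ 3 * z m (S j) ^ 2)) N) M
  + 9 / h ^ 2 * (sumR (fun j => z O (S j) ^ 2) N + sumR (fun j => z M (S j) ^ 2) N)) in Core.
rewrite RHS1 in Core.
set (SG := sumR (fun m => dt * sumR (g2 m) N) M) in *.
set (SO := sumR (fun m => dt * sumR (O2 m) N) M) in *.
set (SE := sumR (fun j => z 0%nat (S j) ^ 2) N + sumR (fun j => z M (S j) ^ 2) N) in *.
assert (EO : sumR (fun m => dt * (tau ^ 3 * (/ tau ^ 3 * sumR (O2 m) N))) M = SO).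
{ apply sumR_ext. intros m _. field. lra. }
rewrite EO.
assert (SG0 : 0 <= SG).
{ apply sumR_ge0. intros m Hm. apply Rmult_le_pos; [lra|]. apply sumR_ge0. intros j Hj. apply pow2_ge_0. }
assert (SO0 : 0 <= SO).
{ apply sumR_ge0. intros m Hm. apply Rmult_le_pos; [lra|]. apply sumR_ge0. intros j Hj.
  assert (sm := spos m Hm). apply Rmult_le_pos; [apply (gw_obs_pos _ _ _ _ _ _ _ W)|].
  apply Rmult_le_pos; [apply pow_le; lra|apply pow2_ge_0]. }
assert (SE0 : 0 <= SE) by (apply Rplus_le_le_0_compat; apply sumR_ge0; intros; apply pow2_ge_0).
apply Rle_trans with (h * (2 * SG + K' * (3 * SG + 12 * Gam * SO + 9 / h ^ 2 * SE))).
- apply Rmult_le_compat_l; [lra|].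
  apply Rmult_le_compat_l with (r := K') in Core; [|lra].
  eapply Rle_trans; [|eapply Rle_trans; [exact Slices|lra]].
  rewrite <- !sumR_plus. right. apply sumR_ext. intros m _. ring.
- replace (C * (h * (SG + SO)) + C * / h ^ 2 * (h * SE)) with (h * (C * SG + C * SO + C * / h ^ 2 * SE)) by ring.
  apply Rmult_le_compat_l; [lra|].
  assert (ih : 0 < / h ^ 2) by (apply Rinv_0_lt_compat, pow_lt; lra).
  assert (ihE : 0 <= / h ^ 2 * SE) by (apply Rmult_le_pos; lra).
  assert (P1 : (2 + K' * 3) * SG <= C * SG) by (apply Rmult_le_compat_r; unfold C; lra).
  assert (P2 : (12 * (K' * Gam)) * SO <= C * SO) by (apply Rmult_le_compat_r; unfold C; lra).
  assert (P3 : (9 * K') * (/ h ^ 2 * SE) <= C * (/ h ^ 2 * SE)) by (apply Rmult_le_compat_r; unfold C; lra).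
  unfold Rdiv. lra.
Qed.
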